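(* Let $K\ge2$, $a\ge0$, $b>aK$, and set $\tilde a_1=a-b$, $\tilde a_i=a$ for $i=2,\dots,K$. Let $\hat{\mathbf Z}^n$ be the gap process described in the context and write $\hat{\mathbf Z}^n_c=(\hat Z^n_2,\dots,\hat Z^n_K)'$. Then: (i) there exist $n_0\in\mathbb{N}$ and, for every $n\ge n_0$, an $\mathbb{R}_+^{K-1}$-valued random variable $\hat{\mathbf Z}^n_c(\infty)$ such that $\hat{\mathbf Z}^n_c(t)\Rightarrow\hat{\mathbf Z}^n_c(\infty)$ as $t\to\infty$; (ii) as $n\to\infty$, $\hat{\mathbf Z}^n_c(\infty)\Rightarrow\mathbf Z_c(\infty)=(Z_2(\infty),\dots,Z_K(\infty))'$, where $\mathbf Z_c(\infty)$ has the product law $\bigotimes_{i=1}^{K-1}\mathrm{Exp}\big(\frac{K-i}{K}b\big)$, i.e. $Z_{i+1}(\infty)$, $i=1,\dots,K-1$, are independent Exponential random variables with rates $\frac{K-i}{K}b$.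
   Context: Model. Only integers $n>\max_l(\max(\tilde a_l,0))^2$ are considered. Let $A_1,\dots,A_K,D_1,\dots,D_K$ be mutually independent rate-one Poisson processes, and $X^n_1(0)\le\cdots\le X^n_K(0)$ nonnegative-integer random variables independent of them. The ranked queue-length process $\mathbf X^n=(X^n_1,\dots,X^n_K)'$ solves $$X^n_i(t)=X^n_i(0)+A_i\Big(n\int_0^t\alpha^n_i(s)\mathbf 1_{\{X^n_i(s)<X^n_{i+1}(s)\}}ds\Big)-D_i\Big(n\int_0^t\delta^n_i(s)\mathbf 1_{\{X^n_i(s)>X^n_{i-1}(s)\}}ds\Big),$$ with $X^n_0\equiv0$, $X^n_{K+1}\equiv\infty$, $\delta^n_i(t)=\sum_{j}\mathbf 1_{\{X^n_j(t)=X^n_i(t)\}}$, $\alpha^n_i(t)=\sum_j(1-\tilde a_jn^{-1/2})\mathbf 1_{\{X^n_j(t)=X^n_i(t)\}}$. (With the given $\tilde a_i$ this is the marginal join-the-shortest-queue system: $K$ parallel Exp($n$) servers, each queue receives arrivals at rate $n-a\sqrt n$ and the shortest queue, ties broken lexicographically, an extra stream at rate $b\sqrt n$.) $\hat{\mathbf Z}^n(t)=n^{-1/2}(X^n_1(t),X^n_2(t)-X^n_1(t),\dots,X^n_K(t)-X^n_{K-1}(t))'$. *)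

(* Defs.v *)
From HB Require Import structures.
From mathcomp Require Import all_boot all_order all_algebra.
From mathcomp Require Import all_classical all_reals all_analysis.
Set Implicit Arguments. Unset Strict Implicit. Unset Printing Implicit Defensive.
Import Order.TTheory GRing.Theory Num.Theory.
Import numFieldNormedType.Exports.
Local Open Scope classical_set_scope.
Local Open Scope ring_scope.

Section Defs.
Context {R : realType}.

Definition expect {d} {T : measurableType d} (P : probability T R) (g : T -> R) : R :=
  fine (\int[P]_w (g w)%:E).

Definition Rint0 (t : R) (f : R -> R) : R :=
  fine (\int[@lebesgue_measure R]_(s in `[0%R, t]) (f s)%:E).

Definition Rint0oo (f : R -> R) : R :=
  fine (\int[@lebesgue_measure R]_(s in `[0%R, +oo[) (f s)%:E).

Definition mutually_independent {d} {T : measurableType d} (P : probability T R)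
  {I : eqType} (C : I -> set (set T)) : Prop :=
  forall (s : seq I) (E : I -> set T), uniq s ->
    (forall i, i \in s -> C i (E i)) ->
    P (\bigcap_(i in [set` s]) E i) = (\prod_(i <- s) P (E i))%E.

Definition counting_path (N : R -> nat) : Prop :=
  N 0 = 0%N /\
  (forall s t, 0 <= s -> s <= t -> (N s <= N t)%N) /\
  (forall t, 0 <= t -> exists e : R, 0 < e /\ forall s, t <= s -> s < t + e -> N s = N t).

Definition rate_one_poisson {d} {T : measurableType d} (P : probability T R)
  (N : T -> R -> nat) : Prop :=
  (forall w, counting_path (N w)) /\
  (forall t k, measurable [set w | N w t = k]) /\
  (forall s t k, 0 <= s -> s <= t ->
     P [set w | (N w t - N w s)%N = k] =
     (expR (- (t - s)) * (t - s) ^+ k / (k`!)%:R)%:E) /\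
  (forall ts : seq R, all (fun t => 0 <= t) ts -> sorted <=%R ts ->
     mutually_independent P (fun j : nat =>
       if (j.+1 < size ts)%N then
         [set E | exists k : nat,
            E = [set w | (N w (nth 0%R ts j.+1) - N w (nth 0%R ts j))%N = k]]
       else [set setT])).

(** Cylinder events of a process (finite-dimensional events at times >= 0):
    they generate the sigma-algebra of the process. *)
Definition cylinders {T : Type} (N : T -> R -> nat) : set (set T) :=
  [set E | exists (ts : seq R) (Q : seq nat -> Prop),
     all (fun t => 0 <= t) ts /\ E = [set w | Q (map (N w) ts)]].

Definition init_events {T : Type} (K : nat) (X0 : T -> nat -> nat) : set (set T) :=
  [set E | exists Q : seq nat -> Prop, E = [set w | Q [seq X0 w i | i <- iota 1 K]]].

Definition indep_classes {T : Type} (K : nat) (A D : nat -> T -> R -> nat)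
  (X0 : T -> nat -> nat) (o : option (bool * nat)) : set (set T) :=
  match o with
  | None => init_events K X0
  | Some (true, i) => if (1 <= i <= K)%N then cylinders (A i) else [set setT]
  | Some (false, i) => if (1 <= i <= K)%N then cylinders (D i) else [set setT]
  end.

Definition atil (a b : R) (i : nat) : R := if i == 1%N then a - b else a.

Definition delta_c (K : nat) (x : nat -> nat) (i : nat) : R :=
  \sum_(1 <= j < K.+1) (x j == x i)%:R.
Definition alpha_c (K n : nat) (a b : R) (x : nat -> nat) (i : nat) : R :=
  \sum_(1 <= j < K.+1) (1 - atil a b j / Num.sqrt n%:R) * (x j == x i)%:R.
(** 1{X_i < X_{i+1}} with X_{K+1} = oo *)
Definition up_ind (K : nat) (x : nat -> nat) (i : nat) : R :=
  if i == K then 1 else (x i < x i.+1)%N%:R.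
(** 1{X_i > X_{i-1}} with X_0 = 0 *)
Definition down_ind (x : nat -> nat) (i : nat) : R :=
  if i == 1%N then (0 < x 1%N)%N%:R else (x i.-1 < x i)%N%:R.

Definition solves_queue (K n : nat) (a b : R) {T : Type} (A D : nat -> T -> R -> nat)
  (X0 : T -> nat -> nat) (X : T -> R -> nat -> nat) : Prop :=
  forall (w : T) (t : R) (i : nat), 0 <= t -> (1 <= i <= K)%N ->
    ((X w t i)%:R : R) =
      (X0 w i)%:R
      + (A i w (n%:R * Rint0 t (fun s => alpha_c K n a b (X w s) i * up_ind K (X w s) i)))%:R
      - (D i w (n%:R * Rint0 t (fun s => delta_c K (X w s) i * down_ind (X w s) i)))%:R.

Definition Zc_hat (K n : nat) {T : Type} (X : T -> R -> nat -> nat) (t : R) (w : T)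
  : 'rV[R]_(K.-1) :=
  \row_(j < K.-1) (((X w t j.+2)%:R - (X w t j.+1)%:R) / Num.sqrt n%:R).

Definition bounded_continuous (m : nat) (f : 'rV[R]_m -> R) : Prop :=
  continuous f /\ exists M : R, forall x, `|f x| <= M.

Fixpoint iexp (lam : nat -> R) (m : nat) (g : (nat -> R) -> R) (z : nat -> R) : R :=
  match m with
  | 0%N => g z
  | m'.+1 => Rint0oo (fun x => lam m' * expR (- (lam m' * x)) *
                       iexp lam m' g (fun j => if j == m' then x else z j))
  end.

Definition prod_exp_expect (m : nat) (lam : nat -> R) (f : 'rV[R]_m -> R) : R :=
  iexp lam m (fun z => f (\row_(j < m) z j)) (fun _ => 0).

(** Rates of the limit: coordinate j (0-based) of Z_c is Z_{j+2}, rate (K-(j+1))/K * b. *)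
Definition limit_rates (K : nat) (b : R) (j : nat) : R :=
  (K - j.+1)%:R / K%:R * b.

End Defs.

(* Main.v *)
Require Import Defs.
From HB Require Import structures.
From mathcomp Require Import all_boot all_order all_algebra all_fingroup.
From mathcomp Require Import all_classical all_reals all_analysis measurable_realfun.
From mathcomp Require Import ring lra zify.
Set Implicit Arguments. Unset Strict Implicit. Unset Printing Implicit Defensive.
Import Order.TTheory GRing.Theory Num.Theory.
Import numFieldNormedType.Exports.
Local Open Scope classical_set_scope.
Local Open Scope ring_scope.

(** Write q = sqrt n. For symmetric functions the ranked queues may be replaced by K
    labelled queues in which departures from empty queues are blocked and the extra stream
    goes to a uniformly chosen shortest queue. Two perturbations separate this chain from an
    exactly solvable one: blocking, and ties at the minimum. Without them, and on functions of
    the gaps, the product of K geometric laws of ratio r, with r^K = lambda/(lambda + b q) and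
    lambda = n - a q, is almost stationary. Blocking is transient for functions of the gaps,
    because b > a K makes the chain drift upwards; ties have probability O(1/q) under the
    geometric product law. A Poincare inequality for this law then shows that the uniformized
    chain forgets its initial state and that its limit functional is within O(q^(-1/2)) of the
    product law. Finally (Renyi) the gaps of K sorted independent geometric variables are,
    up to O(1 - r), independent geometric of ratios r^(K-1), ..., r, and q (1 - r^k)
    tends to k b / K.

    The random time change is not assumed measurable in the sample point, so the law of X(t)
    is reached through lower bounds only: on explicit events, given by Poisson counts in
    deterministic windows, the path is forced, and these events already account for almost
    all of the value predicted by the chain. Applying this to f and to M - f gives the limit. *)

(** * Geometric product laws *)

(** The spectral estimate gives relaxation in order q^2 steps of the uniformized chain, so a bound
    on the bias of one step is useful only if the biases can be summed. They can, because each is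
    charged to a decrease of the standard deviation. With D the Dirichlet form, one step moves the
    mean under the product law by O(q^(-3/2) sqrt D) and lowers the variance by at least a multiple
    of D; since Var <= C q^2 D, the change of the mean is at most C' q^(-1/2) times the decrease of
    the standard deviation, and the sum telescopes. Ties are the delicate perturbation. In the mean
    they are bounded by Cauchy-Schwarz, which takes the square root of their probability and is
    responsible for the exponent -1/2. In the variance, a discrete integration by parts across the
    diagonals bounds the mean of u^2 on ties by O(q) D, so that their cost stays below a fixed
    fraction of the dissipation, which is of order q^2 D. The value of r^K is the one that cancels,
    in the mean of the generator, the only term not of these kinds. *)

Class bnd {R : realType} {T : Type} (f : T -> R) : Prop :=
  bndP : exists M : R, forall x, `|f x| <= M.

Section Bounded.
Context {R : realType} {T : Type}.
Implicit Types f g : T -> R.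

Global Instance bnd_cst (c : R) : bnd (fun _ : T => c).
Proof. by exists `|c|. Qed.

Global Instance bndD f g : bnd f -> bnd g -> bnd (fun x => f x + g x).
Proof.
move=> [M hM] [N hN]; exists (M + N) => x.
by rewrite (le_trans (ler_normD _ _))// lerD.
Qed.

Global Instance bndN f : bnd f -> bnd (fun x => - f x).
Proof. by move=> [M hM]; exists M => x; rewrite normrN. Qed.

Global Instance bndM f g : bnd f -> bnd g -> bnd (fun x => f x * g x).
Proof.
by move=> [M hM] [N hN]; exists (M * N) => x; rewrite normrM ler_pM.
Qed.

Global Instance bndX f n : bnd f -> bnd (fun x => f x ^+ n).
Proof.
move=> [M hM]; exists (M ^+ n) => x; rewrite normrX.
by rewrite lerXn2r// nnegrE// (le_trans _ (hM x)).
Qed.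

Global Instance bnd_bool (b : T -> bool) : bnd (fun x => (b x)%:R : R).
Proof. by exists 1 => x; case: (b x); rewrite ?normr0 ?normr1. Qed.

Global Instance bnd_norm f : bnd f -> bnd (fun x => `|f x|).
Proof. by move=> [M hM]; exists M => x; rewrite normr_id. Qed.

Global Instance bnd_sum (J : Type) (s : seq J) (P : pred J) (f : J -> T -> R) :
  (forall j, bnd (f j)) -> bnd (fun x => \sum_(j <- s | P j) f j x).
Proof.
move=> hf; elim: s => [|j s [M hM]].
  by exists 0 => x; rewrite big_nil normr0.
have [N hN] := hf j; exists (N + M) => x; rewrite big_cons.
case: (P j); first by rewrite (le_trans (ler_normD _ _))// lerD.
by rewrite (le_trans (hM x))// lerDr (le_trans _ (hN x)).
Qed.

End Bounded.

Lemma bnd_comp {R : realType} {S T : Type} (f : T -> R) (g : S -> T) :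
  bnd f -> bnd (fun x => f (g x)).
Proof. by move=> [M hM]; exists M. Qed.
#[global] Hint Extern 5 (bnd (fun _ => _ _)) =>
  (simple eapply bnd_comp) : typeclass_instances.

(* Boundedness is the side condition of every linearity and monotonicity rule below; with this hint
   [//] discharges it. *)
#[global] Hint Extern 0 (bnd _) => solve [typeclasses eauto] : core.

Section GeometricMean.
Context {R : realType} (r : R).
Hypotheses (r0 : 0 < r) (r1 : r < 1).
Implicit Types f g : nat -> R.

Definition geo f : R := limn (series (fun k => (1 - r) * r ^+ k * f k)).

Lemma geo_cvg f : bnd f -> cvgn (series (fun k => (1 - r) * r ^+ k * f k)).
Proof.
move=> [M hM]; apply: normed_cvg.
apply: (@series_le_cvg _ _ (geometric ((1 - r) * M) r)).
- by move=> k /=.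
- move=> k; rewrite /geometric/=; apply: mulr_ge0; last by rewrite exprn_ge0// ltW.
  apply: mulr_ge0; first by rewrite subr_ge0 ltW.
  exact: le_trans (hM 0%N).
- move=> k; rewrite /geometric/= !normrM normrX (gtr0_norm r0) gtr0_norm ?subr_gt0//.
  have h : 0 <= (1 - r) * r ^+ k by rewrite mulr_ge0 ?exprn_ge0// ?subr_ge0; exact: ltW.
  by rewrite [leRHS]mulrAC; exact: ler_wpM2l.
- by apply: is_cvg_geometric_series; rewrite gtr0_norm.
Qed.

Lemma geo_cst c : geo (fun _ => c) = c.
Proof.
rewrite /geo; under eq_fun do rewrite mulrAC.
have /(_ R ((1 - r) * c) r) := @cvg_geometric_series.
rewrite gtr0_norm// => /(_ r1) h; apply/cvg_lim => //.
by rewrite [X in _ --> X](_ : c = (1 - r) * c / (1 - r))//; field; rewrite subr_eq0 gt_eqF.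
Qed.

Lemma geoD f g : bnd f -> bnd g -> geo (fun k => f k + g k) = geo f + geo g.
Proof.
move=> bf bg; rewrite /geo -lim_seriesD; [|exact: geo_cvg..].
by congr (limn (series _)); apply/funext => k /=; rewrite mulrDr.
Qed.

Lemma geoZ c f : bnd f -> geo (fun k => c * f k) = c * geo f.
Proof.
move=> bf; rewrite /geo -[RHS]lim_seriesZ; last exact: geo_cvg.
by congr (limn (series _)); apply/funext => k /=; rewrite mulrCA.
Qed.

Lemma geo_le f g : bnd f -> bnd g -> (forall k, f k <= g k) -> geo f <= geo g.
Proof.
move=> bf bg fg; apply: lim_series_le; [exact: geo_cvg..|] => k /=.
by rewrite ler_wpM2l// mulr_ge0 ?exprn_ge0 ?ltW// subr_gt0.
Qed.

(** Memorylessness: given that it is positive, a geometric variable minus one is again geometric.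
    Exact computations with [geo] go through this rule. *)
Lemma geo_shift f : bnd f ->
  geo f = (1 - r) * f 0%N + r * geo (fun k => f k.+1).
Proof.
move=> bf; have bS : bnd (fun k => f k.+1) by [].
rewrite -geoZ//; set u := fun k => (1 - r) * r ^+ k * f k.
have e n : series u n.+1 = (1 - r) * f 0%N + series (fun k => (1 - r) * r ^+ k * (r * f k.+1)) n.
  rewrite !seriesEord/= big_ord_recl /u/= expr0 mulr1; congr (_ + _).
  by apply: eq_bigr => i _; rewrite /bump/= add1n exprS; ring.
rewrite /geo; apply/cvg_lim => //; rewrite -(cvg_shiftn 1)/=.
under eq_fun do rewrite addn1 e.
by apply: cvgD; [exact: cvg_cst | exact: geo_cvg].
Qed.

Lemma geo_ge0 f : bnd f -> (forall k, 0 <= f k) -> 0 <= geo f.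
Proof. by move=> bf f0; rewrite -(geo_cst 0); exact: geo_le. Qed.

Lemma geo_norm f M : (forall k, `|f k| <= M) -> `|geo f| <= M.
Proof.
move=> hM; have bf : bnd f by exists M.
rewrite ler_norml -{1}(geo_cst (- M)) -{2}(geo_cst M).
by apply/andP; split; apply: geo_le => // k; have := hM k; rewrite ler_norml => /andP[].
Qed.

(** Every point carries positive mass; on products this is what upgrades mean square convergence to
    pointwise convergence. *)
Lemma geo_atom k : exists2 c, 0 < c &
  forall f, bnd f -> (forall i, 0 <= f i) -> c * f k <= geo f.
Proof.
elim: k => [|k [c c0 hc]].
  exists (1 - r) => [|f bf f0]; first by rewrite subr_gt0.
  by rewrite geo_shift// lerDl mulr_ge0 ?(ltW r0)// geo_ge0.
exists (r * c) => [|f bf f0]; first exact: mulr_gt0.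
rewrite geo_shift// -mulrA (le_trans (ler_wpM2l (ltW r0) (hc (fun i => f i.+1) _ _)))//.
by rewrite lerDr mulr_ge0// subr_ge0 ltW.
Qed.

(* Summation by parts against the weights r^k, then AM-GM. *)
Lemma geo_hardy f s : bnd f -> s = r^-1 - 1 ->
  geo (fun k => (f k - f 0%N) ^+ 2) <=
  2 * (2 + s) / s ^+ 2 * geo (fun k => (f k.+1 - f k) ^+ 2).
Proof.
move=> bf sE; set g := fun k => f k - f 0%N.
have s0 : 0 < s by rewrite sE subr_gt0 invf_gt1.
have bg : bnd g by rewrite /g.
set a := geo (fun k => g k ^+ 2).
set D := geo _.
have aS : geo (fun k => g k.+1 ^+ 2) = (1 + s) * a.
  rewrite /a (geo_shift (f := fun k => g k ^+ 2))// /g subrr expr0n/= mulr0 add0r.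
  by rewrite sE addrC subrK mulrA mulVf ?mul1r// gt_eqF.
have a0 : 0 <= a by apply: geo_ge0 => // k; exact: sqr_ge0.
(* The weight in AM-GM for which the last term of [key] is (s / 2) a, half of the left-hand side s
   a, so that it can be absorbed. *)
set t := (2 + s) / s.
have t0 : 0 < t by rewrite divr_gt0// addr_gt0.
have key : (1 + s) * a - a <= t * D + (2 * t)^-1 * ((1 + s) * a + a).
  have -> : (1 + s) * a - a = geo (fun k => g k.+1 ^+ 2 + (- 1) * g k ^+ 2).
    by rewrite geoD// geoZ// aS mulN1r.
  have -> : t * D + (2 * t)^-1 * ((1 + s) * a + a) =
     geo (fun k => t * (f k.+1 - f k) ^+ 2 + (2 * t)^-1 * (g k.+1 ^+ 2 + g k ^+ 2)).
    by rewrite geoD// geoZ// geoZ// geoD// aS.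
  apply: geo_le => // k.
  have -> : f k.+1 - f k = g k.+1 - g k by rewrite /g; ring.
  move: (g k.+1) (g k) => x y; rewrite -subr_ge0.
  have -> : t * (x - y) ^+ 2 + (2 * t)^-1 * (x ^+ 2 + y ^+ 2) - (x ^+ 2 + -1 * y ^+ 2) =
    (4 * t)^-1 * ((2 * t * (x - y) - (x + y)) ^+ 2 + (x - y) ^+ 2).
    by field; rewrite gt_eqF.
  by rewrite mulr_ge0// ?invr_ge0 ?addr_ge0 ?sqr_ge0// mulr_ge0// ltW.
have e1 : (2 * t)^-1 * ((1 + s) * a + a) = s / 2 * a.
  by rewrite /t; field; rewrite !gt_eqF//= addr_gt0.
have : s / 2 * a <= t * D by move: key; rewrite e1; lra.
rewrite -(ler_pM2l (_ : 0 < 2 / s)); last by rewrite divr_gt0.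
rewrite mulrA (_ : 2 / s * (s / 2) = 1); last by field; rewrite gt_eqF.
rewrite mul1r => /le_trans; apply.
by rewrite le_eqVlt; apply/orP; left; apply/eqP; rewrite /t; field; rewrite gt_eqF.
Qed.

End GeometricMean.

Section ProductMean.
Context {R : realType} {I : eqType} (r : I -> R).
Hypotheses (r0 : forall i, 0 < r i) (r1 : forall i, r i < 1).
Implicit Types (f g : (I -> nat) -> R) (y : I -> nat) (s : seq I).

Definition upd y i v : I -> nat := fun j => if j == i then v else y j.
Definition incr i y : I -> nat := upd y i (y i).+1.

Fixpoint Pm s f y : R :=
  if s is i :: s' then geo (r i) (fun v => Pm s' f (upd y i v)) else f y.

Lemma Pm_norm s f M y : (forall y, `|f y| <= M) -> `|Pm s f y| <= M.
Proof. by move=> hM; elim: s y => //= i s IH y; exact: geo_norm. Qed.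

Global Instance bnd_Pm s f : bnd f -> bnd (Pm s f).
Proof. by move=> [M hM]; exists M => y; exact: Pm_norm. Qed.

Lemma Pm_cst s c y : Pm s (fun _ => c) y = c.
Proof.
elim: s y => //= i s IH y; under eq_fun do rewrite IH.
exact: geo_cst.
Qed.

Lemma PmD s f g y : bnd f -> bnd g ->
  Pm s (fun y => f y + g y) y = Pm s f y + Pm s g y.
Proof.
move=> bf bg; elim: s y => //= i s IH y; under eq_fun do rewrite IH.
by rewrite geoD.
Qed.

Lemma PmZ s c f y : bnd f -> Pm s (fun y => c * f y) y = c * Pm s f y.
Proof.
move=> bf; elim: s y => //= i s IH y; under eq_fun do rewrite IH.
by rewrite geoZ.
Qed.

Lemma PmN s f y : bnd f -> Pm s (fun y => - f y) y = - Pm s f y.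
Proof. by move=> bf; under eq_fun do rewrite -mulN1r; rewrite PmZ// mulN1r. Qed.

Lemma PmB s f g y : bnd f -> bnd g ->
  Pm s (fun y => f y - g y) y = Pm s f y - Pm s g y.
Proof. by move=> bf bg; rewrite PmD// PmN. Qed.

Lemma Pm_sum s (J : Type) (t : seq J) (P : pred J) (f : J -> (I -> nat) -> R) y :
  (forall j, bnd (f j)) ->
  Pm s (fun y => \sum_(j <- t | P j) f j y) y = \sum_(j <- t | P j) Pm s (f j) y.
Proof.
move=> bf; elim: t => [|j t IH].
  by rewrite big_nil; under eq_fun do rewrite big_nil; exact: Pm_cst.
rewrite big_cons -IH; under eq_fun do rewrite big_cons.
by case: (P j) => //; rewrite PmD.
Qed.

Lemma Pm_le s f g y : bnd f -> bnd g -> (forall y, f y <= g y) ->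
  Pm s f y <= Pm s g y.
Proof.
move=> bf bg fg; elim: s y => //= i s IH y.
exact: geo_le.
Qed.

Lemma Pm_ge0 s f y : bnd f -> (forall y, 0 <= f y) -> 0 <= Pm s f y.
Proof. by move=> bf f0; rewrite -(Pm_cst s 0 y); exact: Pm_le. Qed.

Lemma Pm_upd s f j v y : j \notin s ->
  Pm s f (upd y j v) = Pm s (fun y => f (upd y j v)) y.
Proof.
elim: s y => //= i s IH y; rewrite inE negb_or => /andP[ji js].
congr (geo _ _); apply/funext => w; rewrite -IH//; congr (Pm _ _ _).
apply/funext => k; rewrite /upd; case: eqP => // ->.
by rewrite eq_sym (negbTE ji).
Qed.

Lemma Pm_incr s f j y : j \notin s ->
  Pm s f (incr j y) = Pm s (fun y => f (incr j y)) y.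
Proof.
elim: s y => //= i s IH y; rewrite inE negb_or => /andP[ji js].
congr (geo _ _); apply/funext => w; rewrite -IH//; congr (Pm _ _ _).
apply/funext => k; rewrite /incr /upd; case: (k =P i) => [->|_].
  by rewrite eq_sym (negbTE ji).
by rewrite (negbTE ji); case: eqP.
Qed.

Lemma Pm_shift s f j y : uniq s -> j \in s -> bnd f ->
  Pm s f y = (1 - r j) * Pm s (fun y => f (upd y j 0)) y
             + r j * Pm s (fun y => f (incr j y)) y.
Proof.
move=> + + bf; elim: s y => //= i s IH y /andP[iNs us].
rewrite inE => /orP[/eqP ->|js].
  rewrite geo_shift//; congr (_ * _ + _ * _).
    rewrite Pm_upd// -[LHS](@geo_cst _ (r i))//; congr (geo _ _).
    apply/funext => w; rewrite Pm_upd//; congr (Pm _ _ _); apply/funext => z.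
    by congr (f _); apply/funext => k; rewrite /upd; case: eqP.
  congr (geo _ _); apply/funext => w; rewrite -Pm_incr//; congr (Pm _ _ _).
  by apply/funext => k; rewrite /incr /upd eqxx; case: eqP.
under eq_fun do rewrite IH//.
by rewrite geoD// !geoZ.
Qed.

(** The indicator kills the term of [Pm_shift] at y_j = 0. The exchange rules for [Em] below all
    derive from this shift identity. *)
Lemma Pm_pos s f j y : uniq s -> j \in s -> bnd f ->
  Pm s (fun y => (0 < y j)%N%:R * f y) y = r j * Pm s (fun y => f (incr j y)) y.
Proof.
move=> us js bf; rewrite (Pm_shift y us js)//.
rewrite (_ : (fun y => _ * f (upd _ _ _)) = fun _ => 0); last first.
  by apply/funext => z; rewrite /upd eqxx mul0r.
rewrite Pm_cst mulr0 add0r; congr (_ * Pm _ _ _); apply/funext => z.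
by rewrite /incr /upd eqxx mul1r.
Qed.

Lemma Pm_atom s y y' : uniq s -> (forall i, i \notin s -> y i = y' i) ->
  exists2 c, 0 < c &
  forall f, bnd f -> (forall y, 0 <= f y) -> c * f y' <= Pm s f y.
Proof.
elim: s y => [|i s IH] y /=.
  move=> _ h; exists 1 => // f _ _; rewrite mul1r.
  by rewrite (_ : y' = y)//; apply/funext => j; rewrite h.
move=> /andP[iNs us] h.
have [|c c0 hc] := IH (upd y i (y' i)) us.
  by move=> j js; rewrite /upd; case: eqP => [->//|/eqP ji]; rewrite h// inE negb_or ji.
have [e e0 he] := geo_atom (r0 i) (r1 i) (y' i).
exists (e * c) => [|f bf f0]; first exact: mulr_gt0.
rewrite -mulrA (le_trans (ler_wpM2l (ltW e0) (hc f bf f0)))//.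
by apply: (he (fun v => Pm s f (upd y i v))) => // v; exact: Pm_ge0.
Qed.

Lemma Pm_varE s f y : bnd f ->
  Pm s (fun z => (f z - Pm s f y) ^+ 2) y = Pm s (fun z => f z ^+ 2) y - Pm s f y ^+ 2.
Proof.
move=> bf; set m := Pm s f y.
rewrite (_ : (fun z => _) = (fun z => f z ^+ 2 + ((- 2 * m) * f z + m ^+ 2))); last first.
  by apply/funext => z; ring.
by rewrite PmD// PmD// PmZ// Pm_cst -/m; ring.
Qed.

Lemma Pm_sqr_le s f y : bnd f -> Pm s f y ^+ 2 <= Pm s (fun z => f z ^+ 2) y.
Proof.
move=> bf; rewrite -subr_ge0 -Pm_varE//.
by apply: Pm_ge0 => // z; exact: sqr_ge0.
Qed.

End ProductMean.

(** * Poincare inequality for products of geometric laws *)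

Section Poincare.
Context {R : realType}.

(** The variance is at most the second moment about any point, here f(0), which the Hardy inequality
    controls. *)
Lemma geo_var_le (r s : R) (f : nat -> R) : 0 < r -> r < 1 -> s = r^-1 - 1 -> bnd f ->
  geo r (fun k => f k ^+ 2) - geo r f ^+ 2 <=
  2 * (2 + s) / s ^+ 2 * geo r (fun k => (f k.+1 - f k) ^+ 2).
Proof.
move=> r0 r1 sE bf; apply: le_trans (geo_hardy r0 r1 bf sE).
rewrite (_ : (fun k => (f k - f 0%N) ^+ 2) =
  fun k => f k ^+ 2 + ((- 2 * f 0%N) * f k + f 0%N ^+ 2)); last first.
  by apply/funext => k; ring.
rewrite geoD// geoD// geoZ// geo_cst// -subr_ge0.
have -> : forall x z c : R, x + (- 2 * c * z + c ^+ 2) - (x - z ^+ 2) = (z - c) ^+ 2.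
  by move=> x z c; ring.
exact: sqr_ge0.
Qed.

(** Tensorization by induction on the coordinates: the variance is the mean of the variance over the
    remaining coordinates ([h1]) plus the variance of the conditional mean [m], to which the
    one-dimensional bound applies. The constant does not grow with the number of coordinates. *)
Lemma Pm_poincare (I : eqType) (r s : R) (t : seq I) (f : (I -> nat) -> R) y :
  0 < r -> r < 1 -> s = r^-1 - 1 -> uniq t -> bnd f ->
  Pm (fun=> r) t (fun z => f z ^+ 2) y - Pm (fun=> r) t f y ^+ 2 <=
  2 * (2 + s) / s ^+ 2 *
  \sum_(j <- t) Pm (fun=> r) t (fun z => (f (incr j z) - f z) ^+ 2) y.
Proof.
move=> r0 r1 sE + bf; set C := _ / _.
have s0 : 0 < s by rewrite sE subr_gt0 invf_gt1.
have C0 : 0 <= C by rewrite divr_ge0 ?exprn_ge0 ?mulr_ge0 ?addr_ge0// ltW.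
have hr i : 0 < (fun _ : I => r) i by [].
have hr1 i : (fun _ : I => r) i < 1 by [].
have bPm (w : seq I) g : bnd g -> bnd (Pm (fun=> r) w g) by exact: bnd_Pm.
elim: t y => [|i t IH] y /=; first by rewrite big_nil mulr0 subrr.
move=> /andP[iNt ut]; rewrite big_cons mulrDr.
pose m v := Pm (fun=> r) t f (upd y i v).
have bm : bnd m by rewrite /m.
have h1 : geo r (fun v => Pm (fun=> r) t (fun z => f z ^+ 2) (upd y i v)) -
  geo r (fun v => m v ^+ 2) <= C * \sum_(j <- t)
   geo r (fun v => Pm (fun=> r) t (fun z => (f (incr j z) - f z) ^+ 2) (upd y i v)).
  rewrite mulr_sumr (eq_bigr (fun j => geo r (fun v => C *
     Pm (fun=> r) t (fun z => (f (incr j z) - f z) ^+ 2) (upd y i v)))); last first.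
    by move=> j _; rewrite geoZ.
  rewrite lerBlDr.
  have -> : forall F : I -> nat -> R, (forall j, bnd (F j)) ->
     \sum_(j <- t) geo r (F j) = geo r (fun v => \sum_(j <- t) F j v).
    move=> F bF; elim: (t) => [|j t' IH'].
      by rewrite big_nil; under eq_fun do rewrite big_nil; rewrite geo_cst.
    rewrite big_cons IH'; under [in RHS]eq_fun do rewrite big_cons.
    by rewrite geoD.
  rewrite -geoD//; apply: geo_le => // v.
  by rewrite -lerBlDr -mulr_sumr; exact: IH.
(* By Jensen, the squared increments of the conditional mean are dominated by the mean squared
   increments of [f]. *)
have h2 : geo r (fun k => (m k.+1 - m k) ^+ 2) <=
   geo r (fun v => Pm (fun=> r) t (fun z => (f (incr i z) - f z) ^+ 2) (upd y i v)).
  apply: geo_le => // v.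
  have bd : bnd (fun z => f (incr i z) - f z) by [].
  have := Pm_sqr_le hr hr1 t (upd y i v) bd.
  rewrite PmB// -Pm_incr// (_ : incr i (upd y i v) = upd y i v.+1)//.
  by apply/funext => j; rewrite /incr /upd eqxx; case: eqP.
have := lerD (geo_var_le r0 r1 sE bm) h1.
rewrite addrACA [X in _ + X]addrC addrA => h3.
have h4 := ler_wpM2l C0 h2.
have e : geo r (fun v => Pm (fun=> r) t f (upd y i v)) = geo r m by [].
rewrite -/C in h3; rewrite e; move: h3 h4; clear.
move: (C * _) (C * geo _ _) (C * _) (geo _ m) (geo _ _) (geo _ _) => x1 x2 x3 x4 x5 x6.
lra.
Qed.

End Poincare.

(** * The generator on gap functions *)

Section Labelled.
Context {I : finType}.
Implicit Types (y : I -> nat) (i j : I).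

Definition amin j y : bool := [forall i, (y j <= y i)%N].
Definition umin j y : bool := [forall i, (i != j) ==> (y j < y i)%N].
Definition ngrp y : nat := (\sum_(j : I) amin j y)%N.
Definition tie y : bool := (1 < ngrp y)%N.
Definition upall y : I -> nat := fun i => (y i).+1.
Definition downf j y : I -> nat :=
  if y j is m.+1 then upd y j m else (fun i => if i == j then 0%N else (y i).+1).
Definition incs (t : seq I) y : I -> nat := fun i => (y i + (i \in t))%N.

Lemma amin_upall j y : amin j (upall y) = amin j y.
Proof. by apply: eq_forallb => i. Qed.
Lemma umin_upall j y : umin j (upall y) = umin j y.
Proof. by apply: eq_forallb => i. Qed.
Lemma ngrp_upall y : ngrp (upall y) = ngrp y.
Proof. by apply: eq_bigr => i _; rewrite amin_upall. Qed.

Lemma incr_upall j y : incr j (upall y) = upall (incr j y).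
Proof. by apply/funext => i; rewrite /incr /upd /upall; case: eqP. Qed.

(** This lets the shift identity act on the extra stream: being the strict minimum before an arrival
    becomes being a minimum after it. *)
Lemma umin_incr j y : umin j y = amin j (incr j y).
Proof.
apply/forallP/forallP => h i; have := h i; rewrite /incr /upd eqxx.
  by case: eqP => //= _.
by case: eqP => //= _ _; apply/implyP.
Qed.

Lemma amin_exists (i0 : I) y : exists j, amin j y.
Proof.
exists [arg min_(i < i0) y i]; case: arg_minnP => // i _ h.
by apply/forallP => j; exact: h.
Qed.

Lemma ngrp_gt0 (i0 : I) y : (0 < ngrp y)%N.
Proof.
by have [j hj] := amin_exists i0 y; rewrite /ngrp (bigD1 j)//= hj.
Qed.

Lemma umin_amin_tie j y : umin j y = amin j y && ~~ tie y.
Proof.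
rewrite /tie /ngrp; apply/idP/andP => [/forallP h|[/forallP ha]].
  have aj : amin j y.
    apply/forallP => i; have [->//|ij] := eqVneq i j.
    by have := h i; rewrite ij /= => /ltnW.
  split => //; rewrite (bigD1 j)//= aj big1// => i ij.
  apply/eqP; rewrite eqb0; apply/negP => /forallP/(_ j).
  by have := h i; rewrite ij /= ltnNge => /negbTE ->.
have aj : amin j y by apply/forallP.
rewrite (bigD1 j)//= aj /= => hs; apply/forallP => i; apply/implyP => ij.
rewrite ltnNge; apply/negP => hle; move: hs; rewrite (bigD1 i)//=.
rewrite (_ : amin i y)//; apply/forallP => k; exact: leq_trans (ha k).
Qed.

End Labelled.

Section Mean.
Context {R : realType} {I : finType} (r : R).
Hypotheses (r0 : 0 < r) (r1 : r < 1).
Implicit Types (f u v : (I -> nat) -> R) (y : I -> nat) (i j : I).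
Local Notation K := #|I|.

Definition Em f : R := Pm (fun=> r) (index_enum I) f (fun=> 0%N).

Let hr i : 0 < (fun _ : I => r) i. Proof. by []. Qed.
Let hr1 i : (fun _ : I => r) i < 1. Proof. by []. Qed.

Lemma Em_cst c : Em (fun=> c) = c. Proof. exact: Pm_cst. Qed.
Lemma EmD f g : bnd f -> bnd g -> Em (fun y => f y + g y) = Em f + Em g.
Proof. exact: PmD. Qed.
Lemma EmB f g : bnd f -> bnd g -> Em (fun y => f y - g y) = Em f - Em g.
Proof. exact: PmB. Qed.
Lemma EmZ c f : bnd f -> Em (fun y => c * f y) = c * Em f.
Proof. exact: PmZ. Qed.
Lemma Em_sum (J : Type) (t : seq J) (P : pred J) (f : J -> (I -> nat) -> R) :
  (forall k, bnd (f k)) ->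
  Em (fun y => \sum_(k <- t | P k) f k y) = \sum_(k <- t | P k) Em (f k).
Proof. exact: Pm_sum. Qed.
Lemma Em_le f g : bnd f -> bnd g -> (forall y, f y <= g y) -> Em f <= Em g.
Proof. exact: Pm_le. Qed.
Lemma Em_ge0 f : bnd f -> (forall y, 0 <= f y) -> 0 <= Em f.
Proof. exact: Pm_ge0. Qed.
Lemma Em_norm f M : (forall y, `|f y| <= M) -> `|Em f| <= M.
Proof. exact: Pm_norm. Qed.

Lemma Em_incr j f : bnd f ->
  Em (fun y => f (incr j y)) = r^-1 * Em (fun y => (0 < y j)%N%:R * f y).
Proof.
move=> bf; rewrite /Em (Pm_pos hr hr1)// ?index_enum_uniq ?mem_index_enum//.
by rewrite mulrA mulVf ?mul1r// gt_eqF.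
Qed.

Lemma Em_atom y : exists2 c, 0 < c &
  forall f, bnd f -> (forall y, 0 <= f y) -> c * f y <= Em f.
Proof.
apply: Pm_atom => //; first exact: index_enum_uniq.
by move=> i; rewrite mem_index_enum.
Qed.

Lemma Em_incs (t : seq I) f : uniq t -> bnd f ->
  Em (fun y => (all (fun i => (0 < y i)%N) t)%:R * f y) =
  r ^+ size t * Em (fun y => f (incs t y)).
Proof.
move=> + bf; elim: t f bf => [|i t IH] f bf /=.
  move=> _; rewrite expr0 mul1r; congr Em; apply/funext => y; rewrite mul1r.
  by congr f; apply/funext => j; rewrite /incs in_nil addn0.
move=> /andP[iNt ut].
rewrite (_ : (fun y => _) = fun y => (0 < y i)%N%:R *
  ((all (fun j => (0 < y j)%N) t)%:R * f y)); last first.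
  by apply/funext => y; rewrite mulrA -natrM mulnb.
rewrite /Em (Pm_pos hr hr1)// ?index_enum_uniq ?mem_index_enum// -/(Em _).
rewrite exprS -mulrA; congr (_ * _).
rewrite -/(Em _) [X in Em X = _](_ : _ = (fun y => (all (fun j => (0 < y j)%N) t)%:R * f (incr i y)));
    last first.
  apply/funext => y; congr (_ * _); congr (_%:R); congr nat_of_bool.
  apply: eq_in_all => j jt.
  by rewrite /incr /upd; case: eqP => // ji; move: iNt; rewrite -ji jt.
rewrite (IH (fun y => f (incr i y)))//; congr (_ * Em _); apply/funext => y; congr f; apply/funext => j.
rewrite /incr /upd /incs in_cons; case: eqP => [->|_] //=.
by rewrite (negbTE iNt) addn0 addn1.
Qed.

Lemma Em_upall f : bnd f ->
  Em (fun y => [forall i, (0 < y i)%N]%:R * f y) = r ^+ K * Em (fun y => f (upall y)).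
Proof.
move=> bf.
rewrite (_ : (fun y => _) = fun y =>
  (all (fun i => (0 < y i)%N) (index_enum I))%:R * f y); last first.
  apply/funext => y; congr (_%:R * _); congr (nat_of_bool _).
  by apply/forallP/allP => [h i _|h i]; [exact: h | exact/h/mem_index_enum].
rewrite Em_incs ?index_enum_uniq//.
congr (_ ^+ _ * Em _).
  by rewrite cardE /enum_mem -enumT; congr size; rewrite enumT; apply/esym/all_filterP/allP.
by apply/funext => y; congr f; apply/funext => i; rewrite /incs mem_index_enum addn1.
Qed.

(** Under the product law the minimum is geometric of ratio r^K and independent of the gaps. Where j
    is a shortest queue, y_j = 0 says that the minimum is 0, hence the factor 1 - r^K. *)
Lemma Em_zero_amin j u : bnd u -> (forall y, u (upall y) = u y) ->
  (forall y, ~~ amin j y -> u y = 0) ->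
  Em (fun y => (y j == 0%N)%:R * u y) = (1 - r ^+ K) * Em u.
Proof.
move=> bu iu zu; rewrite mulrBl mul1r.
have -> : r ^+ K * Em u = Em (fun y => [forall i, (0 < y i)%N]%:R * u y).
  by rewrite Em_upall//; congr (_ * Em _); apply/funext => y.
rewrite -EmB//; congr Em; apply/funext => y.
have [/forallP aj|naj] := boolP (amin j y); last by rewrite zu// !mulr0 subr0.
rewrite (_ : [forall i, _] = (y j != 0%N)); last first.
  rewrite -lt0n; apply/forallP/idP => [/(_ j)//|yj i].
  exact: leq_trans (aj i).
by case: eqP => _; rewrite !(mul1r, mul0r, subr0, subrr).
Qed.

End Mean.

Section Generator.
Context {R : realType} {I : finType} (i0 : I) (lam nu beta r s : R).
Hypotheses (r0 : 0 < r) (r1 : r < 1) (sE : s = r^-1 - 1).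
Hypotheses (lam0 : 0 < lam) (beta0 : 0 < beta).
Implicit Types (f u v : (I -> nat) -> R) (y : I -> nat) (i j : I).
Local Notation K := #|I|.
Hypothesis rK : r ^+ K * (lam + beta) = lam.
Local Notation E := (Em r).

Let bE u (_ : bnd u) : bnd u. Proof. by []. Qed.

(* A departure from an empty queue is replaced by an arrival at every other queue ([downf]):
   the gaps move as if lengths could be negative, and [gap_gen] commutes with [upall]. *)
Definition gap_gen u y : R :=
  \sum_j (lam * (u (incr j y) - u y) + nu * (u (downf j y) - u y)
   + beta / (ngrp y)%:R * (amin j y)%:R * (u (incr j y) - u y)).

(* The part of the extra stream that is routed at a tie; the rest is [umin]. *)
Definition tie_gen u y : R := (tie y)%:R / (ngrp y)%:R *
  \sum_j (amin j y)%:R * (u (incr j y) - u y).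

Instance bnd_invg : bnd (fun y => (ngrp y)%:R^-1 : R).
Proof.
exists 1 => y; have := ngrp_gt0 i0 y; set m := ngrp y => m0.
rewrite ger0_norm ?invr_ge0// invf_le1 ?ler1n ?ltr0n//.
Qed.

Lemma bnd_gap_gen u : bnd u -> bnd (gap_gen u).
Proof. by move=> bu; rewrite /gap_gen. Qed.

(** If y_j = 0, [downf j] takes y and [upall y] to the same state; if y_j > 0, to states that differ
    by [upall]. The raise of all other queues in [downf] is designed for this. *)
Lemma gap_gen_upall u : (forall y, u (upall y) = u y) ->
  forall y, gap_gen u (upall y) = gap_gen u y.
Proof.
move=> iu y; rewrite /gap_gen; apply: eq_bigr => j _.
rewrite amin_upall ngrp_upall incr_upall !iu; congr (_ + _ * _ + _).
rewrite {1}/downf {1}/upall; case E : (y j) => [|k]; last first.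
  rewrite -(iu (downf j y)) /downf E; congr (u _ - _).
  by apply/funext => i; rewrite /upd /upall; case: eqP.
congr (u _ - _); apply/funext => i; rewrite /downf E /upd /upall.
by case: eqP => // ->.
Qed.

Lemma gap_gen_split u y : gap_gen u y =
  \sum_j (lam * (u (incr j y) - u y) + nu * (u (downf j y) - u y)
          + beta * (umin j y)%:R * (u (incr j y) - u y)) + beta * tie_gen u y.
Proof.
rewrite /gap_gen /tie_gen !mulr_sumr -big_split/=; apply: eq_bigr => j _.
rewrite -!addrA; congr (_ + (_ + _)); rewrite umin_amin_tie.
have g0 : (ngrp y)%:R != 0 :> R by rewrite pnatr_eq0 -lt0n (ngrp_gt0 i0).
case: (amin j y); last by rewrite !(mulr0, mul0r, addr0).
have [t|t] := boolP (tie y); first by rewrite /= !(mulr0, mul0r, add0r); ring.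
have -> : ngrp y = 1%N.
  by apply/eqP; rewrite eqn_leq (ngrp_gt0 i0) andbT leqNgt.
by rewrite /=; field.
Qed.

(* The shift identity E[1{y_j > 0} f] = r E[f o incr j] leaves only the tie term and a
   multiple of lambda - nu r. *)
Lemma Em_gap_gen u : bnd u -> (forall y, u (upall y) = u y) ->
  E (gap_gen u) =
  (lam - nu * r) * ((K%:R * s - beta / lam) * E u + beta / lam * E (fun y => (tie y)%:R * u y))
  + beta * E (tie_gen u).
Proof.
move=> bu iu.
have lamn : lam != 0 by rewrite gt_eqF.
have rn : r != 0 by rewrite gt_eqF.
have lbn : lam + beta != 0 by rewrite gt_eqF// addr_gt0.
have cE : r ^+ K = lam / (lam + beta) by apply: (canRL (mulfK lbn)).
have cn : r ^+ K != 0 by rewrite expf_neq0.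
pose a j := E (fun y => (amin j y)%:R * u y).
pose b j := E (fun y => (umin j y)%:R * u y).
have pz (j : I) y : (0 < y j)%N%:R = 1 - (y j == 0%N)%:R :> R.
  by case: (y j) => [|m] /=; rewrite ?subr0 ?subrr.
have z0 j : E (fun y => (y j == 0%N)%:R * u y) = (1 - r ^+ K) * a j.
  rewrite /a -(Em_zero_amin r0 r1 (j := j))//; first last.
  - by move=> y /negbTE ->; rewrite mul0r.
  - by move=> y; rewrite amin_upall iu.
  congr Em; apply/funext => y; case: eqP => [y0|_]; last by rewrite !mul0r.
  rewrite !mul1r (_ : amin j y) ?mul1r//.
  by apply/forallP => i; rewrite y0.
have h1 j : E (fun y => u (incr j y)) = r^-1 * (E u - (1 - r ^+ K) * a j).
  rewrite Em_incr//; congr (_ * _); rewrite -z0 -EmB//; congr Em.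
  by apply/funext => y; rewrite pz mulrBl mul1r.
have h3 j : E (fun y => (umin j y)%:R * u (incr j y)) = r^-1 * r ^+ K * a j.
  under eq_fun do rewrite umin_incr.
  have bau : bnd (fun y => (amin j y)%:R * u y) by [].
  rewrite (Em_incr r0 r1 j bau) -mulrA; congr (_ * _).
  have -> : r ^+ K * a j = a j - (1 - r ^+ K) * a j by ring.
  rewrite {2}/a -(Em_zero_amin r0 r1 (j := j))//; first last.
  - by move=> y /negbTE ->; rewrite mul0r.
  - by move=> y; rewrite amin_upall iu.
  rewrite /a -EmB//; congr Em.
  by apply/funext => y; rewrite pz mulrBl mul1r.
have h2 j : E (fun y => u (downf j y)) = r * E u + r / r ^+ K * (1 - r ^+ K) * b j.
  have e1 : E (fun y => (0 < y j)%N%:R * u (downf j y)) = r * E u.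
    have bd : bnd (fun y => u (downf j y)) by [].
    have := Em_incr r0 r1 j bd.
    rewrite (_ : (fun y => u (downf j (incr j y))) = u); last first.
      apply/funext => y; congr u; rewrite /downf /incr /upd eqxx.
      by apply/funext => i; case: eqP => [->|].
    by move=> ->; rewrite mulrA divff// mul1r.
  pose t := rem j (index_enum I).
  have ut : uniq t by rewrite rem_uniq// index_enum_uniq.
  have it i : (i \in t) = (i != j).
    by rewrite mem_rem_uniq ?index_enum_uniq// inE mem_index_enum andbT.
  have st : size t = K.-1.
    by rewrite size_rem ?mem_index_enum// cardT enumT.
  have K1 : r ^+ K = r * r ^+ K.-1.
    by rewrite -exprS prednK//; apply/card_gt0P; exists i0.
  (* At y_j = 0 the move raises the K - 1 other queues. The shift identity in these coordinates
     turns it into the event that y_j = 0 and all others are positive, where j is the strict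
     minimum. *)
  have e2 : r ^+ K.-1 * E (fun y => (y j == 0%N)%:R * u (downf j y)) =
            (1 - r ^+ K) * b j.
    rewrite /b -(Em_zero_amin r0 r1 (j := j))//; first last.
    - move=> y nj; rewrite (_ : umin j y = false) ?mul0r//.
      by apply/negP; rewrite umin_amin_tie => /andP[]; rewrite (negbTE nj).
    - by move=> y; rewrite umin_upall iu.
    rewrite -st (_ : (fun y => _) = (fun y => (incs t y j == 0%N)%:R * u (incs t y))).
      have b0u : bnd (fun y => (y j == 0%N)%:R * u y) by [].
      rewrite -(Em_incs r0 r1 ut b0u); congr Em.
      apply/funext => y; rewrite mulrA [RHS]mulrA; congr (_ * _).
      rewrite -!natrM; congr (_%:R); rewrite !mulnb; congr nat_of_bool.
      case: (eqVneq (y j) 0%N) => [y0|]; last by rewrite andbF.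
      rewrite andbT/=; apply/allP/forallP => [h i|h i].
        by rewrite y0; apply/implyP => ij; apply: h; rewrite it.
      by rewrite it => ij; have := h i; rewrite ij y0.
    apply/funext => y; rewrite {1}/incs it eqxx addn0.
    case: (eqVneq (y j) 0%N) => [y0|]; last by rewrite !mul0r.
    rewrite !mul1r; congr u; rewrite /downf y0; apply/funext => i.
    by rewrite /incs it; case: eqP => [->|_]; rewrite ?y0// addn1.
  rewrite -{1}e1 (_ : r / r ^+ K * (1 - r ^+ K) * b j =
    E (fun y => (y j == 0%N)%:R * u (downf j y))); last first.
    rewrite -mulrA -e2 {1}K1 mulrA -[LHS]mul1r; field.
    by rewrite rn expf_neq0.
  rewrite -EmD//; congr Em; apply/funext => y; rewrite -mulrDl -natrD.
  by case: (y j) => [|m]; rewrite ?add0n ?addn0 mul1r.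
have bsum : \sum_j b j = E u - E (fun y => (tie y)%:R * u y).
  rewrite -EmB// -Em_sum//; congr Em; apply/funext => y.
  rewrite -mulr_suml -natr_sum.
  have [t|t] := boolP (tie y).
    rewrite big1 ?mul0r ?mul1r ?subrr// => j _.
    by rewrite umin_amin_tie t andbF.
  rewrite mul0r subr0 (_ : (\sum_j umin j y)%N = ngrp y).
    rewrite (_ : ngrp y = 1%N) ?mul1r//.
    by apply/eqP; rewrite eqn_leq (ngrp_gt0 i0) andbT leqNgt.
  by apply: eq_bigr => j _; rewrite umin_amin_tie t andbT.
rewrite (_ : gap_gen u = fun y =>
  \sum_j (lam * (u (incr j y) - u y) + nu * (u (downf j y) - u y)
          + beta * ((umin j y)%:R * u (incr j y) - (umin j y)%:R * u y)) + beta * tie_gen u y);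
  last first.
  apply/funext => y; rewrite gap_gen_split; congr (_ + _); apply: eq_bigr => j _.
  by congr (_ + _); ring.
have btie : bnd (tie_gen u) by rewrite /tie_gen.
rewrite EmD// EmZ// Em_sum//; congr (_ + _).
rewrite (eq_bigr (fun j => (lam * (r^-1 - 1) * E u + nu * (r - 1) * E u) +
   (beta / r * r ^+ K - lam / r * (1 - r ^+ K)) * a j +
   (nu * (r / r ^+ K * (1 - r ^+ K)) - beta) * b j)); last first.
  move=> j _; rewrite EmD// EmD// !EmZ// !EmB// h1 h2 h3 -/(b j); ring.
set c0 := lam * _ * _ + _.
rewrite big_split/= big_split/= -mulr_sumr -mulr_sumr bsum sumr_const -[c0 *+ _]mulr_natl.
(* The relation r^K (lambda + beta) = lambda is what cancels the coefficient of [a j]; it fixes the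
   choice of r. *)
rewrite (_ : beta / r * r ^+ K - lam / r * (1 - r ^+ K) = 0); last first.
  by rewrite cE; field; rewrite lbn rn.
rewrite (_ : nu * (r / r ^+ K * (1 - r ^+ K)) - beta = beta * (nu * r / lam - 1)); last first.
  by rewrite cE; field; rewrite lbn lamn.
rewrite /c0 sE.
have -> : r^-1 - 1 = (1 - r) / r by field.
by field; rewrite lamn rn.
Qed.

End Generator.

(** * Contraction of the uniformized chain *)

Section Jump.
Context {R : realType} {S : Type} {L : finType}.
Variables (rho : L -> S -> R) (m : L -> S -> S).
Implicit Types (u : S -> R) (y : S).

Definition jump u y : R := \sum_l rho l y * (u (m l y) - u y).

(* Jensen's inequality for one step of the uniformized chain, with its defect. *)
Lemma jump_sqr (c : R) u y : (forall l, 0 <= rho l y) -> 0 < c -> \sum_l rho l y <= c / 2 ->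
  (u y + c^-1 * jump u y) ^+ 2 <=
  u y ^+ 2 + c^-1 * jump (fun z => u z ^+ 2) y
  - (2 * c)^-1 * \sum_l rho l y * (u (m l y) - u y) ^+ 2.
Proof.
move=> rho0 c0 rc.
set S0 := \sum_l rho l y in rc; set S1 := jump u y; set S2 := \sum_l _ * _ ^+ 2.
have e : jump (fun z => u z ^+ 2) y = 2 * u y * S1 + S2.
  rewrite /S1 /jump /S2 mulr_sumr -big_split/=; apply: eq_bigr => l _; ring.
(* Cauchy-Schwarz as a completed square. With total rate at most c / 2 it uses up half of the
   quadratic variation [S2]; the other half remains as the defect. *)
have h : 0 <= \sum_l rho l y * (u (m l y) - u y - 2 / c * S1) ^+ 2.
  by apply: sumr_ge0 => l _; rewrite mulr_ge0// sqr_ge0.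
have e2 (a : R) : \sum_l rho l y * (u (m l y) - u y - a) ^+ 2 =
    S2 - 2 * a * S1 + a ^+ 2 * S0.
  rewrite /S2 /S0 /S1 /jump !mulr_sumr -sumrB -big_split/=.
  by apply: eq_bigr => l _; ring.
rewrite e2 in h.
have h3 : (2 / c * S1) ^+ 2 * S0 <= (2 / c * S1) ^+ 2 * (c / 2).
  by rewrite ler_wpM2l// sqr_ge0.
rewrite e -subr_ge0.
rewrite (_ : _ - _ = (2 * c)^-1 * (S2 - 2 * (2 / c * S1) * S1 + (2 / c * S1) ^+ 2 * (c / 2))).
  by rewrite mulr_ge0 ?invr_ge0 ?mulr_ge0 ?(ltW c0)//; move: h h3; lra.
by field; rewrite gt_eqF.
Qed.

Lemma jump_step_le (c : R) u M y : (forall l, 0 <= rho l y) -> 0 < c ->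
  \sum_l rho l y <= c -> (forall z, u z <= M) -> u y + c^-1 * jump u y <= M.
Proof.
move=> rho0 c0 rc uM.
have h : jump u y <= c * (M - u y).
  apply: (@le_trans _ _ (\sum_l rho l y * (M - u y))).
    by apply: ler_sum => l _; rewrite ler_wpM2l// lerB.
  by rewrite -mulr_suml ler_wpM2r// subr_ge0.
have := ler_wpM2l (_ : 0 <= c^-1) h.
rewrite invr_ge0 (ltW c0) mulrA mulVf ?gt_eqF// => /(_ isT); lra.
Qed.

Lemma jumpN u y : jump (fun z => - u z) y = - jump u y.
Proof. by rewrite /jump -sumrN; apply: eq_bigr => l _; ring. Qed.

Lemma jump_step_norm (c : R) u M y : (forall l, 0 <= rho l y) -> 0 < c ->
  \sum_l rho l y <= c -> (forall z, `|u z| <= M) -> `|u y + c^-1 * jump u y| <= M.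
Proof.
move=> rho0 c0 rc uM; rewrite ler_norml; apply/andP; split.
  rewrite lerNl opprD -mulrN -jumpN; apply: (jump_step_le (u := fun z => - u z)) => // z.
  by rewrite (le_trans _ (uM z))// -normrN ler_norm.
by apply: jump_step_le => // z; rewrite (le_trans _ (uM z))// ler_norm.
Qed.

End Jump.

Section MeanCS.
Context {R : realType} {I : finType} (r : R).
Hypotheses (r0 : 0 < r) (r1 : r < 1).
Local Notation E := (@Em R I r).

Lemma Em_CS (f g : (I -> nat) -> R) : bnd f -> bnd g ->
  E (fun y => f y * g y) ^+ 2 <= E (fun y => f y ^+ 2) * E (fun y => g y ^+ 2).
Proof.
move=> bf bg; set F := E (fun y => f y ^+ 2); set G := E (fun y => g y ^+ 2).
set H := E _.
have F0 : 0 <= F by apply: Em_ge0 => // y; exact: sqr_ge0.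
have G0 : 0 <= G by apply: Em_ge0 => // y; exact: sqr_ge0.
have key (t : R) : 0 <= F * t ^+ 2 - 2 * t * H + G.
  have -> : F * t ^+ 2 - 2 * t * H + G = E (fun y => (t * f y - g y) ^+ 2).
    rewrite [X in _ = E X](_ : _ = fun y =>
       t ^+ 2 * f y ^+ 2 + ((- 2 * t) * (f y * g y) + g y ^+ 2)).
      by rewrite EmD// EmD// !EmZ//; rewrite -/F -/G -/H; ring.
    by apply/funext => y; ring.
  by apply: Em_ge0 => // y; exact: sqr_ge0.
have [F00|Fn] := eqVneq F 0.
  rewrite F00 mul0r; have := key (G + 1); have := key ((G + 1) * H).
  rewrite F00 !mul0r !add0r => h _.
  rewrite leNgt; apply/negP => H2.
  have : 2 * ((G + 1) * H) * H >= 2 * (G + 1) * H ^+ 2 by lra.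
  have [Hn|H0] := eqVneq H 0; first by rewrite Hn expr0n ltxx in H2.
  have := key ((G + 1) / H); rewrite F00 mul0r add0r -mulrA mulrAC -mulrA mulfV// mulr1.
  rewrite mulrC -mulrA; lra.
have Fp : 0 < F by rewrite lt0r Fn.
have := key (H / F).
rewrite (_ : F * (H / F) ^+ 2 - 2 * (H / F) * H + G = (F * G - H ^+ 2) / F); last by field.
by rewrite pmulr_lge0 ?invr_gt0// subr_ge0.
Qed.

Lemma Em_CS_sqrt (f g : (I -> nat) -> R) : bnd f -> bnd g ->
  E (fun y => f y * g y) <= Num.sqrt (E (fun y => f y ^+ 2)) * Num.sqrt (E (fun y => g y ^+ 2)).
Proof.
move=> bf bg; rewrite -sqrtrM; last by apply: Em_ge0 => // y; exact: sqr_ge0.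
apply: (le_trans (ler_norm _)); rewrite -sqrtr_sqr ler_sqrt ?Em_CS//.
by rewrite (le_trans (sqr_ge0 (E (fun y => f y * g y))))// Em_CS.
Qed.

End MeanCS.

(** * Ties controlled by the Dirichlet form *)

Section Trace.
Context {R : realType} {I : finType} (r s : R).
Hypotheses (r0 : 0 < r) (r1 : r < 1) (sE : s = r^-1 - 1).
Implicit Types (u v : (I -> nat) -> R) (y : I -> nat) (i j : I).
Local Notation K := (#|I|%:R : R).
Local Notation E := (@Em R I r).

(** The Dirichlet form of the product law. *)
Definition Dir u : R := \sum_j E (fun y => (u (incr j y) - u y) ^+ 2).

Lemma Dir_ge0 u : bnd u -> 0 <= Dir u.
Proof.
by move=> bu; apply: sumr_ge0 => j _; apply: Em_ge0 => // y; exact: sqr_ge0.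
Qed.

Let s0 : 0 < s. Proof. by rewrite sE subr_gt0 invf_gt1. Qed.

(* Discrete integration by parts across the diagonal {y_i = y_j}. *)
Lemma trace_pair i j v : i != j -> bnd v ->
  E (fun y => (y i == y j)%:R * v y ^+ 2) <=
  s * E (fun y => v y ^+ 2) + E (fun y => `|v y ^+ 2 - v (incr i y) ^+ 2|).
Proof.
move=> ij bv.
have bf : bnd (fun y => (y j < y i)%N%:R * v y ^+ 2) by [].
(* The shift identity turns {y_j < y_i} into {y_j <= y_i}; the two differ by the diagonal. *)
have := Em_incr r0 r1 i bf.
rewrite (_ : (fun y => _ * (_ * _)) = (fun y => (y j < y i)%N%:R * v y ^+ 2)); last first.
  apply/funext => y; rewrite mulrA -natrM mulnb; congr (_%:R * _); congr nat_of_bool.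
  by case: (y i) => [|k]//=; rewrite ltn0.
rewrite (_ : (fun y => _) = (fun y => (y j <= y i)%N%:R * v (incr i y) ^+ 2)); last first.
  apply/funext => y; rewrite {1 2}/incr /upd eqxx eq_sym (negbTE ij) ltnS.
  by [].
have -> : r^-1 = 1 + s by rewrite sE addrC subrK.
set X := E (fun y => (y j < y i)%N%:R * _) => hX.
have X1 : X <= E (fun y => v y ^+ 2).
  by apply: Em_le => // y; rewrite ler_piMl ?sqr_ge0//; case: (_ < _)%N.
have h : E (fun y => (y i == y j)%:R * v y ^+ 2) <= E (fun y =>
    (y j <= y i)%N%:R * v (incr i y) ^+ 2 + `|v y ^+ 2 - v (incr i y) ^+ 2|
    - (y j < y i)%N%:R * v y ^+ 2).
  apply: Em_le => // y; rewrite leq_eqVlt (eq_sym (y j)).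
  have := ler_norm (v y ^+ 2 - v (incr i y) ^+ 2).
  have := normr_ge0 (v y ^+ 2 - v (incr i y) ^+ 2).
  have [->|_] := eqVneq (y i) (y j); rewrite ?ltnn /=; first by lra.
  by case: (_ < _)%N => /=; lra.
apply: (le_trans h); rewrite EmB// EmD// hX -/X.
have := ler_wpM2l (ltW s0) X1; lra.
Qed.

Lemma tie_le_pairs y : (tie y)%:R <= \sum_i \sum_(j | i != j) (y i == y j)%:R :> R.
Proof.
have [t|_] := boolP (tie y); last by rewrite sumr_ge0// => i _; rewrite sumr_ge0.
have [i hi] : exists i, amin i y.
  apply/existsP; rewrite -[X in is_true X]negbK negb_exists; apply/negP => /forallP h.
  by move: t; rewrite /tie /ngrp big1// => i _; apply/eqP; rewrite eqb0.
have [j /andP[ij hj]] : exists j, (i != j) && amin j y.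
  apply/existsP; rewrite -[X in is_true X]negbK negb_exists; apply/negP => /forallP h.
  move: t; rewrite /tie /ngrp (bigD1 i)//= big1 ?addn0; first by case: amin.
  move=> j ij; apply/eqP; rewrite eqb0; apply/negP => aj.
  by have := h j; rewrite eq_sym ij aj.
have e : y i = y j.
  by apply/eqP; rewrite eqn_leq (forallP hi) (forallP hj).
rewrite (bigD1 i)//= (bigD1 j)//= e eqxx -addrA lerDl addr_ge0 ?sumr_ge0// => k _.
by rewrite sumr_ge0.
Qed.

Lemma Em_tie_le v X : bnd v ->
  (forall i j, i != j -> E (fun y => (y i == y j)%:R * v y ^+ 2) <= X i) ->
  (forall i, 0 <= X i) ->
  E (fun y => (tie y)%:R * v y ^+ 2) <= K * \sum_i X i.
Proof.
move=> bv hX X0.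
apply: (@le_trans _ _ (E (fun y => \sum_i \sum_(j | i != j) (y i == y j)%:R * v y ^+ 2))).
  apply: Em_le => // y.
  apply: le_trans (ler_wpM2r (sqr_ge0 _) (tie_le_pairs y)) _.
  by rewrite mulr_suml; apply: ler_sum => i _; rewrite mulr_suml.
rewrite Em_sum// mulr_sumr; apply: ler_sum => i _; rewrite Em_sum//.
apply: (@le_trans _ _ (\sum_(j | i != j) X i)).
  by apply: ler_sum => j ij; exact: hX.
rewrite sumr_const -[leLHS]mulr_natl ler_wpM2r// ler_nat.
exact: max_card.
Qed.

(** Young's inequality with weight t for the product in |x^2 - z^2| <= 2 |x| |z - x| + (z - x)^2. *)
Lemma sqr_diff_le (t x z : R) : 0 < t ->
  `|x ^+ 2 - z ^+ 2| <= (1 + t) * (z - x) ^+ 2 + t^-1 * x ^+ 2.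
Proof.
move=> t0; have ti : t * t^-1 = 1 by rewrite mulfV// gt_eqF.
have tv : 0 < t^-1 by rewrite invr_gt0.
have h1 : 0 <= t^-1 * (t * (z - x) - x) ^+ 2 by rewrite mulr_ge0 ?sqr_ge0// ltW.
have h2 : 0 <= t^-1 * (t * (z - x) + x) ^+ 2 by rewrite mulr_ge0 ?sqr_ge0// ltW.
have e1 : t^-1 * (t * (z - x) - x) ^+ 2 = t * (z - x) ^+ 2 - 2 * (z - x) * x + t^-1 * x ^+ 2.
  by field; rewrite gt_eqF.
have e2 : t^-1 * (t * (z - x) + x) ^+ 2 = t * (z - x) ^+ 2 + 2 * (z - x) * x + t^-1 * x ^+ 2.
  by field; rewrite gt_eqF.
rewrite e1 in h1; rewrite e2 in h2; move: h1 h2.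
move: (t^-1 * x ^+ 2) => A h1 h2.
have h3 := sqr_ge0 (z - x).
rewrite ler_norml; apply/andP; split; lra.
Qed.

Lemma Em_sqr_diff_le i (t : R) v : 0 < t -> bnd v ->
  E (fun y => `|v y ^+ 2 - v (incr i y) ^+ 2|) <=
  (1 + t) * E (fun y => (v (incr i y) - v y) ^+ 2) + t^-1 * E (fun y => v y ^+ 2).
Proof.
move=> t0 bv; rewrite -!EmZ// -EmD//; apply: Em_le => // y.
exact: sqr_diff_le.
Qed.

(** The weight t is left free: [tie_sqr_le] takes t = q, which balances the two terms once the
    Poincare inequality is applied. *)
Lemma Em_tie_sqr_le (t : R) v : 0 < t -> bnd v ->
  E (fun y => (tie y)%:R * v y ^+ 2) <=
  K ^+ 2 * (s + t^-1) * E (fun y => v y ^+ 2) + K * (1 + t) * Dir v.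
Proof.
move=> t0 bv.
pose X i := s * E (fun y => v y ^+ 2) +
  ((1 + t) * E (fun y => (v (incr i y) - v y) ^+ 2) + t^-1 * E (fun y => v y ^+ 2)).
have E0 : 0 <= E (fun y => v y ^+ 2) by apply: Em_ge0 => // y; exact: sqr_ge0.
have h := @Em_tie_le v X bv.
apply: le_trans (h _ _) _.
- move=> i j ij; apply: le_trans (trace_pair ij bv) _.
  by rewrite lerD2l; exact: Em_sqr_diff_le.
- move=> i; rewrite /X; apply: addr_ge0; first by rewrite mulr_ge0// ltW.
  apply: addr_ge0; last by rewrite mulr_ge0// invr_ge0 ltW.
  apply: mulr_ge0; first by rewrite addr_ge0// ltW.
  by apply: Em_ge0 => // y; exact: sqr_ge0.
rewrite /X big_split/= big_split/= !sumr_const -mulr_sumr -/(Dir v).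
rewrite -[s * _ *+ _]mulr_natl -[t^-1 * _ *+ _]mulr_natl.
rewrite le_eqVlt; apply/orP; left; apply/eqP; ring.
Qed.

(** A constant function has no increments, so in [trace_pair] only the term with s, of order 1/q,
    survives. *)
Lemma Em_tie_prob : E (fun y => (tie y)%:R) <= K ^+ 2 * s.
Proof.
have := @Em_tie_le (fun=> 1) (fun=> s) _ _ _.
rewrite [X in E X <= _](_ : _ = fun y => (tie y)%:R); last first.
  by apply/funext => y; rewrite expr1n mulr1.
rewrite sumr_const -[s *+ _]mulr_natl mulrA -expr2; apply => //; last by move=> _; exact: ltW.
move=> i j ij; apply: le_trans (trace_pair ij _) _ => //.
by rewrite subrr normr0 expr1n !Em_cst// mulr1 addr0.
Qed.

End Trace.

(** * Decay of the variance and drift of the mean, with explicit constants *)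

Section Contraction.
Context {R : realType} {I : finType} (i0 : I).
Variables (b q lam nu beta r s c1 c2 c3 c4 c5 : R).
Hypotheses (r0 : 0 < r) (r1 : r < 1) (sE : s = r^-1 - 1).
Implicit Types (u v : (I -> nat) -> R) (y : I -> nat) (i j : I).
Local Notation K := (#|I|%:R : R).
Local Notation E := (@Em R I r).
Hypotheses (nuE : nu = q ^+ 2) (betaE : beta = b * q).
Hypotheses (b0 : 0 < b) (q1 : 1 <= q) (lam_ge : q ^+ 2 / 2 <= lam) (lam_le : lam <= q ^+ 2).
Hypothesis rK : r ^+ #|I| * (lam + beta) = lam.
Hypothesis hc1 : `|lam - nu * r| <= c1 * q.
Hypothesis hc2 : `|K * s - beta / lam| <= c2 / q ^+ 2.
Hypothesis hc3 : beta / lam <= c3 / q.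
Hypothesis hc4 : s <= c4 / q.
Hypothesis hc5 : c5 / q <= s.
Hypothesis c50 : 0 < c5.
Hypothesis s_le1 : s <= 1.

Local Notation G := (gap_gen lam nu beta).
Local Notation T := (@tie_gen R I).
Local Notation Dr := (Dir r).

Let q0 : 0 < q. Proof. exact: lt_le_trans q1. Qed.
Let lam0 : 0 < lam.
Proof. by apply: lt_le_trans lam_ge; rewrite divr_gt0// exprn_gt0. Qed.
Let beta0 : 0 < beta. Proof. by rewrite betaE mulr_gt0. Qed.
Let s0 : 0 < s. Proof. by rewrite sE subr_gt0 invf_gt1. Qed.
Let K1 : 1 <= K. Proof. by rewrite ler1n; apply/card_gt0P; exists i0. Qed.
Let c10 : 0 <= c1.
Proof. by rewrite -(pmulr_lge0 _ q0); apply: le_trans hc1. Qed.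
Let c30 : 0 <= c3.
Proof.
have : 0 <= c3 / q by apply: le_trans hc3; rewrite divr_ge0// ltW.
by rewrite pmulr_lge0// invr_gt0.
Qed.
Let c40 : 0 <= c4.
Proof.
have : 0 <= c4 / q by apply: le_trans hc4; rewrite ltW.
by rewrite pmulr_lge0// invr_gt0.
Qed.

(** The Poincare constant in units of q^2: since c5 / q <= s <= 1, one has 2 (2 + s) / s^2 <= 6 q^2
    / c5^2. *)
Definition CP : R := 6 / c5 ^+ 2.
(** Collects both terms of [Em_tie_sqr_le] at t = q after the Poincare inequality, in units of q. *)
Definition CT : R := K ^+ 2 * (c4 + 1) * CP + 2 * K.

Let CP0 : 0 < CP. Proof. by rewrite divr_gt0// exprn_gt0. Qed.
Let CT0 : 0 <= CT.
Proof.
rewrite /CT; apply: addr_ge0; last exact: mulr_ge0.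
by apply: mulr_ge0; [apply: mulr_ge0; [exact: exprn_ge0|exact: addr_ge0]|exact: ltW].
Qed.

Lemma poincare u : bnd u -> E (fun y => u y ^+ 2) - E u ^+ 2 <= CP * q ^+ 2 * Dr u.
Proof.
move=> bu; apply: le_trans (Pm_poincare _ r0 r1 sE (index_enum_uniq I) bu) _.
rewrite -/(Dir r u); apply: ler_wpM2r; first exact: Dir_ge0.
have c5s : c5 <= s * q by move: hc5; rewrite ler_pdivrMr.
rewrite ler_pdivrMr ?exprn_gt0//.
apply: (@le_trans _ _ 6); first by move: s_le1; lra.
rewrite /CP -mulrA mulrAC ler_pdivlMr ?exprn_gt0// ler_wpM2l// -exprMn.
by rewrite ler_pXn2r ?nnegrE 1?mulrC// ?mulr_ge0// ltW.
Qed.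

Lemma tie_sqr_le u : bnd u -> E u = 0 ->
  E (fun y => (tie y)%:R * u y ^+ 2) <= CT * q * Dr u.
Proof.
move=> bu u0; have := poincare bu; rewrite u0 expr0n subr0 => hP.
apply: le_trans (Em_tie_sqr_le r0 r1 sE q0 bu) _.
have D0 := Dir_ge0 r0 r1 bu.
have V0 : 0 <= E (fun y => u y ^+ 2) by apply: Em_ge0 => // y; exact: sqr_ge0.
have h1 : K ^+ 2 * (s + q^-1) * E (fun y => u y ^+ 2) <=
          K ^+ 2 * ((c4 + 1) / q) * (CP * q ^+ 2 * Dr u).
  apply: ler_pM => //; first by rewrite mulr_ge0 ?exprn_ge0 ?addr_ge0 ?invr_ge0// ltW.
  by rewrite ler_wpM2l ?exprn_ge0// mulrDl mul1r lerD2r.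
have h2 : K * (1 + q) * Dr u <= K * (2 * q) * Dr u.
  by rewrite ler_wpM2r// ler_wpM2l//; move: q1; lra.
apply: le_trans (lerD h1 h2) _.
rewrite /CT le_eqVlt; apply/orP; left; apply/eqP; field.
by rewrite gt_eqF.
Qed.

(** The coefficient of q D in [gap_gen_sqr_le], D being the Dirichlet form; the condition 16 C6 <= q
    makes this term at most q^2 D / 16. *)
Definition C6 : R := c1 * c2 * CP + c1 * c3 * CT + b + 16 * b ^+ 2 * K * CT.

Lemma norm_tie_gen_le u y : `|T u y| <= (tie y)%:R * \sum_j `|u (incr j y) - u y|.
Proof.
rewrite /tie_gen; case: (tie y); last by rewrite !mul0r normr0.
rewrite !mul1r normrM ger0_norm ?invr_ge0//.
rewrite -[leRHS]mul1r ler_pM// ?invr_ge0//.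
  by rewrite invf_le1 ?ler1n ?ltr0n (ngrp_gt0 i0).
apply: le_trans (ler_norm_sum _ _ _) _; apply: ler_sum => j _.
by case: amin; rewrite ?mul1r ?mul0r ?normr0.
Qed.

Lemma bnd_tie_gen u : bnd u -> bnd (T u).
Proof.
move=> bu; have : bnd (fun y => (tie y)%:R * \sum_j `|u (incr j y) - u y| : R) by [].
move=> [M hM]; exists M => y; apply: le_trans (norm_tie_gen_le u y) _.
exact: le_trans (ler_norm _) (hM y).
Qed.

Lemma Em_norm_le (f g : (I -> nat) -> R) : bnd f -> bnd g ->
  (forall y, `|f y| <= g y) -> `|E f| <= E g.
Proof.
move=> bf bg fg; rewrite ler_norml; apply/andP; split.
  rewrite -[- E g]mulN1r -EmZ//; apply: Em_le => // y.
  by rewrite mulN1r lerNl (le_trans _ (fg y))// -normrN ler_norm.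
by apply: Em_le => // y; rewrite (le_trans _ (fg y))// ler_norm.
Qed.

Lemma tie_gen_sqr_le u (t : R) : 0 < t -> bnd u -> E u = 0 ->
  `|E (T (fun y => u y ^+ 2))| <= (1 + t) * Dr u + t^-1 * K * CT * q * Dr u.
Proof.
move=> t0 bu u0.
pose g y := \sum_j ((1 + t) * (u (incr j y) - u y) ^+ 2 + t^-1 * ((tie y)%:R * u y ^+ 2)).
have bT : bnd (T (fun y => u y ^+ 2)) by exact: bnd_tie_gen.
apply: (@le_trans _ _ (E g)).
  have bg : bnd g by rewrite /g.
  apply: Em_norm_le => // y; apply: le_trans (norm_tie_gen_le _ y) _.
  rewrite mulr_sumr; apply: ler_sum => j _.
  have h := sqr_diff_le (u y) (u (incr j y)) t0.
  case: (tie y); first by rewrite !mul1r distrC.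
  by rewrite !mul0r mulr0 addr0 mulr_ge0 ?sqr_ge0// addr_ge0// ltW.
rewrite /g Em_sum// (eq_bigr (fun j => (1 + t) * E (fun y => (u (incr j y) - u y) ^+ 2)
  + t^-1 * E (fun y => (tie y)%:R * u y ^+ 2))); last by move=> j _; rewrite EmD// !EmZ.
rewrite big_split/= -mulr_sumr -/(Dir r u) sumr_const -[_ *+ _]mulr_natl lerD2l.
rewrite mulrCA -!mulrA ler_wpM2l ?invr_ge0 ?(ltW t0)// ler_wpM2l// !mulrA.
exact: tie_sqr_le.
Qed.

(** Exact stationarity would make this mean 0. What [Em_gap_gen] leaves over is bounded by the
    Dirichlet form, through the Poincare inequality and the tie estimates, by at most half of what
    the defect in Jensen's inequality gains. *)
Lemma gap_gen_sqr_le u : bnd u -> (forall y, u (upall y) = u y) -> E u = 0 ->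
  16 * C6 <= q -> `|E (G (fun y => u y ^+ 2))| <= q ^+ 2 / 8 * Dr u.
Proof.
move=> bu iu u0 hq.
have bT : bnd (T (fun y => u y ^+ 2)) by exact: bnd_tie_gen.
rewrite (Em_gap_gen i0 nu r0 r1 sE lam0 beta0 rK)//; last by move=> y; rewrite iu.
have D0 := Dir_ge0 r0 r1 bu.
set D := Dr u in D0 *.
have V0 : 0 <= E (fun y => u y ^+ 2) by apply: Em_ge0 => // y; exact: sqr_ge0.
have T0 : 0 <= E (fun y => (tie y)%:R * u y ^+ 2).
  by apply: Em_ge0 => // y; rewrite mulr_ge0// sqr_ge0.
have hP : E (fun y => u y ^+ 2) <= CP * q ^+ 2 * D.
  by have := poincare bu; rewrite u0 expr0n subr0.
have hT := tie_sqr_le bu u0.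
rewrite -/D in hT.
(* This weight t in [tie_gen_sqr_le] satisfies beta t = q^2 / 16, while the term with its inverse
   stays of order q. *)
have t0 : 0 < q / (16 * b) by rewrite divr_gt0// mulr_gt0.
have hG := tie_gen_sqr_le t0 bu u0.
rewrite -/D in hG.
apply: le_trans (ler_normD _ _) _.
rewrite normrM [`|beta * _|]normrM (gtr0_norm beta0).
have h1 : `|(K * s - beta / lam) * E (fun y => u y ^+ 2) +
     beta / lam * E (fun y => (tie y)%:R * u y ^+ 2)| <=
   (c2 * CP + c3 * CT) * D.
  apply: le_trans (ler_normD _ _) _; rewrite !normrM (ger0_norm V0) (ger0_norm T0).
  rewrite mulrDl; apply: lerD.
    apply: le_trans (ler_pM (normr_ge0 _) V0 hc2 hP) _.
    by rewrite le_eqVlt; apply/orP; left; apply/eqP; field; rewrite gt_eqF.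
  have hb : `|beta| * `|lam^-1| <= c3 / q.
    by rewrite (gtr0_norm beta0) gtr0_norm// invr_gt0.
  apply: le_trans (ler_pM _ T0 hb hT) _; first by rewrite mulr_ge0.
  by rewrite le_eqVlt; apply/orP; left; apply/eqP; field; rewrite gt_eqF.
have h2 := ler_pM (normr_ge0 _) (normr_ge0 _) hc1 h1.
have h3 := ler_wpM2l (ltW beta0) hG.
apply: le_trans (lerD h2 h3) _.
have -> : c1 * q * ((c2 * CP + c3 * CT) * D) + beta * ((1 + q / (16 * b)) * D +
   (q / (16 * b))^-1 * K * CT * q * D) = (q * C6 + q ^+ 2 / 16) * D.
  by rewrite betaE /C6; field; rewrite !gt_eqF.
rewrite ler_wpM2r//.
have := ler_wpM2l (ltW q0) hq; rewrite expr2.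
by rewrite (mulrCA q 16); move: (q * q) (q * C6) => A B; lra.
Qed.

Definition C7 : R := c1 * c3 * Num.sqrt (K ^+ 2 * c4) * Num.sqrt CT
  + b * K * Num.sqrt (K ^+ 2 * c4).

(** The bias is linear in [u], so Cauchy-Schwarz lets the tie probability, of order 1/q, enter only
    with its square root; multiplied by beta this gives sqrt q. *)
Lemma gap_gen_mean_le u : bnd u -> (forall y, u (upall y) = u y) -> E u = 0 ->
  `|E (G u)| <= C7 * Num.sqrt q * Num.sqrt (Dr u).
Proof.
move=> bu iu u0.
have bT : bnd (T u) by exact: bnd_tie_gen.
rewrite (Em_gap_gen i0 nu r0 r1 sE lam0 beta0 rK)// u0 mulr0 add0r.
have D0 := Dir_ge0 r0 r1 bu.
set D := Dr u in D0 *.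
have sq0 : 0 < Num.sqrt q by rewrite sqrtr_gt0.
have ht : Num.sqrt (E (fun y => ((tie y)%:R : R) ^+ 2)) <= Num.sqrt (K ^+ 2 * c4) / Num.sqrt q.
  rewrite -sqrtrV ?(ltW q0)// -sqrtrM ?mulr_ge0// ?exprn_ge0// ler_sqrt; last first.
    by rewrite !mulr_ge0 ?invr_ge0// ltW.
  rewrite (_ : (fun y => _) = (fun y => (tie y)%:R)); last first.
    by apply/funext => y; case: tie; rewrite ?expr1n ?expr0n.
  have hp : E (fun y => (tie y)%:R) <= K ^+ 2 * s by exact: (Em_tie_prob r0 r1 sE).
  apply: le_trans hp _.
  by rewrite -[leRHS]mulrA; apply: ler_wpM2l => //; exact: exprn_ge0.
have h1 : `|E (fun y => (tie y)%:R * u y)| <=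
   Num.sqrt (K ^+ 2 * c4) * Num.sqrt CT * Num.sqrt D.
  (* The idempotent indicator is written twice to leave a copy in each factor of Cauchy-Schwarz: one
     yields the tie probability, the other makes [tie_sqr_le] applicable. *)
  apply: (@le_trans _ _ (E (fun y => (tie y)%:R * ((tie y)%:R * `|u y|)))).
    apply: Em_norm_le => // y; case: (tie y); by rewrite ?mul1r ?mul0r ?normr0.
  apply: le_trans (Em_CS_sqrt r0 r1 _ _) _ => //.
  apply: le_trans (ler_pM _ _ ht (_ : _ <= Num.sqrt (CT * q * D))) _.
  - exact: sqrtr_ge0.
  - exact: sqrtr_ge0.
  - rewrite ler_sqrt; last by rewrite !mulr_ge0// ltW.
    rewrite (_ : (fun y => _) = fun y => (tie y)%:R * u y ^+ 2); first exact: tie_sqr_le.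
    apply/funext => y; case: tie; rewrite ?mul1r ?mul0r ?expr0n//.
    by rewrite real_normK ?num_real.
  rewrite !sqrtrM ?mulr_ge0// ?(ltW q0)//.
  by rewrite le_eqVlt; apply/orP; left; apply/eqP; field; rewrite gt_eqF.
have h2 : `|E (T u)| <= K * (Num.sqrt (K ^+ 2 * c4) / Num.sqrt q * Num.sqrt D).
  apply: (@le_trans _ _ (E (fun y => \sum_j (tie y)%:R * `|u (incr j y) - u y|))).
    apply: Em_norm_le => // y; rewrite -mulr_sumr; exact: norm_tie_gen_le.
  rewrite Em_sum// mulr_natl -sumr_const; apply: ler_sum => j _.
  apply: le_trans (Em_CS_sqrt r0 r1 _ _) _ => //.
  apply: ler_pM => //; rewrite ?sqrtr_ge0//.
  rewrite ler_sqrt; last exact: D0.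
  rewrite (_ : (fun y => _) = fun y => (u (incr j y) - u y) ^+ 2); last first.
    by apply/funext => y; rewrite real_normK ?num_real.
  rewrite /D /Dir (bigD1 j)//= lerDl sumr_ge0// => k _.
  by apply: Em_ge0 => // y; exact: sqr_ge0.
apply: le_trans (ler_normD _ _) _; rewrite !normrM (gtr0_norm beta0) normrV ?unitfE ?gt_eqF//.
rewrite (gtr0_norm lam0).
set s1 := Num.sqrt (K ^+ 2 * c4) in ht h1 h2 *.
have s10 : 0 <= s1 by exact: sqrtr_ge0.
have sD0 : 0 <= Num.sqrt D by exact: sqrtr_ge0.
have sC0 : 0 <= Num.sqrt CT by exact: sqrtr_ge0.
have sq1 : 1 <= Num.sqrt q by rewrite -[leLHS]sqrtr1 ler_wsqrtr.
have a1 : `|lam - nu * r| * (beta / lam * `|E (fun y => (tie y)%:R * u y)|) <=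
   c1 * c3 * s1 * Num.sqrt CT * Num.sqrt q * Num.sqrt D.
  apply: (@le_trans _ _ ((c1 * q) * ((c3 / q) * (s1 * Num.sqrt CT * Num.sqrt D)))).
    apply: ler_pM => //; first by rewrite mulr_ge0// divr_ge0// ltW.
    by apply: ler_pM => //; rewrite divr_ge0// ltW.
  rewrite (_ : c1 * q * _ = c1 * c3 * s1 * Num.sqrt CT * Num.sqrt D); last first.
    by field; rewrite gt_eqF.
  rewrite ler_wpM2r//; rewrite -[leLHS]mulr1 ler_wpM2l// !mulr_ge0//.
have a2 : beta * `|E (T u)| <= b * K * s1 * Num.sqrt q * Num.sqrt D.
  apply: le_trans (ler_wpM2l (ltW beta0) h2) _.
  rewrite betaE -{1}(sqr_sqrtr (ltW q0)).
  by rewrite le_eqVlt; apply/orP; left; apply/eqP; field; rewrite gt_eqF.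
apply: le_trans (lerD a1 a2) _.
by rewrite /C7 -/s1 le_eqVlt; apply/orP; left; apply/eqP; ring.
Qed.

(** The total rate is at most (2 K + b) q^2; the factor 2 makes it at most half of the clock rate c,
    as [jump_sqr] demands. *)
Definition c0 : R := 2 * (2 * K + b).
Let c := c0 * q ^+ 2.
Definition Qgap u y : R := u y + c^-1 * G u y.

Let c00 : 0 < c0.
Proof. by rewrite mulr_gt0// addr_gt0// mulr_gt0// (lt_le_trans _ K1). Qed.
Let cp : 0 < c. Proof. by rewrite mulr_gt0// exprn_gt0. Qed.

(** Labels 0, 1 and 2 stand for arrivals, departures and the extra stream. *)
Definition grate (l : 'I_3 * I) y : R :=
  match val l.1 with
  | 0 => lam | 1 => nu | _ => beta / (ngrp y)%:R * (amin l.2 y)%:R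
  end.
Definition gmove (l : 'I_3 * I) y : I -> nat :=
  if val l.1 == 1%N then downf l.2 y else incr l.2 y.

Lemma grate_ge0 l y : 0 <= grate l y.
Proof.
rewrite /grate; case: (val l.1) => [|[|k]]; first exact: ltW.
  by rewrite nuE exprn_ge0// ltW.
by rewrite mulr_ge0// divr_ge0// ltW.
Qed.

Lemma sum_grate (F : 'I_3 * I -> R) : \sum_l F l =
  \sum_j (F (ord0, j) + F (lift ord0 ord0, j) + F (lift ord0 (lift ord0 ord0), j)).
Proof.
transitivity (\sum_(t < 3) \sum_j F (t, j)).
  by rewrite pair_bigA/=; apply: eq_bigr => -[].
rewrite !big_ord_recl big_ord0 addr0.
by rewrite !big_split/= addrA.
Qed.

Lemma gap_gen_jump u y : G u y = jump grate gmove u y.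
Proof. by rewrite /jump sum_grate. Qed.

Lemma sum_grate_le y : \sum_l grate l y <= c / 2.
Proof.
rewrite sum_grate /grate/= big_split/= big_split/= !sumr_const -mulr_sumr -natr_sum.
rewrite -/(ngrp y) divfK ?pnatr_eq0 -?lt0n ?(ngrp_gt0 i0)//.
rewrite -[lam *+ _]mulr_natl -[nu *+ _]mulr_natl.
have h : K * lam <= K * q ^+ 2 by rewrite ler_wpM2l.
have h2 : b * q <= b * q ^+ 2 by rewrite ler_wpM2l ?(ltW b0)// ler_eXnr.
have -> : c / 2 = K * q ^+ 2 + K * q ^+ 2 + b * q ^+ 2.
  by rewrite /c /c0; field.
by rewrite nuE betaE !lerD.
Qed.

Lemma sum_grate_le1 y : \sum_l grate l y <= c.
Proof. by apply: le_trans (sum_grate_le y) _; move: cp; lra. Qed.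

Lemma Qgap_norm u M : (forall y, `|u y| <= M) -> forall y, `|Qgap u y| <= M.
Proof.
move=> uM y; rewrite /Qgap gap_gen_jump; apply: jump_step_norm => //.
  by move=> l; exact: grate_ge0.
exact: sum_grate_le1.
Qed.

Lemma bnd_Qgap u : bnd u -> bnd (Qgap u).
Proof. by move=> [M hM]; exists M; exact: Qgap_norm. Qed.

Lemma Qgap_upall u : (forall y, u (upall y) = u y) ->
  forall y, Qgap u (upall y) = Qgap u y.
Proof. by move=> iu y; rewrite /Qgap iu gap_gen_upall. Qed.

Lemma gap_gen_shift u (m : R) y : G (fun y => u y - m) y = G u y.
Proof. by rewrite !gap_gen_jump; apply: eq_bigr => l _; congr (_ * _); ring. Qed.

Definition Var u : R := E (fun y => u y ^+ 2) - E u ^+ 2.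

Lemma Var_shift u m : bnd u -> E (fun y => (u y - m) ^+ 2) = Var u + (E u - m) ^+ 2.
Proof.
move=> bu; rewrite (_ : (fun y => _) = fun y => u y ^+ 2 + ((- 2 * m) * u y + m ^+ 2)).
  by rewrite EmD// EmD// EmZ// Em_cst// /Var; ring.
by apply/funext => y; ring.
Qed.

Lemma Dir_shift u m : Dr (fun y => u y - m) = Dr u.
Proof.
apply: eq_bigr => j _; congr (Em _ _); apply/funext => y; congr (_ ^+ 2); ring.
Qed.

(** The defect in Jensen's inequality gains at least 2 (8 c0)^-1 D, already from the arrivals alone,
    and the failure of stationarity costs at most (8 c0)^-1 D, where D is the Dirichlet form of
    [u]. *)
Lemma Var_Qgap_le u : bnd u -> (forall y, u (upall y) = u y) -> 16 * C6 <= q ->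
  Var (Qgap u) <= Var u - (8 * c0)^-1 * Dr u.
Proof.
move=> bu iu hq; set m := E u; pose w y := u y - m.
have bw : bnd w by rewrite /w.
have bQ := bnd_Qgap bu.
have bG2 : bnd (G (fun y => w y ^+ 2)) by exact: bnd_gap_gen.
have iw y : w (upall y) = w y by rewrite /w iu.
have w0 : E w = 0 by rewrite EmB// Em_cst// subrr.
have D0 := Dir_ge0 r0 r1 bu.
have hV : E (fun y => w y ^+ 2) = Var u by rewrite Var_shift// subrr expr0n addr0.
(* The variance is the smallest second moment, so the old mean may be kept as centre. *)
have h1 : Var (Qgap u) <= E (fun y => (Qgap u y - m) ^+ 2).
  by rewrite Var_shift// lerDl sqr_ge0.
apply: le_trans h1 _.
have bD : bnd (fun y => \sum_j (w (incr j y) - w y) ^+ 2) by [].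
have bQ2 : bnd (fun y => Qgap u y - m) by [].
have h2 : E (fun y => (Qgap u y - m) ^+ 2) <=
   E (fun y => (w y ^+ 2 + c^-1 * G (fun z => w z ^+ 2) y)
     - (2 * c)^-1 * (lam * \sum_j (w (incr j y) - w y) ^+ 2)).
  apply: Em_le => // y.
  have -> : Qgap u y - m = w y + c^-1 * jump grate gmove w y.
    by rewrite -gap_gen_jump gap_gen_shift /w /Qgap; ring.
  rewrite gap_gen_jump.
  have h := jump_sqr gmove w (fun l => grate_ge0 l y) cp (sum_grate_le y).
  apply: le_trans h _; rewrite lerD2l lerN2; apply: ler_wpM2l.
    by rewrite invr_ge0; apply: mulr_ge0 => //; exact: ltW.
  rewrite sum_grate mulr_sumr; apply: ler_sum => j _.
  have -> : lam * (w (incr j y) - w y) ^+ 2 =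
    grate (ord0, j) y * (w (gmove (ord0, j) y) - w y) ^+ 2 by [].
  by rewrite -[leRHS]addrA lerDl; apply: addr_ge0; apply: mulr_ge0; rewrite ?sqr_ge0// grate_ge0.
apply: le_trans h2 _.
rewrite EmB// EmD// !EmZ// Em_sum// hV -/(Dir r w) Dir_shift.
have h3 := gap_gen_sqr_le bw iw w0 hq.
rewrite Dir_shift in h3.
have h4 : c^-1 * E (G (fun z => w z ^+ 2)) <= c^-1 * (q ^+ 2 / 8 * Dr u).
  rewrite ler_wpM2l ?invr_ge0 ?(ltW cp)//; exact: le_trans (ler_norm _) h3.
have h5 : (2 * c)^-1 * (q ^+ 2 / 2 * Dr u) <= (2 * c)^-1 * (lam * Dr u).
  apply: ler_wpM2l; last exact: ler_wpM2r.
  by rewrite invr_ge0; apply: mulr_ge0 => //; exact: ltW.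
have e4 : c^-1 * (q ^+ 2 / 8 * Dr u) = (8 * c0)^-1 * Dr u.
  by rewrite /c; field; rewrite !gt_eqF.
have e5 : (2 * c)^-1 * (q ^+ 2 / 2 * Dr u) = 2 * ((8 * c0)^-1 * Dr u).
  by rewrite /c; field; rewrite !gt_eqF.
rewrite e4 in h4; rewrite e5 in h5; move: h4 h5.
move: (c^-1 * E _) ((8 * c0)^-1 * Dr u) ((2 * c)^-1 * _) (Var u) => A B C' V; lra.
Qed.

Lemma Qgap_mean u : bnd u -> E (Qgap u) = E u + c^-1 * E (G u).
Proof.
move=> bu; have bG : bnd (G u) by exact: bnd_gap_gen.
by rewrite /Qgap EmD// EmZ.
Qed.

Lemma Qgap_mean_le u : bnd u -> (forall y, u (upall y) = u y) ->
  `|E (Qgap u) - E u| <= C7 / (c0 * q ^+ 2) * Num.sqrt q * Num.sqrt (Dr u).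
Proof.
move=> bu iu; rewrite Qgap_mean// addrC addKr normrM gtr0_norm ?invr_gt0//.
have bw : bnd (fun y => u y - E u) by [].
have w0 : E (fun y => u y - E u) = 0 by rewrite EmB// Em_cst// subrr.
have := gap_gen_mean_le bw _ w0.
rewrite Dir_shift (_ : G (fun y => u y - E u) = G u); last first.
  by apply/funext => y; rewrite gap_gen_shift.
move=> h; rewrite -/c (mulrC C7) -!mulrA; apply: ler_wpM2l; first by rewrite invr_ge0 ltW.
by rewrite mulrA; apply: h => // y; rewrite iu.
Qed.

Definition C8 : R := 16 * C7 * Num.sqrt CP.

(** The difference of standard deviations on the right is what makes the estimate summable over the
    steps. *)
Lemma Qgap_step u : bnd u -> (forall y, u (upall y) = u y) -> 16 * C6 <= q ->
  `|E (Qgap u) - E u| <= C8 / Num.sqrt q * (Num.sqrt (Var u) - Num.sqrt (Var (Qgap u))).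
Proof.
move=> bu iu hq.
have V0 v : bnd v -> 0 <= Var v.
  by move=> bv; rewrite subr_ge0; apply: Pm_sqr_le.
have h1 := Var_Qgap_le bu iu hq.
have bQ := bnd_Qgap bu.
have D0 := Dir_ge0 r0 r1 bu.
set x := Num.sqrt (Var u); set x' := Num.sqrt (Var (Qgap u)).
have x0 : 0 <= x by exact: sqrtr_ge0.
have x'0 : 0 <= x' by exact: sqrtr_ge0.
set z := Num.sqrt (Dr u).
have z0 : 0 <= z by exact: sqrtr_ge0.
have zE : Dr u = z ^+ 2 by rewrite sqr_sqrtr.
have xE : Var u = x ^+ 2 by rewrite sqr_sqrtr// V0.
have x'E : Var (Qgap u) = x' ^+ 2 by rewrite sqr_sqrtr// V0.
set p := Num.sqrt CP.
have p0 : 0 < p by rewrite sqrtr_gt0.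
have pE : CP = p ^+ 2 by rewrite sqr_sqrtr// ltW.
have hx : x <= p * q * z.
  have := poincare bu; rewrite -/(Var u) xE zE pE -!exprMn.
  by rewrite ler_pXn2r// nnegrE !mulr_ge0// ltW.
have xx' : x' <= x.
  rewrite /x /x' ler_sqrt; last exact: V0.
  apply: le_trans h1 _; rewrite gerBl mulr_ge0// invr_ge0 mulr_ge0//; exact: ltW.
(* The variance drops by at least (8 c0)^-1 z^2, and x^2 - x'^2 = (x - x') (x + x') with x + x' <= 2
   x <= 2 p q z; dividing by z bounds z by the decrease of x. *)
have key : z <= 16 * c0 * p * q * (x - x').
  have [->|zn] := eqVneq z 0.
    apply: mulr_ge0; last by rewrite subr_ge0.
    by do 3 (apply: mulr_ge0; last exact: ltW).
  have zp : 0 < z by rewrite lt0r zn.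
  have h2 : (8 * c0)^-1 * z ^+ 2 <= (x - x') * (2 * x).
    have : (8 * c0)^-1 * z ^+ 2 <= (x - x') * (x + x').
      have -> : (x - x') * (x + x') = x ^+ 2 - x' ^+ 2 by ring.
      by move: h1; rewrite xE x'E zE; move: (_ * z ^+ 2) => A; lra.
    move/le_trans; apply; rewrite ler_wpM2l ?subr_ge0//; move: xx'; lra.
  have h3 : (x - x') * (2 * x) <= (x - x') * (2 * (p * q * z)).
    by rewrite ler_wpM2l ?subr_ge0// ler_wpM2l.
  have := le_trans h2 h3; rewrite ler_pdivrMl; last exact: mulr_gt0.
  rewrite (_ : 8 * c0 * _ = 16 * c0 * p * q * (x - x') * z); last by ring.
  by rewrite expr2 ler_pM2r.
have sq0 : 0 < Num.sqrt q by rewrite sqrtr_gt0.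
have C70 : 0 <= C7.
  rewrite /C7; apply: addr_ge0.
    by rewrite !mulr_ge0 ?sqrtr_ge0.
  by rewrite !mulr_ge0 ?sqrtr_ge0// ltW.
apply: le_trans (Qgap_mean_le bu iu) _.
apply: (@le_trans _ _ (C7 / (c0 * q ^+ 2) * Num.sqrt q * (16 * c0 * p * q * (x - x')))).
  apply: ler_wpM2l => //; apply: mulr_ge0; last exact: ltW.
  by apply: divr_ge0 => //; exact: ltW.
have gen (C t k w X qq : R) : t != 0 -> k != 0 -> qq = t ^+ 2 ->
    C / (k * qq ^+ 2) * t * (16 * k * w * qq * X) = 16 * C * w / t * X.
  by move=> tn kn ->; field; rewrite tn kn.
rewrite /C8 -/p gen ?gt_eqF//.
by rewrite sqr_sqrtr// ltW.
Qed.

Fixpoint Qiter k u : (I -> nat) -> R := if k is k'.+1 then Qgap (Qiter k' u) else u.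

Lemma Qiter_norm k u M : (forall y, `|u y| <= M) -> forall y, `|Qiter k u y| <= M.
Proof. by move=> uM; elim: k => //= k IH; exact: Qgap_norm. Qed.

Lemma bnd_Qiter k u : bnd u -> bnd (Qiter k u).
Proof. by move=> [M hM]; exists M; exact: Qiter_norm. Qed.

Lemma Qiter_upall k u : (forall y, u (upall y) = u y) ->
  forall y, Qiter k u (upall y) = Qiter k u y.
Proof. by move=> iu; elim: k => //= k IH; exact: Qgap_upall. Qed.

Let V0 v : bnd v -> 0 <= Var v.
Proof. by move=> bv; rewrite subr_ge0; apply: Pm_sqr_le. Qed.

(** The decay rate of the variance per step; the added 1 keeps it below 1. *)
Definition kap : R := (8 * c0 * (CP * q ^+ 2 + 1))^-1.

Let kap01 : 0 < kap < 1.
Proof.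
have h : 1 < 8 * c0 * (CP * q ^+ 2 + 1).
  have h1 : 1 < 8 * c0.
    by rewrite /c0; have := K1; have := b0; lra.
  apply: lt_le_trans h1 _; rewrite ler_peMr//; first by apply: mulr_ge0 => //; exact: ltW.
  by rewrite lerDr; apply: mulr_ge0; [exact: ltW|apply: exprn_ge0; exact: ltW].
by rewrite /kap invr_gt0 invf_lt1 ?h (lt_trans _ h).
Qed.

Lemma Var_Qiter k u : bnd u -> (forall y, u (upall y) = u y) -> 16 * C6 <= q ->
  Var (Qiter k u) <= (1 - kap) ^+ k * Var u.
Proof.
move=> bu iu hq; elim: k => [|k IH]; first by rewrite expr0 mul1r.
have bk := bnd_Qiter k bu; have ik := Qiter_upall k iu.
have h1 := Var_Qgap_le bk ik hq.
have D0 := Dir_ge0 r0 r1 bk.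
have hP := poincare bk; rewrite -/(Var _) in hP.
have /andP[k0 k1] := kap01.
have h2 : kap * Var (Qiter k u) <= (8 * c0)^-1 * Dr (Qiter k u).
  have hP' : Var (Qiter k u) <= (CP * q ^+ 2 + 1) * Dr (Qiter k u).
    by apply: le_trans hP _; rewrite ler_wpM2r// lerDl.
  apply: le_trans (ler_wpM2l (ltW k0) hP') _.
  rewrite /kap le_eqVlt; apply/orP; left; apply/eqP; field.
  by rewrite !gt_eqF//= addr_gt0// mulr_gt0// exprn_gt0.
rewrite exprS -mulrA; apply: (@le_trans _ _ ((1 - kap) * Var (Qiter k u))).
  by rewrite mulrBl mul1r; apply: le_trans h1 _; rewrite lerD2l lerN2.
by rewrite ler_wpM2l// subr_ge0 ltW.
Qed.

Lemma Qiter_mean k m u : bnd u -> (forall y, u (upall y) = u y) -> 16 * C6 <= q ->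
  `|E (Qiter (k + m) u) - E (Qiter m u)| <=
  C8 / Num.sqrt q * (Num.sqrt (Var (Qiter m u)) - Num.sqrt (Var (Qiter (k + m) u))).
Proof.
move=> bu iu hq; elim: k => [|k IH]; first by rewrite !subrr normr0 mulr0.
rewrite addSn /=.
have bk := bnd_Qiter (k + m) bu; have ik := Qiter_upall (k + m) iu.
have h := lerD (Qgap_step bk ik hq) IH.
rewrite -mulrDr [X in _ <= _ * X]addrC addrA subrK in h.
apply: le_trans h; rewrite -[X in `|X|](subrKA (E (Qiter (k + m) u))).
exact: ler_normD.
Qed.

Let C80 : 0 <= C8 / Num.sqrt q.
Proof.
rewrite /C8; apply: divr_ge0; last exact: sqrtr_ge0.
apply: mulr_ge0; last exact: sqrtr_ge0.
apply: mulr_ge0 => //; rewrite /C7; apply: addr_ge0.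
  by rewrite !mulr_ge0 ?sqrtr_ge0.
by rewrite !mulr_ge0 ?sqrtr_ge0// ltW.
Qed.

Lemma Var_Qiter_cvg u : bnd u -> (forall y, u (upall y) = u y) -> 16 * C6 <= q ->
  Var (Qiter k u) @[k --> \oo] --> 0.
Proof.
move=> bu iu hq; have /andP[k0 k1] := kap01.
apply: (@squeeze_cvgr _ _ _ _ (fun _ => 0) (fun k => (1 - kap) ^+ k * Var u)).
- apply: nearW => k; apply/andP; split; last exact: Var_Qiter.
  by apply: V0; exact: bnd_Qiter.
- exact: cvg_cst.
- rewrite -(mul0r (Var u)); apply: cvgMr_tmp.
  by apply: cvg_expr; rewrite ger0_norm ?subr_ge0 ?ltW// gtrBl.
Qed.

(* A reversible-like L2 estimate forces pointwise convergence because every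
   state carries positive mass; the telescoped mean controls the limit. *)
Lemma Qiter_cvg u : bnd u -> (forall y, u (upall y) = u y) -> 16 * C6 <= q ->
  exists2 l, forall y, Qiter k u y @[k --> \oo] --> l &
    `|l - E u| <= C8 / Num.sqrt q * Num.sqrt (Var u).
Proof.
move=> bu iu hq.
have sV : Num.sqrt (Var (Qiter k u)) @[k --> \oo] --> 0.
  rewrite -[X in _ --> X]sqrtr0; apply: continuous_cvg; last exact: Var_Qiter_cvg.
  exact: sqrt_continuous.
set C := C8 / Num.sqrt q.
(* Nonincreasing by [Qgap_step] and bounded below, so it converges; its second term tends to 0,
   hence the means converge. *)
pose a k := E (Qiter k u) + C * Num.sqrt (Var (Qiter k u)).
have [M hM] := bu.
have ca : cvgn a.
  apply: nonincreasing_is_cvgn.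
    apply/nonincreasing_seqP => k; rewrite /a.
    have bk := bnd_Qiter k bu; have ik := Qiter_upall k iu.
    have := Qgap_step bk ik hq; rewrite -/C -/(Qiter k.+1 u) ler_norml mulrBr => /andP[_].
    by lra.
  exists (- M) => _ [k _ <-]; rewrite /a.
  have := Em_norm r0 r1 (Qiter_norm k hM); rewrite ler_norml => /andP[h _].
  by apply: (le_trans h); rewrite lerDl mulr_ge0// sqrtr_ge0.
have sC : C * Num.sqrt (Var (Qiter k u)) @[k --> \oo] --> 0.
  by rewrite -(mulr0 C); apply: cvgMl_tmp.
pose l := limn a.
have cE : E (Qiter k u) @[k --> \oo] --> l.
  rewrite -(subr0 l) (_ : (fun k => _) = fun k => a k - C * Num.sqrt (Var (Qiter k u))).
    by apply: cvgB => //; exact: ca.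
  by apply/funext => k; rewrite /a addrK.
exists l; last first.
  have : `|E (Qiter k u) - E u| @[k --> \oo] --> `|l - E u|.
    by apply: cvg_norm; apply: cvgB => //; exact: cvg_cst.
  move=> /cvgr_to_le; apply; apply: nearW => k.
  have := Qiter_mean k 0 bu iu hq; rewrite addn0 -/C => /le_trans; apply.
  by rewrite ler_wpM2l// gerBl sqrtr_ge0.
move=> y; have [w w0 hw] := Em_atom r0 r1 y.
have h0 : Var (Qiter k u) + (E (Qiter k u) - l) ^+ 2 @[k --> \oo] --> 0.
  rewrite -[X in _ --> X](addr0 0); apply: cvgD; first exact: Var_Qiter_cvg.
  have h2 : E (Qiter k u) - l @[k --> \oo] --> 0 by apply/subr_cvg0.
  have -> : (fun k => (E (Qiter k u) - l) ^+ 2) =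
    (fun k => (E (Qiter k u) - l) * (E (Qiter k u) - l)).
    by apply/funext => k; rewrite expr2.
  by rewrite -[X in _ --> X](mulr0 0); apply: cvgM.
have h1 : (Qiter k u y - l) ^+ 2 @[k --> \oo] --> 0.
  apply: (@squeeze_cvgr _ _ _ _ (fun _ => 0)
    (fun k => w^-1 * (Var (Qiter k u) + (E (Qiter k u) - l) ^+ 2))).
  - apply: nearW => k; rewrite sqr_ge0/= ler_pdivlMl//.
    have bk := bnd_Qiter k bu.
    have b2 : bnd (fun y => (Qiter k u y - l) ^+ 2) by [].
    have := hw _ b2 (fun y => sqr_ge0 _); rewrite Var_shift//.
  - exact: cvg_cst.
  - by rewrite -(mulr0 w^-1); apply: cvgMl_tmp.
apply/subr_cvg0; apply/norm_cvg0P.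
have -> : (fun k => `|Qiter k u y - l|) = (fun k => Num.sqrt ((Qiter k u y - l) ^+ 2)).
  by apply/funext => k; rewrite sqrtr_sqr.
rewrite -sqrtr0; apply: continuous_cvg h1; exact: sqrt_continuous.
Qed.

End Contraction.

(** * Asymptotics of the geometric ratio in q *)

Section Ratio.
Context {R : realType}.
Variables (K : nat) (a b : R).
Hypotheses (K0 : (0 < K)%N) (a0 : 0 <= a) (b0 : 0 < b).

Lemma expr1p_ge k (s : R) : 0 <= s -> 1 + k%:R * s <= (1 + s) ^+ k.
Proof.
move=> s0; elim: k => [|k IH]; first by rewrite mul0r addr0 expr0.
rewrite exprS; apply: (@le_trans _ _ ((1 + s) * (1 + k%:R * s))).
  rewrite -natr1; have : 0 <= s * (k%:R * s) by rewrite !mulr_ge0.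
  by move: (k%:R) => x; lra.
by rewrite ler_wpM2l// addr_ge0.
Qed.

Lemma expr1p_le k (s : R) : 0 <= s -> s <= 1 ->
  (1 + s) ^+ k <= 1 + k%:R * s + 4 ^+ k * s ^+ 2.
Proof.
move=> s0 s1; elim: k => [|k IH].
  by rewrite !expr0 mul0r addr0 mul1r lerDl sqr_ge0.
rewrite (exprS (1 + s)); apply: (@le_trans _ _ ((1 + s) * (1 + k%:R * s + 4 ^+ k * s ^+ 2))).
  by rewrite ler_wpM2l// addr_ge0.
have k4 : k%:R <= 4 ^+ k :> R.
  rewrite -natrX ler_nat; apply: ltnW; exact: ltn_expl.
have h1 : k%:R * s ^+ 2 <= 4 ^+ k * s ^+ 2 by rewrite ler_wpM2r// sqr_ge0.
have h2 : 4 ^+ k * s ^+ 2 * s <= 4 ^+ k * s ^+ 2.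
  by rewrite ler_piMr// mulr_ge0 ?sqr_ge0// exprn_ge0.
rewrite (exprS 4) -[k.+1%:R]natr1; move: h1 h2.
have -> : (1 + s) * (1 + k%:R * s + 4 ^+ k * s ^+ 2) =
  1 + (k%:R + 1) * s + k%:R * s ^+ 2 + 4 ^+ k * s ^+ 2 + 4 ^+ k * s ^+ 2 * s by ring.
have : 0 <= 4 ^+ k * s ^+ 2 by rewrite mulr_ge0 ?sqr_ge0// exprn_ge0.
by move: (4 ^+ k) (k%:R) => A B; lra.
Qed.

Definition lam q : R := q ^+ 2 - a * q.
Definition ratio q : R := (lam q / (lam q + b * q)) `^ K%:R^-1.
Definition slack q : R := (ratio q)^-1 - 1.
(** Above it q >= 1, lambda >= q^2 / 2 (from q >= 2 a) and [slack] <= 1 (from q >= 2 b). *)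
Definition qmin : R := 1 + 2 * a + 2 * b.

Section Fixed.
Variable q : R.
Hypothesis hq : qmin <= q.

Let q0 : 0 < q. Proof. by have := hq; have := a0; have := b0; rewrite /qmin; lra. Qed.

Lemma lam_ge : q ^+ 2 / 2 <= lam q.
Proof.
have : 0 <= q * (q - 2 * a).
  by apply: mulr_ge0; [exact: ltW|]; have := hq; have := b0; rewrite /qmin; lra.
by rewrite /lam mulrBr -expr2 mulrCA (mulrC q a); move: (a * q) (q ^+ 2) => A B; lra.
Qed.

Lemma lam_le : lam q <= q ^+ 2.
Proof. by rewrite /lam gerBl mulr_ge0// ltW. Qed.

Lemma lam_gt0 : 0 < lam q.
Proof. by apply: lt_le_trans lam_ge; rewrite divr_gt0// exprn_gt0. Qed.

Let bq0 : 0 < b * q. Proof. exact: mulr_gt0. Qed.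
Let lbq0 : 0 < lam q + b * q. Proof. exact: addr_gt0 lam_gt0 bq0. Qed.
Let x0 : 0 < lam q / (lam q + b * q).
Proof. exact: divr_gt0 lam_gt0 lbq0. Qed.

Lemma ratio_gt0 : 0 < ratio q. Proof. by rewrite /ratio powR_gt0. Qed.

Lemma ratioK : ratio q ^+ K = lam q / (lam q + b * q).
Proof.
rewrite -powR_mulrn ?(ltW ratio_gt0)// /ratio -powRrM mulVf ?powRr1 ?(ltW x0)//.
by rewrite pnatr_eq0 -lt0n.
Qed.

Lemma ratio_lt1 : ratio q < 1.
Proof.
rewrite ltNge; apply/negP => h.
have : 1 <= ratio q ^+ K by exact: exprn_ege1.
rewrite ratioK ler_pdivlMr// mul1r gerDl leNgt.
by rewrite bq0.
Qed.

Lemma ratio_eq : ratio q ^+ K * (lam q + b * q) = lam q.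
Proof. by rewrite ratioK divfK// gt_eqF. Qed.

Lemma slack_gt0 : 0 < slack q.
Proof. by rewrite subr_gt0 invf_gt1 ?ratio_lt1// ratio_gt0. Qed.

Lemma slackK : (1 + slack q) ^+ K = 1 + b * q / lam q.
Proof.
rewrite /slack addrC subrK exprVn ratioK invf_div mulrDl divff//.
by rewrite gt_eqF// lam_gt0.
Qed.

Lemma beta_lam_le : b * q / lam q <= 2 * b / q.
Proof.
rewrite ler_pdivrMr ?lam_gt0//; apply: (@le_trans _ _ (2 * b / q * (q ^+ 2 / 2))).
  by rewrite le_eqVlt; apply/orP; left; apply/eqP; field; rewrite gt_eqF.
by rewrite ler_wpM2l ?lam_ge// divr_ge0 ?mulr_ge0// ltW.
Qed.

Lemma beta_lam_ge : b / q <= b * q / lam q.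
Proof.
rewrite ler_pdivlMr ?lam_gt0//; apply: (@le_trans _ _ (b / q * q ^+ 2)).
  by rewrite ler_wpM2l ?lam_le// divr_ge0// ltW.
by rewrite le_eqVlt; apply/orP; left; apply/eqP; field; rewrite gt_eqF.
Qed.

Lemma Kslack_le : K%:R * slack q <= b * q / lam q.
Proof.
have := expr1p_ge K (ltW slack_gt0); rewrite slackK.
by move: (K%:R * _) (b * q / _) => A B; lra.
Qed.

Lemma slack_le : slack q <= 2 * b / q.
Proof.
apply: le_trans beta_lam_le; apply: le_trans Kslack_le.
by rewrite ler_peMl ?(ltW slack_gt0)// ler1n.
Qed.

Lemma slack_le1 : slack q <= 1.
Proof.
apply: le_trans slack_le _; rewrite ler_pdivrMr// mul1r.
by have := hq; have := a0; rewrite /qmin; lra.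
Qed.

Lemma Kslack_ge : b * q / lam q <= K%:R * slack q + 4 ^+ K * slack q ^+ 2.
Proof.
have := expr1p_le K (ltW slack_gt0) slack_le1; rewrite slackK.
by move: (K%:R * _) (b * q / _) (4 ^+ K * _) => A B C; lra.
Qed.

(** With s the slack, the first-order parts of (1 + s)^K = 1 + b q / lambda match, and the remainder
    is at most 4^K s^2. *)
Lemma slack_bound2 : `|K%:R * slack q - b * q / lam q| <= 4 ^+ K * (2 * b) ^+ 2 / q ^+ 2.
Proof.
rewrite distrC ger0_norm ?subr_ge0 ?Kslack_le// lerBlDl.
apply: le_trans Kslack_ge _; rewrite lerD2l -mulrA ler_wpM2l ?exprn_ge0//.
rewrite -expr_div_n ler_pXn2r ?nnegrE ?slack_le// ?(ltW slack_gt0)//.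
by rewrite divr_ge0 ?mulr_ge0// ltW.
Qed.

Lemma slack_ge : b / (K%:R + 4 ^+ K) / q <= slack q.
Proof.
have p : 0 < K%:R + 4 ^+ K :> R by rewrite ltr_wpDl// exprn_gt0.
rewrite mulrAC ler_pdivrMr//; apply: le_trans beta_lam_ge _.
apply: le_trans Kslack_ge _; 
have -> : slack q * (K%:R + 4 ^+ K) = K%:R * slack q + 4 ^+ K * slack q by ring.
rewrite lerD2l; apply: ler_wpM2l; first exact: exprn_ge0.
by rewrite expr2 ler_piMr ?slack_le1// ltW// slack_gt0.
Qed.

(** Both lambda and q^2 r are q^2 up to O(q): q^2 - lambda = a q, and 1 - r = s r <= 2 b / q, where
    s is the slack. *)
Lemma drift_bound : `|lam q - q ^+ 2 * ratio q| <= (2 * b + a) * q.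
Proof.
have h0 : 0 <= q ^+ 2 * (1 - ratio q).
  by rewrite mulr_ge0 ?exprn_ge0 ?(ltW q0)// subr_ge0 ltW// ratio_lt1.
have h1 : q ^+ 2 * (1 - ratio q) <= 2 * b * q.
  have -> : 1 - ratio q = slack q * ratio q.
    by rewrite /slack mulrBl mulVf ?mul1r// gt_eqF// ratio_gt0.
  apply: (@le_trans _ _ (q ^+ 2 * (2 * b / q))).
    rewrite ler_wpM2l ?exprn_ge0 ?(ltW q0)//; apply: le_trans slack_le.
    by rewrite ler_piMr ?(ltW slack_gt0)// ltW// ratio_lt1.
  by rewrite le_eqVlt; apply/orP; left; apply/eqP; field; rewrite gt_eqF.
have h2 : 0 <= a * q by rewrite mulr_ge0// ltW.
have h3 : 0 <= b * q by exact: ltW.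
have -> : lam q - q ^+ 2 * ratio q = q ^+ 2 * (1 - ratio q) - a * q by rewrite /lam; ring.
move: h0 h1; move: (q ^+ 2 * _) => X h0 h1.
by rewrite ler_norml mulrDl; apply/andP; split; lra.
Qed.

End Fixed.
End Ratio.

(** * Blocking at empty queues *)

Section Blocked.
Context {R : realType} {I : finType} (i0 : I).
Variables (lam nu beta c : R).
Hypotheses (lam0 : 0 < lam) (lam_nu : lam <= nu) (beta0 : 0 < beta).
Implicit Types (u v : (I -> nat) -> R) (y : I -> nat) (i j : I).
Local Notation K := (#|I|%:R : R).
Hypothesis cp : 2 * (K * lam + K * nu + beta) <= c.
Local Notation G := (gap_gen lam nu beta).

Definition decr j y : I -> nat := upd y j (y j).-1.

Definition queue_gen u y : R :=
  \sum_j (lam * (u (incr j y) - u y) + nu * (0 < y j)%N%:R * (u (decr j y) - u y)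
   + beta / (ngrp y)%:R * (amin j y)%:R * (u (incr j y) - u y)).

Definition Qqueue u y : R := u y + c^-1 * queue_gen u y.

Let nu0 : 0 < nu. Proof. exact: lt_le_trans lam_nu. Qed.
Let K1 : 1 <= K. Proof. by rewrite ler1n; apply/card_gt0P; exists i0. Qed.
Let c0 : 0 < c.
Proof.
apply: lt_le_trans cp; apply: mulr_gt0 => //; apply: addr_gt0 => //.
by apply: addr_gt0; apply: mulr_gt0 => //; apply: lt_le_trans K1.
Qed.

Definition qrate (l : 'I_3 * I) y : R :=
  match val l.1 with
  | 0 => lam | 1 => nu * (0 < y l.2)%N%:R
  | _ => beta / (ngrp y)%:R * (amin l.2 y)%:R
  end.
Definition qmove (l : 'I_3 * I) y : I -> nat :=
  if val l.1 == 1%N then decr l.2 y else incr l.2 y.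

Lemma qrate_ge0 l y : 0 <= qrate l y.
Proof.
rewrite /qrate; case: (val l.1) => [|[|k]]; first exact: ltW.
  by rewrite mulr_ge0// ltW.
by rewrite mulr_ge0// divr_ge0// ltW.
Qed.

Lemma queue_gen_jump u y : queue_gen u y = jump qrate qmove u y.
Proof. by rewrite /jump sum_grate. Qed.

Lemma sum_amin y : \sum_j (beta / (ngrp y)%:R * (amin j y)%:R) = beta.
Proof.
rewrite -mulr_sumr -natr_sum -/(ngrp y) divfK//.
by rewrite pnatr_eq0 -lt0n (ngrp_gt0 i0).
Qed.

Lemma sum_qrate_le y : \sum_l qrate l y <= c.
Proof.
rewrite sum_grate /qrate/= big_split/= big_split/= sum_amin sumr_const.
rewrite -[lam *+ _]mulr_natl.
have h : \sum_j nu * (0 < y j)%N%:R <= K * nu.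
  rewrite [leRHS]mulr_natl -sumr_const; apply: ler_sum => j _.
  by rewrite ler_piMr ?(ltW nu0)//; case: (0 < y j)%N.
have h2 : 0 <= K * lam by rewrite mulr_ge0// ltW.
have h3 : 0 <= K * nu by rewrite mulr_ge0// ltW.
by move: h h2 h3 beta0 cp; move: (\sum_j _) (K * lam) (K * nu) => A B C; lra.
Qed.

Lemma QqueueB u v y : Qqueue (fun z => u z - v z) y = Qqueue u y - Qqueue v y.
Proof.
have e : queue_gen (fun z => u z - v z) y = queue_gen u y - queue_gen v y.
  by rewrite !queue_gen_jump /jump -sumrB; apply: eq_bigr => l _; ring.
by rewrite /Qqueue e; ring.
Qed.

Lemma QqueueZ k u y : Qqueue (fun z => k * u z) y = k * Qqueue u y.
Proof.
rewrite /Qqueue !queue_gen_jump /jump mulrDr mulrCA; congr (_ + _ * _).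
by rewrite mulr_sumr; apply: eq_bigr => l _; ring.
Qed.

Lemma Qqueue_le u v : (forall y, u y <= v y) -> forall y, Qqueue u y <= Qqueue v y.
Proof.
move=> uv y; rewrite -subr_le0 -QqueueB /Qqueue queue_gen_jump.
apply: (@jump_step_le _ _ _ _ qmove c (fun z => u z - v z)) => //.
- by move=> l; exact: qrate_ge0.
- exact: sum_qrate_le.
- by move=> z; rewrite subr_le0.
Qed.

Lemma Qqueue_abs u y : `|Qqueue u y| <= Qqueue (fun z => `|u z|) y.
Proof.
rewrite ler_norml; apply/andP; split; last by apply: Qqueue_le => z; exact: ler_norm.
rewrite lerNl -[- Qqueue u y]mulN1r -QqueueZ; apply: Qqueue_le => z.
by rewrite mulN1r -normrN ler_norm.
Qed.

Lemma Qqueue_lim (U : nat -> (I -> nat) -> R) (l : R) :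
  (forall y, U m y @[m --> \oo] --> l) ->
  forall y, Qqueue (U m) y @[m --> \oo] --> l.
Proof.
move=> hU y; rewrite /Qqueue.
have -> : l = l + c^-1 * \sum_(k : 'I_3 * I) 0 by rewrite big1_eq mulr0 addr0.
apply: cvgD; first exact: hU; apply: cvgMl_tmp.
under eq_fun do rewrite queue_gen_jump.
apply: cvg_big => [|k _]; first exact: add_continuous.
rewrite -(mulr0 (qrate k y)); apply: cvgMl_tmp.
by rewrite -(subrr l); apply: cvgB; exact: hU.
Qed.

(** Blocked and unblocked moves agree when no queue is empty; otherwise each of the K departures
    contributes an error of at most 2 M nu. *)
Lemma Qqueue_gap u (M : R) y : (forall y, u (upall y) = u y) -> (forall y, `|u y| <= M) ->
  `|Qqueue u y - (u y + c^-1 * G u y)| <=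
  c^-1 * (nu * K * (2 * M)) * [exists j, y j == 0%N]%:R.
Proof.
move=> iu uM.
have M0 : 0 <= M by apply: le_trans (uM y).
rewrite /Qqueue opprD addrACA subrr add0r -mulrBr normrM gtr0_norm ?invr_gt0// -mulrA.
rewrite ler_wpM2l ?invr_ge0 ?(ltW c0)// /queue_gen /gap_gen -sumrB.
rewrite (eq_bigr (fun j => nu * ((0 < y j)%N%:R * (u (decr j y) - u y) -
   (u (downf j y) - u y)))); last by move=> j _; ring.
have [ex|nex] := boolP [exists j, y j == 0%N]; last first.
  rewrite big1 ?normr0 ?mulr0// => j _; apply/eqP.
  have yj : y j != 0%N by apply/negP => h; case/negP: nex; apply/existsP; exists j.
  have -> : downf j y = decr j y by rewrite /downf /decr; case: (y j) yj.
  by rewrite lt0n yj mul1r subrr mulr0.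
rewrite mulr1 (mulrC nu) -mulrA [leRHS]mulr_natl -sumr_const.
apply: le_trans (ler_norm_sum _ _ _) _; apply: ler_sum => j _.
rewrite normrM (gtr0_norm nu0) ler_wpM2l ?(ltW nu0)//.
case E : (y j) => [|k].
  rewrite mul0r sub0r normrN; apply: le_trans (ler_normB _ _) _.
  by have := uM (downf j y); have := uM y; lra.
rewrite mul1r /downf E /decr E /= subrr normr0; lra.
Qed.

Section Lyapunov.
Variable sig : R.
Hypotheses (sig0 : 0 < sig) (sig1 : sig < 1).
Hypothesis drift : K * (nu / sig - lam) < beta.

(** This exponential sum dominates the indicator of an empty queue, and [drift] makes it contract by
    1 - [lrate] per step. *)
Definition lyap y : R := \sum_j sig ^+ y j.
Definition lrate : R := c^-1 * ((1 - sig) * (beta / K - (nu / sig - lam))).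

Let A0 : 0 <= nu / sig - lam.
Proof.
rewrite subr_ge0; apply: le_trans lam_nu _.
by rewrite ler_pdivlMr// ler_piMr// ltW.
Qed.

Lemma lyap_ge y : [exists j, y j == 0%N]%:R <= lyap y.
Proof.
case: existsP => [[j /eqP yj]|_]; last by rewrite sumr_ge0// => i _; rewrite exprn_ge0// ltW.
rewrite /lyap (bigD1 j)//= yj expr0 lerDl sumr_ge0// => i _.
by rewrite exprn_ge0// ltW.
Qed.

Lemma lyap_ge0 y : 0 <= lyap y.
Proof. by rewrite sumr_ge0// => i _; rewrite exprn_ge0// ltW. Qed.

Lemma lyap_upd j (v : nat) y : lyap (upd y j v) - lyap y = sig ^+ v - sig ^+ y j.
Proof.
rewrite /lyap (bigD1 j)//= [X in _ - X](bigD1 j)//= {1}/upd eqxx opprD addrACA.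
rewrite (eq_bigr (fun i => sig ^+ y i)) ?subrr ?addr0// => i ij.
by rewrite /upd (negbTE ij).
Qed.

(* Individually the queues drift downwards; only the extra stream to the
   minimum, through [a K < b], makes this exponential sum decrease. *)
Lemma queue_gen_lyap y : queue_gen lyap y <= - (c * lrate) * lyap y.
Proof.
have [k hk] := amin_exists i0 y.
set x := sig ^+ y k.
have x0 : 0 < x by rewrite exprn_gt0.
have xle j : sig ^+ y j <= x.
  by rewrite /x ler_wiXn2l ?(ltW sig0) ?(ltW sig1)//; exact: (forallP hk).
have xmin j : amin j y -> sig ^+ y j = x.
  move=> hj; rewrite /x; congr (_ ^+ _).
  by apply/eqP; rewrite eqn_leq (forallP hj) (forallP hk).
(* The shortest queue carries at least 1/K of the sum, so a gain there is a gain proportional to all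
   of [lyap]. *)
have Hx : lyap y <= K * x.
  by rewrite mulr_natl -sumr_const; apply: ler_sum => j _.
have h1 : queue_gen lyap y <= (1 - sig) * (nu / sig - lam) * lyap y - (1 - sig) * beta * x.
  have -> : (1 - sig) * beta * x =
    \sum_j (beta / (ngrp y)%:R * (amin j y)%:R) * ((1 - sig) * x).
    by rewrite -mulr_suml sum_amin; ring.
  rewrite {2}/lyap mulr_sumr -sumrB /queue_gen; apply: ler_sum => j _.
  rewrite !lyap_upd.
  have -> : beta / (ngrp y)%:R * (amin j y)%:R * (sig ^+ (y j).+1 - sig ^+ y j) =
    - (beta / (ngrp y)%:R * (amin j y)%:R * ((1 - sig) * x)).
    have [aj|_] := boolP (amin j y); last by rewrite !mulr0 !mul0r oppr0.
    by rewrite exprS xmin//; ring.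
  rewrite lerD2r.
  have h : nu * (0 < y j)%N%:R * (sig ^+ (y j).-1 - sig ^+ y j) <=
           (1 - sig) * (nu / sig) * sig ^+ y j.
    case: (y j) => [|m].
      rewrite subrr mulr0; apply: mulr_ge0; last by rewrite exprn_ge0// ltW.
      apply: mulr_ge0; first by rewrite subr_ge0 ltW.
      by apply: divr_ge0; exact: ltW.
    rewrite /= mulr1 exprS le_eqVlt; apply/orP; left; apply/eqP; field.
    by rewrite gt_eqF.
  apply: le_trans (lerD (lexx _) h) _; rewrite exprS.
  by rewrite le_eqVlt; apply/orP; left; apply/eqP; ring.
apply: le_trans h1 _.
rewrite /lrate mulrA mulfV ?gt_eqF// mul1r.
have s1 : 0 <= (1 - sig) * (beta / K) by rewrite mulr_ge0 ?divr_ge0 ?subr_ge0// ltW.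
have := ler_wpM2l s1 Hx.
have -> : (1 - sig) * (beta / K) * (K * x) = (1 - sig) * beta * x.
  by field; rewrite gt_eqF// (lt_le_trans _ K1).
have -> : - ((1 - sig) * (beta / K - (nu / sig - lam))) * lyap y =
  (1 - sig) * (nu / sig - lam) * lyap y - (1 - sig) * (beta / K) * lyap y by ring.
by move=> h; rewrite lerD2l lerN2.
Qed.

Lemma lrate_gt0 : 0 < lrate.
Proof.
rewrite mulr_gt0 ?invr_gt0// mulr_gt0 ?subr_gt0//.
by rewrite ltr_pdivlMr 1?mulrC// (lt_le_trans _ K1).
Qed.

Lemma lrate_lt1 : lrate < 1.
Proof.
rewrite /lrate mulrC ltr_pdivrMr// mul1r.
apply: (@le_lt_trans _ _ (1 * beta)).
  apply: ler_pM.
  - by rewrite subr_ge0 ltW.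
  - by rewrite subr_ge0 ler_pdivlMr 1?mulrC ?(ltW drift)// (lt_le_trans _ K1).
  - by rewrite gerBl ltW.
  - apply: (@le_trans _ _ (beta / K)); first by rewrite gerBl.
    by rewrite ler_pdivrMr ?(lt_le_trans _ K1)// ler_peMr// ltW.
rewrite mul1r; apply: lt_le_trans cp.
have h2 : 0 <= K * lam by rewrite mulr_ge0// ltW.
have h3 : 0 <= K * nu by rewrite mulr_ge0// ltW.
by move: h2 h3 beta0; move: (K * lam) (K * nu) => B C; lra.
Qed.

Lemma Qqueue_lyap y : Qqueue lyap y <= (1 - lrate) * lyap y.
Proof.
rewrite /Qqueue mulrBl mul1r lerD2l.
have := ler_wpM2l (_ : 0 <= c^-1) (queue_gen_lyap y).
rewrite invr_ge0 (ltW c0) => /(_ isT) /le_trans; apply.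
by rewrite le_eqVlt; apply/orP; left; apply/eqP; field; rewrite gt_eqF.
Qed.

Fixpoint Qqiter k u : (I -> nat) -> R := if k is k'.+1 then Qqueue (Qqiter k' u) else u.

Lemma QqiterD k m u : Qqiter (k + m) u = Qqiter k (Qqiter m u).
Proof. by elim: k => //= k ->. Qed.

Lemma QqiterB k u v y : Qqiter k (fun z => u z - v z) y = Qqiter k u y - Qqiter k v y.
Proof.
elim: k y => //= k IH y; rewrite -QqueueB; congr Qqueue.
by apply/funext => z; exact: IH.
Qed.

Lemma Qqiter_lim k (U : nat -> (I -> nat) -> R) (l : R) :
  (forall y, U m y @[m --> \oo] --> l) ->
  forall y, Qqiter k (U m) y @[m --> \oo] --> l.
Proof. by move=> hU; elim: k => //= k IH; exact: Qqueue_lim. Qed.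

Lemma Qqiter_lyap k (B : R) v : 0 <= B -> (forall y, `|v y| <= B * lyap y) ->
  forall y, `|Qqiter k v y| <= B * (1 - lrate) ^+ k * lyap y.
Proof.
move=> B0 hv; elim: k => [|k IH] y; first by rewrite expr0 mulr1.
apply: le_trans (Qqueue_abs _ _) _.
apply: le_trans (Qqueue_le IH _) _; rewrite QqueueZ exprS.
have h := Qqueue_lyap y.
have B1 : 0 <= B * (1 - lrate) ^+ k.
  by rewrite mulr_ge0// exprn_ge0// subr_ge0 ltW// lrate_lt1.
apply: le_trans (ler_wpM2l B1 h) _.
by rewrite le_eqVlt; apply/orP; left; apply/eqP; ring.
Qed.

Let Q u y : R := u y + c^-1 * G u y.
(** Abstract iterates of the unblocked step, later instantiated by [Qiter]. *)
Variable Qit : nat -> ((I -> nat) -> R) -> (I -> nat) -> R.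
Hypothesis Qit0 : forall u, Qit 0 u = u.
Hypothesis QitS : forall k u, Qit k.+1 u = Q (Qit k u).
Hypothesis Qit_norm : forall k u M, (forall y, `|u y| <= M) -> forall y, `|Qit k u y| <= M.
Hypothesis Qit_inv : forall k u, (forall y, u (upall y) = u y) ->
  forall y, Qit k u (upall y) = Qit k u y.

(** Each step adds an error bounded by a constant times the indicator of an empty queue, hence times
    [lyap], and later blocked steps shrink it by 1 - [lrate]; the geometric series makes the bound
    uniform in m. *)
Lemma Qqiter_close m u (M : R) : (forall y, u (upall y) = u y) -> (forall y, `|u y| <= M) ->
  forall y, `|Qqiter m u y - Qit m u y| <= c^-1 * (nu * K * (2 * M)) / lrate * lyap y.
Proof.
move=> iu uM; set B := c^-1 * _.
have [M0 k0] : 0 <= M /\ 0 < lrate.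
  by split; [apply: le_trans (uM (fun=> 0%N)) | exact: lrate_gt0].
have B0 : 0 <= B.
  by rewrite /B mulr_ge0 ?invr_ge0 ?(ltW c0)// !mulr_ge0// ltW.
have Bk : 0 <= B / lrate by rewrite divr_ge0// ltW.
elim: m => [|m IH] y.
  by rewrite Qit0 subrr normr0 mulr_ge0// lyap_ge0.
rewrite QitS /=.
have -> : Qqueue (Qqiter m u) y - Q (Qit m u) y =
  Qqueue (fun z => Qqiter m u z - Qit m u z) y + (Qqueue (Qit m u) y - Q (Qit m u) y).
  by rewrite QqueueB; ring.
apply: le_trans (ler_normD _ _) _.
have h1 : `|Qqueue (fun z => Qqiter m u z - Qit m u z) y| <=
    B / lrate * ((1 - lrate) * lyap y).
  apply: le_trans (Qqueue_abs _ _) _; apply: le_trans (Qqueue_le IH _) _.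
  by rewrite QqueueZ ler_wpM2l// Qqueue_lyap.
have h2 := Qqueue_gap y (Qit_inv m iu) (Qit_norm m uM).
have h3 : B * [exists j, y j == 0%N]%:R <= B * lyap y by rewrite ler_wpM2l// lyap_ge.
apply: le_trans (lerD h1 (le_trans h2 h3)) _.
by rewrite le_eqVlt; apply/orP; left; apply/eqP; field; rewrite gt_eqF.
Qed.

(** Split p steps into k outer and p - k inner ones. Making the inner ones unblocked costs B [lyap],
    which the k outer blocked steps shrink to B (1 - [lrate])^k [lyap]. With k fixed, the inner
    unblocked iterates tend to the constant l, which blocked steps preserve. *)
Lemma Qqiter_cvg u (l : R) : bnd u -> (forall y, u (upall y) = u y) ->
  (forall y, Qit k u y @[k --> \oo] --> l) ->
  forall y, Qqiter k u y @[k --> \oo] --> l.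
Proof.
move=> [M uM] iu hl y; apply/cvgrPdist_le => e e0.
set B := c^-1 * (nu * K * (2 * M)) / lrate.
have B0 : 0 <= B.
  have M0 : 0 <= M by apply: le_trans (uM (fun=> 0%N)).
  rewrite divr_ge0 ?(ltW lrate_gt0)// mulr_ge0 ?invr_ge0 ?(ltW c0)//.
  by rewrite !mulr_ge0// ltW.
have hg : B * (1 - lrate) ^+ k * lyap y @[k --> \oo] --> 0.
  have h : (1 - lrate) ^+ k @[k --> \oo] --> 0.
    apply: cvg_expr; rewrite ger0_norm ?gtrBl ?lrate_gt0//.
    by rewrite subr_ge0 ltW// lrate_lt1.
  have h2 : B * (1 - lrate) ^+ k @[k --> \oo] --> B * 0 by exact: cvgMl_tmp.
  have h3 : B * (1 - lrate) ^+ k * lyap y @[k --> \oo] --> B * 0 * lyap y.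
    exact: cvgMr_tmp.
  by rewrite mulr0 mul0r in h3.
have e2 : 0 < e / 2 by rewrite divr_gt0.
have [k _ hk] := (@cvgrPdist_le _ _ _ _ _ _ _).1 hg _ e2.
have := hk k (leqnn k); rewrite sub0r normrN => hk'.
have hm := Qqiter_lim k hl y.
have [m _ hm'] := (@cvgrPdist_le _ _ _ _ _ _ _).1 hm _ e2.
exists (k + m)%N => // p /= kmp.
have -> : p = (k + (p - k))%N by rewrite subnKC// (leq_trans _ kmp)// leq_addr.
have mp : (m <= p - k)%N by rewrite leq_subRL ?(leq_trans _ kmp)// leq_addr.
have := hm' _ mp; rewrite QqiterD => h1.
have h2 := Qqiter_lyap k B0 (Qqiter_close (p - k) iu uM) y.
rewrite QqiterB in h2.
have h3 := le_trans h2 (le_trans (ler_norm _) hk').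
have -> : l - Qqiter k (Qqiter (p - k) u) y = (l - Qqiter k (Qit (p - k) u) y) -
  (Qqiter k (Qqiter (p - k) u) y - Qqiter k (Qit (p - k) u) y) by ring.
apply: le_trans (ler_normB _ _) _.
by move: h1 h3; lra.
Qed.

End Lyapunov.
End Blocked.

(** * Ranked queues *)

Section Ranked.
Context {R : realType} (K n : nat) (a b : R).
Hypotheses (K2 : (2 <= K)%N) (a0 : 0 <= a) (b0 : 0 < b) (hn : a ^+ 2 < n%:R).
Implicit Types (y : 'I_K -> nat) (f : ('I_K -> nat) -> R) (i j : 'I_K) (l : bool * 'I_K).

Local Notation q := (Num.sqrt (n%:R : R)).
Local Notation lm := (lam a q).
Local Notation nu := (q ^+ 2).
Local Notation beta := (b * q).

(** The model numbers ranks from 1 and ordinals start at 0, hence the shifts here and in [rst]. *)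
Definition ext y : nat -> nat :=
  fun k : nat => if insub k.-1 is Some j then y j else 0%N.
Definition rst (x : nat -> nat) : 'I_K -> nat := fun i : 'I_K => x i.+1.

Lemma extE y i : ext y i.+1 = y i.
Proof. by rewrite /ext /= insubT//= => h; congr y; exact: val_inj. Qed.

Definition qrk l y : R :=
  if l.1 then n%:R * (alpha_c K n a b (ext y) l.2.+1 * up_ind K (ext y) l.2.+1)
  else n%:R * (delta_c K (ext y) l.2.+1 * down_ind (ext y) l.2.+1).
Definition mv l y : 'I_K -> nat := if l.1 then incr l.2 y else decr l.2 y.
Definition ordered y := forall i j, (i <= j)%N -> (y i <= y j)%N.

(** On ordered states [top] singles out the last member of a group of equal queues, and [bot] the
    first member of a group of equal nonempty queues. *)
Definition top i y : bool := [forall j : 'I_K, (i < j)%N ==> (y i < y j)%N].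
Definition bot i y : bool := (0 < y i)%N && [forall j : 'I_K, (j < i)%N ==> (y j < y i)%N].
(** This is n times the coefficient of rank j in [alpha_c]; the extra stream appears in the first
    rank only. *)
Definition w j : R := lm + beta * (val j == 0%N)%:R.

Let q0 : 0 < q.
Proof. by rewrite sqrtr_gt0; apply: le_lt_trans hn; exact: sqr_ge0. Qed.
Let nE : n%:R = nu. Proof. by rewrite sqr_sqrtr. Qed.
Let aq : a < q.
Proof.
rewrite -[a]ger0_norm// -sqrtr_sqr ltr_sqrt//.
by apply: le_lt_trans hn; exact: sqr_ge0.
Qed.

Lemma lm_gt0 : 0 < lm.
Proof. by rewrite /lam expr2 -mulrBl mulr_gt0// subr_gt0. Qed.

Lemma lm_le : lm <= nu.
Proof. by rewrite /lam gerBl mulr_ge0// ltW. Qed.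

Let beta0 : 0 < beta. Proof. exact: mulr_gt0. Qed.

Lemma w_ge j : lm <= w j.
Proof. by rewrite /w lerDl mulr_ge0// ltW. Qed.

Lemma sum1K (F : nat -> R) : \sum_(1 <= j < K.+1) F j = \sum_(j < K) F j.+1.
Proof. by rewrite big_add1/= big_mkord. Qed.

Lemma rate_up i y : qrk (true, i) y =
  (\sum_j w j * (y j == y i)%:R) * up_ind K (ext y) i.+1.
Proof.
rewrite /qrk/= mulrA /alpha_c sum1K mulr_sumr; congr (_ * _); apply: eq_bigr => j _.
rewrite !extE mulrA; congr (_ * _).
rewrite /w /lam [X in X * (1 - _) = _]nE /atil eqSS; case: eqP => _ /=.
  by field; rewrite gt_eqF.
by field; rewrite gt_eqF.
Qed.

Lemma rate_down i y : qrk (false, i) y =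
  (\sum_j nu * (y j == y i)%:R) * down_ind (ext y) i.+1.
Proof.
rewrite /qrk/= mulrA /delta_c sum1K mulr_sumr; congr (_ * _); apply: eq_bigr => j _.
by rewrite !extE [X in X * _ = _]nE.
Qed.

Lemma up_ind01 i y :
  up_ind (R := R) K (ext y) i.+1 = 0 \/ up_ind (R := R) K (ext y) i.+1 = 1.
Proof. by rewrite /up_ind; case: eqP => _; [right|case: (_ < _)%N; [right|left]]. Qed.

Lemma down_ind01 i y : down_ind (R := R) (ext y) i.+1 = 0 \/ down_ind (R := R) (ext y) i.+1 = 1.
Proof.
by rewrite /down_ind; case: eqP => _; case: (_ < _)%N; [right|left|right|left].
Qed.

Lemma up_indE i y : ordered y -> up_ind K (ext y) i.+1 = (top i y)%:R :> R.
Proof.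
move=> oy; rewrite /up_ind; case: eqP => [iK|iK].
  rewrite (_ : top i y)//; apply/forallP => j; apply/implyP => ij.
  by have := ltn_ord j; move: ij iK; lia.
have hi : (i.+1 < K)%N by rewrite ltn_neqAle ltn_ord andbT; apply/eqP.
rewrite (_ : i.+2 = (Ordinal hi).+1)// !extE; congr (_%:R); congr nat_of_bool.
apply/idP/forallP => [h j|h]; last by have := h (Ordinal hi); rewrite /= ltnSn.
by apply/implyP => ij; apply: leq_trans h _; apply: oy.
Qed.

Lemma down_indE i y : ordered y -> down_ind (ext y) i.+1 = (bot i y)%:R :> R.
Proof.
move=> oy; rewrite /down_ind eqSS; case: eqP => [i_0|i_0].
  have -> : ext y 1 = y i by rewrite -extE i_0.
  congr (_%:R); congr nat_of_bool; rewrite /bot; case: (0 < y i)%N => //=.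
  by apply/esym/forallP => j; rewrite i_0 ltn0.
have ip : (0 < i)%N by rewrite lt0n; apply/eqP.
have hi : (i.-1 < K)%N by apply: leq_ltn_trans (leq_pred _) (ltn_ord i).
rewrite /= -(prednK ip) (_ : i.-1.+1 = (Ordinal hi).+1)// extE prednK// extE.
congr (_%:R); congr nat_of_bool; apply/idP/andP => [h|[_ /forallP/(_ (Ordinal hi))]]; last first.
  by rewrite /= prednK// leqnn.
split; first exact: leq_trans h.
apply/forallP => j; apply/implyP => ji; apply: leq_ltn_trans h.
by apply: oy; rewrite /= -ltnS prednK.
Qed.

Lemma qrk_ge0 l y : 0 <= qrk l y.
Proof.
case: l => -[] i; rewrite ?rate_up ?rate_down; apply: mulr_ge0.
- by apply: sumr_ge0 => j _; rewrite mulr_ge0// (le_trans (ltW lm_gt0))// w_ge.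
- by case: (up_ind01 i y) => ->.
- by apply: sumr_ge0 => j _; rewrite mulr_ge0// exprn_ge0// ltW.
- by case: (down_ind01 i y) => ->.
Qed.

Definition Cmax : R := K%:R * lm + K%:R * nu + beta.

Lemma sum_w : \sum_j w j = K%:R * lm + beta.
Proof.
rewrite /w big_split/= sumr_const -mulr_sumr card_ord -[lm *+ _]mulr_natl; congr (_ + _).
have h0 : (0 < K)%N by exact: leq_trans K2.
rewrite (bigD1 (Ordinal h0))//= big1 ?addr0 ?mulr1// => j hj.
by apply/eqP; rewrite pnatr_eq0 eqb0; apply: contra hj => /eqP h; apply/eqP/val_inj.
Qed.

Lemma qrk_le l y : qrk l y <= Cmax.
Proof.
have h1 : 0 <= K%:R * lm by rewrite mulr_ge0// ltW// lm_gt0.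
have h2 : 0 <= K%:R * nu by rewrite mulr_ge0// exprn_ge0// ltW.
case: l => -[] i; rewrite ?rate_up ?rate_down.
  apply: (@le_trans _ _ (\sum_j w j)).
    have h : \sum_j w j * (y j == y i)%:R <= \sum_j w j.
      apply: ler_sum => j _; rewrite ler_piMr ?(le_trans (ltW lm_gt0)) ?w_ge//.
      by case: (_ == _).
    have p : 0 <= \sum_j w j * (y j == y i)%:R.
      by apply: sumr_ge0 => j _; rewrite mulr_ge0// (le_trans (ltW lm_gt0))// w_ge.
    by case: (up_ind01 i y) => ->; rewrite ?mulr0 ?mulr1// (le_trans p).
  by rewrite sum_w /Cmax; move: h2; move: (K%:R * nu) => A; lra.
apply: (@le_trans _ _ (\sum_(j : 'I_K) nu)).
  have h : \sum_j nu * (y j == y i)%:R <= \sum_(j : 'I_K) nu.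
    apply: ler_sum => j _; rewrite ler_piMr ?exprn_ge0 ?(ltW q0)//.
    by case: (_ == _).
  have p : 0 <= \sum_j nu * (y j == y i)%:R.
    by apply: sumr_ge0 => j _; rewrite mulr_ge0// exprn_ge0// ltW.
  by case: (down_ind01 i y) => ->; rewrite ?mulr0 ?mulr1// (le_trans p).
rewrite sumr_const card_ord -[nu *+ _]mulr_natl /Cmax.
by move: h1 beta0; move: (K%:R * lm) (K%:R * nu) => A B; lra.
Qed.

(** A rate vanishes or is bounded below. This bounds the time that a true clock needs to reach a
    jump already passed by the guessed clock. *)
Lemma qrk_min l y : qrk l y != 0 -> lm <= qrk l y.
Proof.
case: l => -[] i; rewrite ?rate_up ?rate_down.
  case: (up_ind01 i y) => ->; rewrite ?mulr0 ?eqxx// mulr1 => _.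
  rewrite (bigD1 i)//= eqxx mulr1 -[leLHS]addr0 lerD ?w_ge//.
  by apply: sumr_ge0 => j _; rewrite mulr_ge0// (le_trans (ltW lm_gt0))// w_ge.
case: (down_ind01 i y) => ->; rewrite ?mulr0 ?eqxx// mulr1 => _.
rewrite (bigD1 i)//= eqxx mulr1 -[leLHS]addr0 lerD ?lm_le//.
by apply: sumr_ge0 => j _; rewrite mulr_ge0// exprn_ge0// ltW.
Qed.

Lemma ordered_mv l y : ordered y -> qrk l y != 0 -> ordered (mv l y).
Proof.
move=> oy; case: l => -[] i; rewrite ?rate_up ?rate_down ?up_indE ?down_indE//.
  have [/forallP t|_] := boolP (top i y); last by rewrite mulr0 eqxx.
  move=> _ j k jk; rewrite /mv /= /incr /upd; case: eqP => [ji|ji]; case: eqP => [ki|ki] //.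
  - have := t k; rewrite -ji => /implyP; apply.
    by rewrite ltn_neqAle jk andbT; apply/eqP => e; apply: ki; apply: val_inj; rewrite -ji.
  - by apply: leqW; apply: oy; rewrite -ki.
  - exact: oy.
have [/andP[yi /forallP t]|_] := boolP (bot i y); last by rewrite mulr0 eqxx.
move=> _ j k jk; rewrite /mv /= /decr /upd; case: eqP => [ji|ji]; case: eqP => [ki|ki] //.
- by apply: leq_trans (leq_pred _) _; apply: oy; rewrite -ji.
- have := t j; rewrite -ki => /implyP h.
  rewrite -ltnS prednK; last by rewrite ki.
  by apply: h; rewrite ltn_neqAle jk andbT; apply/eqP => e; apply: ji; rewrite -ki; exact: val_inj.
- exact: oy.
Qed.

Lemma top_unique j y : ordered y -> \sum_i (y j == y i)%:R * (top i y)%:R = 1 :> R.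
Proof.
move=> oy; pose P := fun i : 'I_K => y j == y i.
have Pj : P j by rewrite /P.
case: (@arg_maxnP _ j P (fun i => val i) Pj) => i Pi hi.
have ti : top i y.
  apply/forallP => k; apply/implyP => ik; rewrite ltn_neqAle oy ?(ltnW ik)// andbT.
  apply/negP => /eqP e; have : (k <= i)%N by apply: hi; rewrite /P -e.
  by rewrite leqNgt ik.
rewrite (bigD1 i)//= ti mulr1 (_ : (y j == y i)) ?addr0//.
rewrite big1 ?addr0// => k ki.
have [e|] := eqVneq (y j) (y k); last by rewrite mul0r.
rewrite mul1r; apply/eqP; rewrite pnatr_eq0 eqb0; apply/negP => /forallP tk.
have ki' : (k < i)%N.
  by rewrite ltn_neqAle (inj_eq val_inj) ki/=; apply: hi; rewrite /P e.
have := tk i; rewrite ki' /= -e; move: Pi; rewrite /P => /eqP <-.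
by rewrite ltnn.
Qed.

Lemma bot_unique j y : ordered y -> \sum_i (y j == y i)%:R * (bot i y)%:R = (0 < y j)%N%:R :> R.
Proof.
move=> oy; have [yj|] := ltnP 0 (y j); last first.
  rewrite leqn0 => /eqP yj; rewrite big1// => i _.
  by rewrite yj /bot; case: (y i) => [|m]; rewrite ?mulr0 ?mul0r.
pose P := fun i : 'I_K => y j == y i.
have Pj : P j by rewrite /P.
case: (@arg_minnP _ j P (fun i => val i) Pj) => i Pi hi.
have ti : bot i y.
  rewrite /bot; move: (Pi); rewrite /P => /eqP <-; rewrite yj /=.
  apply/forallP => k; apply/implyP => ik; rewrite (eqP Pi) ltn_neqAle oy ?(ltnW ik)// andbT.
  apply/negP => /eqP e; have : (i <= k)%N by apply: hi; rewrite /P e.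
  by rewrite leqNgt ik.
rewrite (bigD1 i)//= ti mulr1 (_ : (y j == y i)) ?addr0//.
rewrite big1 ?addr0// => k ki.
have [e|] := eqVneq (y j) (y k); last by rewrite mul0r.
rewrite mul1r; apply/eqP; rewrite pnatr_eq0 eqb0; apply/negP => /andP[_ /forallP tk].
have ki' : (i < k)%N.
  by rewrite ltn_neqAle eq_sym (inj_eq val_inj) ki/= hi// /P e.
have := tk i; rewrite ki' /= -e; move: Pi; rewrite /P => /eqP <-.
by rewrite ltnn.
Qed.

Definition sym f := forall (s : 'S_K) y, f (y \o s) = f y.

Lemma sym_incr f i j y : sym f -> y i = y j -> f (incr i y) = f (incr j y).
Proof.
move=> sf e; rewrite -(sf (tperm i j) (incr i y)); congr f; apply/funext => k /=.
rewrite /incr /upd; case: tpermP => [->|->|/eqP ki /eqP kj].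
- by rewrite (eq_sym i) e.
- by rewrite !eqxx e.
- by rewrite (negbTE ki) (negbTE kj).
Qed.

Lemma sym_decr f i j y : sym f -> y i = y j -> f (decr i y) = f (decr j y).
Proof.
move=> sf e; rewrite -(sf (tperm i j) (decr i y)); congr f; apply/funext => k /=.
rewrite /decr /upd; case: tpermP => [->|->|/eqP ki /eqP kj].
- by rewrite (eq_sym i) e.
- by rewrite !eqxx e.
- by rewrite (negbTE ki) (negbTE kj).
Qed.

Lemma sum_bool_pair (F : bool * 'I_K -> R) :
  \sum_l F l = \sum_i F (true, i) + \sum_i F (false, i).
Proof.
transitivity (\sum_(t : bool) \sum_i F (t, i)).
  by rewrite pair_bigA/=; apply: eq_bigr => -[].
by rewrite big_bool.
Qed.

(* In a group of equal queues the ranked dynamics moves only the last one up and the first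
   one down, at the total rate of the group; a symmetric function does not see which. *)
Lemma rank_gen_sym f y : sym f -> ordered y ->
  jump qrk mv f y = queue_gen lm nu beta f y.
Proof.
move=> sf oy; rewrite /jump sum_bool_pair /queue_gen.
have hup : \sum_i qrk (true, i) y * (f (mv (true, i) y) - f y) =
    \sum_j w j * (f (incr j y) - f y).
  rewrite (eq_bigr (fun i => \sum_j w j * (f (incr j y) - f y) *
     ((y j == y i)%:R * (top i y)%:R))); last first.
    move=> i _; rewrite rate_up up_indE// !mulr_suml; apply: eq_bigr => j _.
    rewrite /mv/=; have [e|_] := eqVneq (y j) (y i); last by rewrite !(mulr0, mul0r).
    by rewrite (sym_incr sf e); ring.
  rewrite exchange_big/=; apply: eq_bigr => j _.
  by rewrite -mulr_sumr top_unique// mulr1.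
have hdown : \sum_i qrk (false, i) y * (f (mv (false, i) y) - f y) =
    \sum_j nu * (0 < y j)%N%:R * (f (decr j y) - f y).
  rewrite (eq_bigr (fun i => \sum_j nu * (f (decr j y) - f y) *
     ((y j == y i)%:R * (bot i y)%:R))); last first.
    move=> i _; rewrite rate_down down_indE// !mulr_suml; apply: eq_bigr => j _.
    rewrite /mv/=; have [e|_] := eqVneq (y j) (y i); last by rewrite !(mulr0, mul0r).
    by rewrite (sym_decr sf e); ring.
  rewrite exchange_big/=; apply: eq_bigr => j _.
  by rewrite -mulr_sumr bot_unique//; ring.
have h0 : (0 < K)%N by exact: leq_trans K2.
pose z := Ordinal h0.
have az : amin z y by apply/forallP => i; exact: oy.
(* The weights [w] give the extra stream to rank 0, whereas the generator splits it evenly among the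
   shortest queues; a symmetric [f] does not see the difference. *)
have hb : \sum_j beta / (ngrp y)%:R * (amin j y)%:R * (f (incr j y) - f y) =
    beta * (f (incr z y) - f y).
  have hs := sum_amin z beta y.
  rewrite -[in RHS]hs mulr_suml; apply: eq_bigr => j _.
  have [aj|_] := boolP (amin j y); last by rewrite !(mulr0, mul0r).
  rewrite (sym_incr (j := z) sf)//; apply/eqP.
  by rewrite eqn_leq (forallP aj) (forallP az).
rewrite hup hdown !big_split/= hb.
have -> : \sum_j w j * (f (incr j y) - f y) =
   \sum_j lm * (f (incr j y) - f y) + beta * (f (incr z y) - f y).
  rewrite (eq_bigr (fun j => lm * (f (incr j y) - f y) +
     beta * ((val j == 0%N)%:R * (f (incr j y) - f y)))); last by move=> j _; rewrite /w; ring.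
  rewrite big_split/= -!mulr_sumr; congr (_ * _ + _ * _).
  rewrite (bigD1 z)//= mul1r big1 ?addr0// => j hj.
  have -> : (val j == 0%N) = false by apply: contraNF hj => /eqP h; apply/eqP/val_inj.
  by rewrite mul0r.
by ring.
Qed.

Lemma sym_queue_gen f : sym f -> sym (queue_gen lm nu beta f).
Proof.
move=> sf s y; rewrite /queue_gen [RHS](reindex_inj (@perm_inj _ s))/=.
have ha j : amin j (y \o s) = amin (s j) y.
  apply/forallP/forallP => h i; last exact: h.
  by have := h ((s^-1)%g i); rewrite /= permKV.
have hg : ngrp (y \o s) = ngrp y.
  by rewrite /ngrp [RHS](reindex_inj (@perm_inj _ s)); apply: eq_bigr => j _; rewrite ha.
have hu j v : upd (y \o s) j v = upd y (s j) v \o s.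
  by apply/funext => i; rewrite /upd /= (inj_eq (@perm_inj _ s)).
apply: eq_bigr => j _; rewrite ha hg sf.
have -> : incr j (y \o s) = incr (s j) y \o s by rewrite /incr hu.
have -> : decr j (y \o s) = decr (s j) y \o s by rewrite /decr hu.
by rewrite !sf.
Qed.

End Ranked.

(** * Forcing the path by Poisson counts *)

Lemma fin_min_pos {R : realType} {L : finType} (Q : L -> R -> Prop) :
  (forall l, exists e : R, 0 < e /\ Q l e) ->
  (forall l (e e' : R), e' <= e -> Q l e -> Q l e') ->
  exists e : R, 0 < e /\ forall l, Q l e.
Proof.
move=> hQ mQ; have [e he] := choice hQ.
exists (\big[Num.min/1]_l e l); split.
  by apply: (big_ind (fun x : R => 0 < x)) => [//|x y x0 y0|l _]; [rewrite lt_min x0 | have [] := he l].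
by move=> l; apply: mQ (proj2 (he l)); exact: bigmin_le.
Qed.

Section Counting.
Context {R : realType}.
Variable N : R -> nat.
Hypothesis cN : counting_path N.

Lemma counting_le s t : 0 <= s -> s <= t -> (N s <= N t)%N.
Proof. by case: cN => _ [h _]; exact: h. Qed.

Lemma counting_squeeze s u t : 0 <= s -> s <= u -> u <= t -> N t = N s -> N u = N s.
Proof.
move=> s0 su ut e; apply/eqP; rewrite eqn_leq (counting_le s0 su) andbT -e.
by rewrite counting_le// (le_trans s0).
Qed.

(** The jump time is the supremum of the times at which the count is still m; right-continuity
    excludes the value m there. *)
Lemma counting_jump p p' m : 0 <= p -> p <= p' -> N p = m -> N p' = m.+1 ->
  exists x, [/\ p < x, x <= p', N x = m.+1 & forall u, p <= u -> u < x -> N u = m].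
Proof.
move=> p0 pp' Np Np'; case: cN => _ [_ rc].
pose A := [set u | p <= u <= p' /\ N u = m].
have hA : has_sup A.
  by split; [exists p; rewrite /A/= lexx pp' | exists p' => u [/andP[]]].
set x := sup A.
have px : p <= x by apply: sup_upper_bound => //; rewrite /A/= lexx pp'.
have xp' : x <= p' by apply: ge_sup; [exact: hA.1 | move=> u [/andP[]]].
have below u : p <= u -> u < x -> N u = m.
  move=> pu ux; have xu0 : 0 < x - u by rewrite subr_gt0.
  have [v [/andP[pv vp'] Nv] uv] := sup_adherent xu0 hA.
  move: uv; rewrite -/x subKr => uv; rewrite -Np.
  by apply: (@counting_squeeze p u v) => //; [exact: ltW | rewrite Nv].
have x0 : 0 <= x by exact: le_trans px.
have [e [e0 he]] := rc x x0.
have Nx : N x = m.+1.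
  have Nxle : (N x <= m.+1)%N by rewrite -Np' counting_le.
  have Nxge : (m <= N x)%N by rewrite -Np counting_le.
  apply/eqP; rewrite eqn_leq Nxle/= ltn_neqAle Nxge andbT; apply/negP => /eqP Nxm.
  have xltp' : x < p'.
    by rewrite lt_neqAle xp' andbT; apply/eqP => E; move: Np'; rewrite -E -Nxm; lia.
  pose v := Num.min p' (x + e / 2).
  have xv : x < v by rewrite lt_min xltp' ltrDl divr_gt0.
  have vA : A v.
    rewrite /A/= ge_min lexx/= andbT (le_trans px (ltW xv)); split => //.
    rewrite (he v) ?(ltW xv)// (le_lt_trans (_ : v <= x + e / 2))//.
      by rewrite ge_min lexx orbT.
    by rewrite ltrD2l ltr_pdivrMr// ltr_pMr// ltr1n.
  by have := sup_upper_bound hA vA; rewrite -/x leNgt xv.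
exists x; split => //; rewrite lt_neqAle px andbT; apply/eqP => E.
by move: Nx; rewrite -E Np; lia.
Qed.

End Counting.

Section Path.
Context {R : realType} {K : nat}.
Local Notation L := (bool * 'I_K)%type.
Local Notation St := ('I_K -> nat).
Variables (rate : L -> St -> R) (C rmin : R).
Hypotheses (rate0 : forall l x, 0 <= rate l x) (rateC : forall l x, rate l x <= C).
Hypotheses (C0 : 0 < C) (rmin0 : 0 < rmin).
Hypothesis rate_min : forall l x, rate l x != 0 -> rmin <= rate l x.
Variables (N : L -> R -> nat) (x0 : St) (X : R -> St) (tau : L -> R -> R).
Hypothesis cN : forall l, counting_path (N l).
Hypothesis tau0 : forall l, tau l 0 = 0.
Hypothesis tau_mono : forall l s t, 0 <= s -> s <= t -> tau l s <= tau l t.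
Hypothesis tau_lip : forall l s t, 0 <= s -> s <= t -> tau l t <= tau l s + C * (t - s).
Hypothesis tau_cst : forall l s t x, 0 <= s -> s <= t ->
  (forall v, s <= v -> v < t -> X v = x) -> tau l t = tau l s + (t - s) * rate l x.
Hypothesis XE : forall t i, 0 <= t -> ((X t i)%:R : R) =
  (x0 i)%:R + (N (true, i) (tau (true, i) t))%:R - (N (false, i) (tau (false, i) t))%:R.

Lemma tau_ge0 l s : 0 <= s -> 0 <= tau l s.
Proof. by move=> s0; rewrite -(tau0 l) tau_mono. Qed.

Lemma X_same s t : 0 <= s -> 0 <= t ->
  (forall l, N l (tau l t) = N l (tau l s)) -> X t = X s.
Proof.
move=> s0 t0 h; apply/funext => i; apply/eqP; rewrite -(eqr_nat R) !XE//.
by rewrite !h.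
Qed.

Lemma X_jump s t l0 : 0 <= s -> 0 <= t ->
  N l0 (tau l0 t) = (N l0 (tau l0 s)).+1 ->
  (forall l, l != l0 -> N l (tau l t) = N l (tau l s)) -> X t = mv l0 (X s).
Proof.
move=> s0 t0 h0 h; apply/funext => i.
have [e|ni] := eqVneq i l0.2; last first.
  have -> : mv l0 (X s) i = X s i.
    by rewrite /mv /incr /decr /upd; case: l0.1; rewrite (negbTE ni).
  apply/eqP; rewrite -(eqr_nat R) !XE// !h//.
    by apply: contra ni => /eqP <-.
  by apply: contra ni => /eqP <-.
move: h0 h; rewrite e; case: (l0) => -[] i0 /= h0 h; rewrite /mv /incr /decr /upd /= eqxx.
  apply/eqP; rewrite -(eqr_nat R) -natr1 !XE// h0 h//= -natr1; apply/eqP; ring.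
have : (X t i0)%:R + 1 = (X s i0)%:R :> R by rewrite !XE// h0 h//= -natr1; ring.
by rewrite natr1 => /eqP; rewrite eqr_nat => /eqP <-.
Qed.

Lemma no_jump s (d : R) x : 0 <= s -> 0 <= d -> X s = x ->
  (forall l u, 0 <= u -> u < d -> N l (tau l s + u * rate l x) = N l (tau l s)) ->
  (forall l u, 0 <= u -> u <= d -> tau l (s + u) = tau l s + u * rate l x) /\
  (forall u, 0 <= u -> u < d -> X (s + u) = x).
Proof.
move=> s0 d0 Xs hN.
pose P u := forall v, 0 <= v -> v < u -> X (s + v) = x.
have tauP u : 0 <= u -> P u -> forall l v, 0 <= v -> v <= u ->
    tau l (s + v) = tau l s + v * rate l x.
  move=> u0 Pu l v v0 vu.
  rewrite (@tau_cst l s (s + v) x) ?lerDl//; first by congr (_ + _ * _); ring.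
  move=> z sz zv; have -> : z = s + (z - s) by ring.
  by apply: Pu; lra.
suff Pd : P d by split => //; exact: tauP.
pose A := [set u | 0 <= u <= d /\ P u].
have A0 : A 0 by rewrite /A/= lexx d0; split => // v v0 /(le_lt_trans v0); rewrite ltxx.
have hA : has_sup A by split; [exists 0 | exists d => u [/andP[]]].
set us := sup A.
have us0 : 0 <= us by exact: sup_upper_bound.
have usd : us <= d by apply: ge_sup; [exact: hA.1 | move=> u [/andP[]]].
have Pus : P us.
  move=> v v0 vus; have us_v : 0 < us - v by rewrite subr_gt0.
  have [u [_ Pu] uv] := sup_adherent us_v hA.
  by move: uv; rewrite -/us subKr; exact: Pu.
have [usde|usn] := eqVneq us d; first by rewrite -usde.
have usltd : us < d by rewrite lt_neqAle usn.
exfalso.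
have tus l : tau l (s + us) = tau l s + us * rate l x by exact: (tauP us).
have [e [e0 he]] : exists e : R, 0 < e /\ forall l, forall z, tau l (s + us) <= z ->
    z < tau l (s + us) + e -> N l z = N l (tau l (s + us)).
  apply: fin_min_pos => [l|l e e' ee' he z h1 h2].
    by case: (cN l) => _ [_ rc]; apply: rc; rewrite tau_ge0// addr_ge0.
  by apply: he => //; apply: lt_le_trans h2 _; rewrite lerD2l.
(* Clocks run at speed at most C, so for a time e / C they stay where right-continuity freezes all
   counters. *)
pose et := Num.min (d - us) (e / C).
have et0 : 0 < et by rewrite lt_min subr_gt0 usltd divr_gt0.
have Pet : P (us + et).
  move=> v v0 vet; have [vus|usv] := ltP v us; first exact: Pus.
  rewrite -Xs; apply: X_same => //; first by rewrite addr_ge0.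
  move=> l; rewrite (he l).
  - by rewrite tus hN.
  - by apply: tau_mono; rewrite ?addr_ge0// lerD2l.
  - have h1 : tau l (s + v) <= tau l (s + us) + C * (s + v - (s + us)).
      by apply: tau_lip; rewrite ?addr_ge0// lerD2l.
    apply: le_lt_trans h1 _; rewrite ltrD2l mulrC -ltr_pdivlMr//.
    have h2 : et <= e / C by rewrite ge_min lexx orbT.
    by apply: lt_le_trans h2; lra.
have : A (us + et).
  split => //; rewrite addr_ge0 ?(ltW et0)//=.
  have : et <= d - us by rewrite ge_min lexx.
  by lra.
by move=> /(sup_upper_bound hA); rewrite -/us; lra.
Qed.

(* The guessed clocks [c] may run ahead of the true clocks [tau], by at most [H], as long as
   no counter jumps in between. *)
Definition synced s x (c : L -> R) (H : R) := [/\ 0 <= s, X s = x &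
  forall l, [/\ tau l s <= c l, c l <= tau l s + H & N l (tau l s) = N l (c l)]].

Lemma synced_step s x c H h : 0 <= h -> synced s x c H ->
  (forall l, N l (c l + h * rate l x) = N l (c l)) ->
  synced (s + h) x (fun l => c l + h * rate l x) H.
Proof.
move=> h0 [s0 Xs hs] hN.
have hr l : 0 <= h * rate l x by rewrite mulr_ge0.
have sq l u : 0 <= u -> u <= h -> N l (tau l s + u * rate l x) = N l (tau l s).
  move=> u0 uh; have [h1 h2 h3] := hs l.
  apply: (counting_squeeze (cN l) (t := c l + h * rate l x)).
  - exact: tau_ge0.
  - by rewrite lerDl mulr_ge0.
  - by rewrite lerD// ler_wpM2r.
  - by rewrite hN h3.
have [ht hX] := no_jump s0 h0 Xs (fun l u u0 uh => sq l u u0 (ltW uh)).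
have Xsh : X (s + h) = x.
  rewrite -Xs; apply: X_same => // [|l]; first exact: addr_ge0.
  by rewrite ht// sq.
split => // [|l]; first exact: addr_ge0.
have [h1 h2 h3] := hs l.
rewrite ht//; split; first by rewrite lerD2r.
  by rewrite addrAC lerD2r.
by rewrite sq// h3 hN.
Qed.

(** The jump sits at a clock value xi inside the window, so the true clock meets it after a delay d
    <= H / rmin + h <= W h, whatever its lag. The quiet stretch, W h time units at the maximal speed
    C, covers all that any clock can do up to s + W h, so no second jump occurs. *)
Lemma synced_jump s x c H h (W : nat) l0 : 0 <= h -> 0 <= H -> synced s x c H ->
  H / rmin + h <= W%:R * h ->
  N l0 (c l0 + h * rate l0 x) = (N l0 (c l0)).+1 ->
  (forall l, l != l0 -> N l (c l + h * rate l x) = N l (c l)) ->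
  (forall l, N l (c l + h * rate l x + W%:R * h * C) = N l (c l + h * rate l x)) ->
  synced (s + W%:R * h) (mv l0 x) (fun l => c l + h * rate l x + W%:R * h * C)
    (H + h * C + W%:R * h * C).
Proof.
move=> h0 H0 [s0 Xs hs] hW hj hnj hc.
set Wh := W%:R * h; have Wh0 : 0 <= Wh by rewrite mulr_ge0.
have c_ge0 l : 0 <= c l by have [h1 _ _] := hs l; apply: le_trans h1; exact: tau_ge0.
have hr l : 0 <= h * rate l x by rewrite mulr_ge0.
have [xi [cxi xic Nxi hxi]] : exists xi, [/\ c l0 < xi, xi <= c l0 + h * rate l0 x,
    N l0 xi = (N l0 (c l0)).+1 & forall u, c l0 <= u -> u < xi -> N l0 u = N l0 (c l0)].
  by apply: (counting_jump (cN l0)) => //; rewrite lerDl.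
have r0 : rate l0 x != 0.
  by apply/eqP => r0; move: hj; rewrite r0 mulr0 addr0; lia.
have rp : 0 < rate l0 x by rewrite lt0r r0 rate0.
have [t1 t2 t3] := hs l0.
set d := (xi - tau l0 s) / rate l0 x.
have d0 : 0 <= d by rewrite divr_ge0// subr_ge0 (le_trans t1)// ltW.
have dE : d * rate l0 x = xi - tau l0 s by rewrite /d divfK.
have dW : d <= Wh.
  apply: le_trans hW; rewrite /d ler_pdivrMr//.
  apply: (@le_trans _ _ (H + h * rate l0 x)); first by lra.
  rewrite mulrDl lerD2r mulrAC ler_pdivlMr//.
  by rewrite ler_wpM2l// rate_min.
have big l u : 0 <= u -> u <= Wh -> u * rate l x <= Wh * C.
  by move=> u0 uW; apply: ler_pM.
have hN l u : 0 <= u -> u < d -> N l (tau l s + u * rate l x) = N l (tau l s).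
  move=> u0 ud; have [h1 h2 h3] := hs l.
  have ut : tau l s <= tau l s + u * rate l x by rewrite lerDl mulr_ge0.
  have [->|ll] := eqVneq l l0.
    have uxi : tau l0 s + u * rate l0 x < xi.
      have : u * rate l0 x < d * rate l0 x by rewrite ltr_pM2r.
      by rewrite dE; lra.
    have [uc|cu] := leP (tau l0 s + u * rate l0 x) (c l0).
      apply: (counting_squeeze (cN l0) (t := c l0)) => //.
      - exact: tau_ge0.
      - by rewrite lerDl mulr_ge0.
    by rewrite hxi// ltW.
  apply: (counting_squeeze (cN l) (t := c l + h * rate l x + Wh * C)) => //.
  - exact: tau_ge0.
  - by have := big l u u0 (le_trans (ltW ud) dW); have := hr l; lra.
  - by rewrite hc hnj// h3.
have [ht hX] := no_jump s0 d0 Xs hN.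
have sd0 : 0 <= s + d by exact: addr_ge0.
have td l : tau l (s + d) = tau l s + d * rate l x by exact: ht.
have Nl0 : N l0 (tau l0 (s + d)) = (N l0 (tau l0 s)).+1.
  by rewrite td dE addrC subrK Nxi t3.
have Nl l : l != l0 -> N l (tau l (s + d)) = N l (tau l s).
  move=> ll; have [h1 h2 h3] := hs l; rewrite td.
  apply: (counting_squeeze (cN l) (t := c l + h * rate l x + Wh * C)) => //.
  - exact: tau_ge0.
  - by rewrite lerDl mulr_ge0.
  - by have := big l d d0 dW; have := hr l; lra.
  - by rewrite hc hnj// h3.
have Xd : X (s + d) = mv l0 x by rewrite -Xs; exact: X_jump.
have Ntd l : N l (tau l (s + d)) = N l (c l + h * rate l x + Wh * C).
  rewrite hc; have [->|ll] := eqVneq l l0; first by rewrite Nl0 hj t3.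
  by have [_ _ h3] := hs l; rewrite Nl// hnj.
have sq l u : 0 <= u -> u <= Wh - d ->
    N l (tau l (s + d) + u * rate l (mv l0 x)) = N l (tau l (s + d)).
  move=> u0 uW; have [h1 h2 h3] := hs l.
  apply: (counting_squeeze (cN l) (t := c l + h * rate l x + Wh * C)) => //.
  - exact: tau_ge0.
  - by rewrite lerDl mulr_ge0.
  - rewrite td.
    have a1 : d * rate l x <= d * C by rewrite ler_wpM2l.
    have a2 : u * rate l (mv l0 x) <= (Wh - d) * C by apply: ler_pM.
    by have := hr l; move: a2; rewrite mulrBl; lra.
have W0 : 0 <= Wh - d by rewrite subr_ge0.
have [ht' hX'] := no_jump sd0 W0 Xd (fun l u u0 uh => sq l u u0 (ltW uh)).
have e : s + d + (Wh - d) = s + Wh by ring.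
have XW : X (s + Wh) = mv l0 x.
  rewrite -Xd; apply: X_same => // [|l]; first exact: addr_ge0.
  by rewrite -e ht'// sq.
split => // [|l]; first exact: addr_ge0.
have [h1 h2 h3] := hs l.
have lip : tau l (s + Wh) <= tau l s + C * (s + Wh - s) by apply: tau_lip; rewrite ?lerDl.
have mono : tau l s <= tau l (s + Wh) by apply: tau_mono; rewrite ?lerDl.
have hC : h * rate l x <= h * C by rewrite ler_wpM2l.
split.
- have e2 : s + Wh - s = Wh by ring.
  move: lip h1 (hr l); rewrite e2 (mulrC C).
  by move: (tau l (s + Wh)) (tau l s) (c l) (Wh * C) (h * _) => A B D E F; lra.
- lra.
- by rewrite -e ht'// sq.
Qed.

End Path.

Section Look.
Context {R : realType} {K : nat} {A : Type}.
Local Notation L := (bool * 'I_K)%type.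
Local Notation St := ('I_K -> nat).
Variables (Phi : St -> R) (W : nat -> nat).
Variables (sw : A -> St -> R) (sa : A -> St -> A).
Variables (hw : nat -> L -> A -> St -> R) (ha : nat -> A -> St -> A).

(* [k] time steps with at most [J] jumps: in a step either no counter moves, or exactly one
   does, and then the guessed clocks are advanced by [W j] quiet steps so that the true clocks,
   whatever the time of the jump inside the step, stay behind them. *)
Fixpoint look (J j : nat) {struct J} : nat -> St -> A -> R :=
  fix inner (k : nat) (x : St) (c : A) {struct k} : R :=
    match k with
    | 0%N => Phi x
    | k'.+1 => sw c x * inner k' x (sa c x) +
        match J with
        | 0%N => 0
        | J'.+1 => if (W j <= k'.+1)%N then
            \sum_(l : L) hw j l c x * look J' j.+1 (k'.+1 - W j)%N (mv l x) (ha j c x)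
          else 0
        end
    end.

Lemma look0 J j x c : look J j 0 x c = Phi x.
Proof. by case: J. Qed.

Lemma look0S j k x c : look 0 j k.+1 x c = sw c x * look 0 j k x (sa c x).
Proof. by rewrite /= addr0. Qed.

Lemma lookSS J j k x c : look J.+1 j k.+1 x c = sw c x * look J.+1 j k x (sa c x) +
  if (W j <= k.+1)%N then
    \sum_(l : L) hw j l c x * look J j.+1 (k.+1 - W j)%N (mv l x) (ha j c x)
  else 0.
Proof. by []. Qed.

Lemma look_ge0 : (forall x, 0 <= Phi x) -> (forall c x, 0 <= sw c x) ->
  (forall j l c x, 0 <= hw j l c x) -> forall J j k x c, 0 <= look J j k x c.
Proof.
move=> P0 s0 h0; elim=> [|J IHJ] j; elim=> [|k IHk] x c; rewrite ?look0//.
  by rewrite look0S mulr_ge0.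
rewrite lookSS addr_ge0// ?mulr_ge0//; case: ifP => // _.
by apply: sumr_ge0 => l _; rewrite mulr_ge0.
Qed.

End Look.

Lemma minn_monol m n p : (m <= n)%N -> (minn m p <= minn n p)%N.
Proof. by lia. Qed.

Section Lookahead.
Context {R : realType} {K : nat}.
Local Notation L := (bool * 'I_K)%type.
Local Notation St := ('I_K -> nat).
Variables (rate : L -> St -> R) (C rmin h : R) (W : nat -> nat) (Phi : St -> R).
Hypotheses (rate0 : forall l x, 0 <= rate l x) (rateC : forall l x, rate l x <= C).
Hypotheses (C0 : 0 < C) (rmin0 : 0 < rmin) (h0 : 0 <= h) (Phi0 : forall x, 0 <= Phi x).
Hypothesis rate_min : forall l x, rate l x != 0 -> rmin <= rate l x.

(** How far, in units of h, the guessed clocks may be ahead after j jumps: each jump adds one window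
    and its quiet stretch, both counted at full speed C. *)
Fixpoint lead (j : nat) : R :=
  if j is j'.+1 then lead j' + C + (W j')%:R * C else 0.
Hypothesis Wlead : forall j, lead j / rmin + 1 <= (W j)%:R.

Lemma lead_ge0 j : 0 <= lead j.
Proof.
elim: j => //= j IH; rewrite addr_ge0//; first by rewrite addr_ge0// ltW.
by rewrite mulr_ge0// ltW.
Qed.

Lemma W_gt0 j : (0 < W j)%N.
Proof.
rewrite -(ltr_nat R); apply: lt_le_trans (Wlead j).
by rewrite ltr_wpDl// divr_ge0// ?lead_ge0// ltW.
Qed.

Definition stay_ind (N : L -> R -> nat) (c : L -> R) x : R :=
  [forall l, N l (c l + h * rate l x) == N l (c l)]%:R.
(** The second condition is the quiet stretch of [W j] steps; it is tested at the maximal speed C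
    because the rates in force depend on when the jump happens. *)
Definition hop_ind (N : L -> R -> nat) j l0 (c : L -> R) x : R :=
  ([forall l, N l (c l + h * rate l x) == addn (N l (c l)) (l == l0)] &&
   [forall l, N l (c l + h * rate l x + (W j)%:R * h * C) == N l (c l + h * rate l x)])%:R.
Definition stay_clk (c : L -> R) x := fun l => c l + h * rate l x.
Definition hop_clk j (c : L -> R) x := fun l => c l + h * rate l x + (W j)%:R * h * C.

Definition plook N := look Phi W (stay_ind N) stay_clk (hop_ind N) hop_clk.

Section Pathwise.
Variables (N : L -> R -> nat) (x0 : St) (X : R -> St) (tau : L -> R -> R).
Hypothesis cN : forall l, counting_path (N l).
Hypothesis tau0 : forall l, tau l 0 = 0.
Hypothesis tau_mono : forall l s t, 0 <= s -> s <= t -> tau l s <= tau l t.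
Hypothesis tau_lip : forall l s t, 0 <= s -> s <= t -> tau l t <= tau l s + C * (t - s).
Hypothesis tau_cst : forall l s t x, 0 <= s -> s <= t ->
  (forall v, s <= v -> v < t -> X v = x) -> tau l t = tau l s + (t - s) * rate l x.
Hypothesis XE : forall t i, 0 <= t -> ((X t i)%:R : R) =
  (x0 i)%:R + (N (true, i) (tau (true, i) t))%:R - (N (false, i) (tau (false, i) t))%:R.

Lemma ind1 (B : bool) : B%:R != 0 :> R -> B%:R = 1 :> R.
Proof. by case: B; rewrite ?eqxx. Qed.

Lemma stay_hop c x j l : stay_ind N c x != 0 -> hop_ind N j l c x = 0.
Proof.
rewrite pnatr_eq0 eqb0 negbK => /forallP hs; apply/eqP; rewrite pnatr_eq0 eqb0 negb_and.
apply/orP; left; apply/forallPn; exists l; rewrite (eqP (hs l)) eqxx.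
by rewrite -[X in X == _]addn0 eqn_add2l.
Qed.

Lemma hop_hop c x j l l' : l' != l -> hop_ind N j l c x != 0 -> hop_ind N j l' c x = 0.
Proof.
move=> ll; rewrite pnatr_eq0 eqb0 negbK => /andP[/forallP hs _].
apply/eqP; rewrite pnatr_eq0 eqb0 negb_and.
apply/orP; left; apply/forallPn; exists l'; rewrite (eqP (hs l')) eqxx (negbTE ll).
by rewrite eqn_add2l.
Qed.

(** By [stay_hop] and [hop_hop] the branches of [look] exclude each other, so at most one is nonzero
    on a given path; along it the path is forced and ends in the state at which [Phi] is
    evaluated. *)
Lemma plook_le J j k s x c : synced N X tau s x c (h * lead j) ->
  plook N J j k x c <= Phi (X (s + k%:R * h)).
Proof.
have base j' x' s' c' : synced N X tau s' x' c' (h * lead j') ->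
    forall J', plook N J' j' 0 x' c' <= Phi (X (s' + 0%:R * h)).
  by move=> [_ Xs _] J'; rewrite /plook look0 mul0r addr0 Xs.
have stay j' x' s' c' : stay_ind N c' x' != 0 -> synced N X tau s' x' c' (h * lead j') ->
    synced N X tau (s' + h) x' (stay_clk c' x') (h * lead j').
  rewrite pnatr_eq0 eqb0 negbK => /forallP hs sy.
  by apply: (synced_step rate0 C0 cN tau0 tau_mono tau_lip tau_cst XE h0 sy) => l; apply/eqP.
elim: J j k s x c => [|J IHJ] j k; elim: k => [|k IHk] s x c sy; try exact: base sy _.
  rewrite /plook look0S; have [->|hs] := eqVneq (stay_ind N c x) 0; first by rewrite mul0r.
  have -> : stay_ind N c x = 1 by exact: ind1.
  rewrite mul1r (_ : s + k.+1%:R * h = s + h + k%:R * h); last by rewrite -natr1; ring.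
  by apply: IHk; exact: stay.
rewrite /plook lookSS; have [hs0|hs] := eqVneq (stay_ind N c x) 0; last first.
  have -> : stay_ind N c x = 1 by exact: ind1.
  rewrite mul1r [X in _ + X](_ : _ = 0) ?addr0; last first.
    by case: ifP => // _; rewrite big1// => l _; rewrite stay_hop// mul0r.
  rewrite (_ : s + k.+1%:R * h = s + h + k%:R * h); last by rewrite -natr1; ring.
  by apply: IHk; exact: stay.
rewrite hs0 mul0r add0r; case: ifP => // Wk.
have [/existsP[l0 hl0]|] := boolP [exists l, hop_ind N j l c x != 0]; last first.
  move/existsPn => hn; rewrite big1// => l _.
  by have := hn l; rewrite negbK => /eqP ->; rewrite mul0r.
rewrite (bigD1 l0)//= big1 ?addr0 => [|l ll]; last by rewrite (hop_hop ll hl0) mul0r.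
have h1 : hop_ind N j l0 c x = 1 by exact: ind1.
rewrite h1 mul1r.
rewrite (_ : s + k.+1%:R * h = s + (W j)%:R * h + (k.+1 - W j)%:R * h); last first.
  by rewrite natrB//; ring.
apply: IHJ; rewrite /hop_clk.
have -> : h * lead j.+1 = h * lead j + h * C + (W j)%:R * h * C by rewrite /=; ring.
move: hl0; rewrite pnatr_eq0 eqb0 negbK => /andP[/forallP p1 /forallP p2].
apply: (synced_jump rate0 rateC C0 rmin0 rate_min cN tau0 tau_mono tau_lip tau_cst XE) => //.
- by rewrite mulr_ge0// lead_ge0.
- have := ler_wpM2l h0 (Wlead j); rewrite (mulrC h (W j)%:R) -mulrA.
  by move: (lead j / rmin) ((W j)%:R * h) => A B; lra.
- by rewrite (eqP (p1 l0)) eqxx addn1.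
- by move=> l ll; rewrite (eqP (p1 l)) (negbTE ll) addn0.
- by move=> l; apply/eqP.
Qed.

End Pathwise.

Local Notation Rb := (#|{: L}|%:R * C).
(* Probabilities of [stay_ind] and [hop_ind] for independent Poisson counters. *)
Definition stay_wt (_ : unit) x : R := \prod_l expR (- (h * rate l x)).
Definition hop_wt j l0 (_ : unit) x : R :=
  \prod_l (expR (- (h * rate l x)) * (h * rate l x) ^+ (l == l0)) *
  \prod_(l : L) expR (- ((W j)%:R * h * C)).
Definition wlook := look Phi W stay_wt (fun _ _ => tt) hop_wt (fun _ _ _ => tt).

Variables (M : R) (S : St -> Prop) (b : nat -> St -> R) (Wb : nat) (Jt : nat).
Hypothesis PhiM : forall x, Phi x <= M.
Hypothesis S_mv : forall l x, S x -> rate l x != 0 -> S (mv l x).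
Hypothesis b_0 : forall x, S x -> b 0 x = Phi x.
Hypothesis b_S : forall k x, S x -> b k.+1 x = b k x + h * jump rate (@mv K) (b k) x.
Hypothesis hR : h * Rb <= 1.
Hypothesis Wb_ge : forall j, (j < Jt)%N -> (W j <= Wb)%N.

(** Three losses: more than J jumps, by Markov's inequality for 2 to the power of the number of
    jumps; the quiet stretches and the steps they consume, of order h^2 per step; and jumps in the
    last [Wb] steps, which leave no room for a quiet stretch. *)
Definition look_err J k : R := 2 ^- J * (1 + h * Rb) ^+ k +
   2 * Wb%:R * Rb ^+ 2 * (k%:R * h ^+ 2) + (minn k Wb)%:R * (h * Rb).

Let s x : R := \sum_l rate l x.
Let s0 x : 0 <= s x. Proof. by apply: sumr_ge0 => l _. Qed.
Let sR x : s x <= Rb.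
Proof. by rewrite /s (le_trans (ler_sum _ (fun l _ => rateC l x)))// sumr_const mulr_natl. Qed.
Let Rb0 : 0 <= Rb. Proof. by apply: mulr_ge0 => //; exact: ltW. Qed.
Let hs1 x : h * s x <= 1.
Proof. by apply: le_trans hR; rewrite ler_wpM2l. Qed.
Let hs0 x : 0 <= h * s x. Proof. by rewrite mulr_ge0. Qed.
Let B0 : 0 <= h * Rb. Proof. exact: mulr_ge0. Qed.
Let A0 : 0 <= 2 * Wb%:R * Rb ^+ 2.
Proof. by apply: mulr_ge0; [exact: mulr_ge0 | exact: exprn_ge0]. Qed.
Let M0 : 0 <= M. Proof. exact: le_trans (Phi0 (fun=> 0%N)) (PhiM _). Qed.

Lemma b_SE k x : S x -> b k.+1 x = (1 - h * s x) * b k x + h * \sum_l rate l x * b k (mv l x).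
Proof.
move=> Sx; rewrite b_S// /jump.
rewrite (eq_bigr (fun l => rate l x * b k (mv l x) - rate l x * b k x)); last first.
  by move=> l _; rewrite mulrBr.
by rewrite big_split/= sumrN -mulr_suml -/(s x); ring.
Qed.

Lemma b_bnd k x : S x -> 0 <= b k x <= M.
Proof.
elim: k x => [|k IH] x Sx; first by rewrite b_0// Phi0 PhiM.
have s1 : 0 <= 1 - h * s x by rewrite subr_ge0.
have [b1 b2] := andP (IH _ Sx).
have c1 l : 0 <= rate l x * b k (mv l x).
  have [->|r0] := eqVneq (rate l x) 0; first by rewrite mul0r.
  by rewrite mulr_ge0//; have /andP[] := IH _ (S_mv Sx r0).
have c2 l : rate l x * b k (mv l x) <= rate l x * M.
  have [->|r0] := eqVneq (rate l x) 0; first by rewrite !mul0r.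
  by rewrite ler_wpM2l//; have /andP[] := IH _ (S_mv Sx r0).
rewrite b_SE//; apply/andP; split.
  apply: addr_ge0; first exact: mulr_ge0.
  by apply: mulr_ge0 => //; apply: sumr_ge0.
have -> : M = (1 - h * s x) * M + h * (s x * M) by ring.
by rewrite lerD ?ler_wpM2l// /s mulr_suml ler_sum.
Qed.

Lemma b_step k x : S x -> `|b k.+1 x - b k x| <= h * Rb * M.
Proof.
move=> Sx; rewrite b_S// addrC addKr normrM ger0_norm// -mulrA ler_wpM2l//.
apply: (@le_trans _ _ (s x * M)); last by rewrite ler_wpM2r.
rewrite /jump /s mulr_suml; apply: le_trans (ler_norm_sum _ _ _) _.
apply: ler_sum => l _; have [->|r0] := eqVneq (rate l x) 0; first by rewrite !mul0r normr0.
rewrite normrM ger0_norm// ler_wpM2l//.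
have /andP[b1 b2] := b_bnd k Sx; have /andP[b3 b4] := b_bnd k (S_mv Sx r0).
by rewrite ler_norml; apply/andP; split; lra.
Qed.

Lemma b_steps m k x : S x -> `|b (m + k)%N x - b k x| <= m%:R * (h * Rb * M).
Proof.
move=> Sx; elim: m => [|m IH]; first by rewrite add0n subrr normr0 mul0r.
rewrite addSn -natr1 mulrDl mul1r -(subrK (b (m + k)%N x) (b _.+1 x)) -addrA addrC.
by apply: le_trans (ler_normD _ _) _; apply: lerD => //; exact: b_step.
Qed.

Lemma stay_wt_ge x : 1 - h * s x <= stay_wt tt x.
Proof.
rewrite /stay_wt -expR_sum sumrN -mulr_sumr.
exact: expR_ge1Dx.
Qed.

Lemma hop_wt_ge j l x : h * rate l x * (1 - (1 + (W j)%:R) * (h * Rb)) <= hop_wt j l tt x.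
Proof.
have -> : hop_wt j l tt x = h * rate l x * expR (- (h * s x) - (W j)%:R * (h * Rb)).
  rewrite /hop_wt big_split/= -!expR_sum.
  have -> : \prod_(i : L) (h * rate i x) ^+ (i == l) = h * rate l x.
    by rewrite (bigD1 l)//= eqxx expr1 big1 ?mulr1// => i /negbTE ->; rewrite expr0.
  rewrite mulrAC -expRD mulrC; congr (_ * expR _).
  by rewrite sumrN -mulr_sumr -/(s x) sumr_const -mulr_natl; ring.
rewrite ler_wpM2l ?mulr_ge0//; apply: le_trans (expR_ge1Dx _).
have := ler_wpM2l h0 (sR x); move: (W j)%:R (h * Rb) (h * s x) => A B D; lra.
Qed.

Lemma stay_wt_ge0 x : 0 <= stay_wt tt x.
Proof. by apply: prodr_ge0 => l _; exact: expR_ge0. Qed.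

Lemma hop_wt_ge0 j l x : 0 <= hop_wt j l tt x.
Proof.
rewrite /hop_wt mulr_ge0//; apply: prodr_ge0 => i _; rewrite ?mulr_ge0 ?expR_ge0//.
by rewrite exprn_ge0// mulr_ge0.
Qed.

Lemma wlook_ge0 J j k x : 0 <= wlook J j k x tt.
Proof.
apply: look_ge0 => // [[] y|j' l [] y]; [exact: stay_wt_ge0 | exact: hop_wt_ge0].
Qed.

Lemma look_err_ge0 J k : 0 <= look_err J k.
Proof.
rewrite /look_err; apply: addr_ge0; first apply: addr_ge0.
- by rewrite mulr_ge0 ?invr_ge0 ?exprn_ge0// addr_ge0// mulr_ge0.
- by apply: mulr_ge0 => //; apply: mulr_ge0 => //; exact: exprn_ge0.
- exact: mulr_ge0.
Qed.

Lemma look_err_mono J k k' : (k <= k')%N -> look_err J k <= look_err J k'.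
Proof.
move=> kk; rewrite /look_err; apply: lerD; first apply: lerD.
- rewrite ler_wpM2l ?invr_ge0 ?exprn_ge0// ler_weXn2l// lerDl mulr_ge0//.
- by apply: ler_wpM2l => //; apply: ler_wpM2r; [exact: exprn_ge0 | rewrite ler_nat].
- by rewrite ler_wpM2r// ler_nat minn_monol.
Qed.

(** [b] is the Euler scheme of the backward equation. Away from the end of the horizon a step loses
    only second-order terms: the Poisson weights are at least their first-order expansions, and
    after a jump [b] is read with k + 1 - [W j] steps left in place of k. *)
Lemma wlook_ge J j k x : S x -> (j + J = Jt)%N ->
  b k x - M * look_err J k <= wlook J j k x tt.
Proof.
have p1 : 1 <= 1 + h * Rb by rewrite lerDl mulr_ge0.
elim: J j k x => [|J IHJ] j k x Sx jJ.
  apply: le_trans (wlook_ge0 _ _ _ _); rewrite subr_le0.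
  have /andP[_ bM] := b_bnd k Sx; apply: le_trans bM _.
  rewrite -[leLHS]mulr1 ler_wpM2l// /look_err expr0 invr1 mul1r.
  rewrite -addrA -[leLHS]addr0 lerD ?exprn_ege1//.
  apply: addr_ge0; last exact: mulr_ge0.
  by apply: mulr_ge0 => //; apply: mulr_ge0 => //; exact: exprn_ge0.
elim: k x Sx => [|k IHk] x Sx.
  rewrite /wlook look0 b_0// gerBl; exact: (mulr_ge0 M0 (look_err_ge0 _ _)).
have jJt : (j < Jt)%N by rewrite -jJ -addSnnS leq_addr.
have WjW := Wb_ge jJt.
have Wj0 := W_gt0 j.
have hs0' := hs0 x; have hs1' := hs1 x.
have e0 := look_err_ge0 J.+1 k.
have E1 : (1 - h * s x) * (b k x - M * look_err J.+1 k) <=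
    stay_wt tt x * wlook J.+1 j k x tt.
  have v0 := wlook_ge0 J.+1 j k x.
  apply: (@le_trans _ _ ((1 - h * s x) * wlook J.+1 j k x tt)).
    by rewrite ler_wpM2l ?subr_ge0// IHk.
  by rewrite ler_wpM2r// stay_wt_ge.
rewrite /wlook lookSS -/wlook b_SE//.
case: ifP => [Wk|/negbT]; last first.
  rewrite -ltnNge => kW; rewrite addr0; apply: le_trans E1.
  have E2 : h * (\sum_l rate l x * b k (mv l x)) <= h * Rb * M.
    rewrite -mulrA ler_wpM2l//; apply: (@le_trans _ _ (s x * M)); last by rewrite ler_wpM2r.
    rewrite /s mulr_suml; apply: ler_sum => l _.
    have [->|r0] := eqVneq (rate l x) 0; first by rewrite !mul0r.
    by rewrite ler_wpM2l//; have /andP[] := b_bnd k (S_mv Sx r0).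
  have E3 : look_err J.+1 k + h * Rb <= look_err J.+1 k.+1.
    have kWb : (k.+1 <= Wb)%N by apply: leq_trans WjW; exact: ltnW.
    have m1 : minn k Wb = k by apply/minn_idPl; exact: ltnW.
    have m2 : minn k.+1 Wb = k.+1 by apply/minn_idPl.
    rewrite /look_err m1 m2 -(natr1 k) (mulrDl k%:R 1 (h * Rb)) mul1r addrA lerD2r lerD2r.
    apply: lerD.
      by rewrite ler_wpM2l ?invr_ge0 ?exprn_ge0// ler_weXn2l.
    by apply: ler_wpM2l => //; apply: ler_wpM2r; [exact: exprn_ge0 | rewrite lerDl].
  have E4 := ler_wpM2l M0 E3.
  have E5 : 0 <= h * s x * (M * look_err J.+1 k) by rewrite !mulr_ge0.
  move: E2 E4 E5; move: (look_err J.+1 k) (look_err J.+1 k.+1) (b k x) (h * s x) (h * _ ) (h * Rb) => *; lra.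
set k1 := (k.+1 - W j)%N.
have k1k : (k1 <= k)%N by rewrite /k1 leq_subLR -add1n leq_add2r.
have kE : (k - k1).+1 = W j by rewrite -subSn// /k1 subKn.
have F l : rate l x != 0 -> h * rate l x * (b k (mv l x) - M * look_err J k -
     M * (2 * Wb%:R * (h * Rb))) <= hop_wt j l tt x * wlook J j.+1 k1 (mv l x) tt.
  move=> r0; have Sy := S_mv Sx r0; set y := mv l x in Sy *.
  have v0 := wlook_ge0 J j.+1 k1 y.
  have I1 : b k1 y - M * look_err J k1 <= wlook J j.+1 k1 y tt by apply: IHJ; rewrite ?addSnnS.
  have I2 : M * look_err J k1 <= M * look_err J k by rewrite ler_wpM2l// look_err_mono.
  have I3 : b k y - b k1 y <= (Wb%:R - 1) * (h * Rb * M).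
    have := b_steps (k - k1) k1 Sy; rewrite subnK// => h3.
    apply: le_trans (ler_norm _) _; apply: le_trans h3 _.
    rewrite ler_wpM2r//; first exact: mulr_ge0.
    by rewrite lerBrDr natr1 kE ler_nat.
  have I4 := hop_wt_ge j l x.
  have hr : 0 <= h * rate l x by rewrite mulr_ge0.
  have /andP[_ bM] := b_bnd k1 Sy.
  have le0 := mulr_ge0 M0 (look_err_ge0 J k).
  have hRb0 : 0 <= h * Rb by rewrite mulr_ge0.
  have WW : (W j)%:R <= Wb%:R :> R by rewrite ler_nat.
  set eps := (1 + (W j)%:R) * (h * Rb) in I4.
  have eps0 : 0 <= eps by rewrite mulr_ge0// addr_ge0.
  have epsW : eps <= (1 + Wb%:R) * (h * Rb) by rewrite ler_wpM2r// lerD2l.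
  have I5 : b k y - M * look_err J k - M * (2 * Wb%:R * (h * Rb)) <=
     b k1 y - M * look_err J k - M * eps.
    have := ler_wpM2l M0 epsW; move: I3.
    move: (M * eps) (h * Rb) (look_err _ _) (b k y) (b k1 y) (Wb%:R) => Z B e D1 D2 V; lra.
  apply: le_trans (ler_wpM2l hr I5) _.
  (* If eps > 1, the lower bound to be shown is nonpositive, because b is at most M. *)
  have [eps1|eps1] := leP eps 1.
    apply: (@le_trans _ _ (h * rate l x * (1 - eps) * wlook J j.+1 k1 y tt)); last first.
      by rewrite ler_wpM2r.
    rewrite -mulrA ler_wpM2l//.
    apply: (@le_trans _ _ ((1 - eps) * (b k1 y - M * look_err J k))); last first.
      by rewrite ler_wpM2l ?subr_ge0//; lra.
    have := ler_wpM2l eps0 bM; have := mulr_ge0 eps0 le0.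
    by move: (M * look_err _ _) (b k1 y) => e D; lra.
  apply: (@le_trans _ _ 0); last by rewrite mulr_ge0// hop_wt_ge0.
  rewrite mulr_ge0_le0//.
  have : M <= M * eps by rewrite ler_peMr// ltW.
  by move: (M * eps) (M * look_err _ _) le0 bM => *; lra.
have G : h * (\sum_l rate l x * b k (mv l x)) - h * s x * (M * look_err J k +
     M * (2 * Wb%:R * (h * Rb))) <= \sum_l hop_wt j l tt x * wlook J j.+1 k1 (mv l x) tt.
  rewrite /s !mulr_sumr mulr_suml -sumrB; apply: ler_sum => l _.
  have [r0|r0] := eqVneq (rate l x) 0.
    rewrite r0 !(mul0r, mulr0) subrr.
    by rewrite mulr_ge0 ?wlook_ge0 ?hop_wt_ge0.
  by apply: le_trans (F l r0); rewrite mulrBr mulrBr; move: (M * _) (M * _) => *; lra.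
(* Giving up one allowed jump doubles the term in 2^-J; this happens with weight at most h Rb, which
   is the factor 1 + h Rb contributed by one more step. *)
have Err : look_err J.+1 k + h * s x * (look_err J k - look_err J.+1 k + 2 * Wb%:R * (h * Rb))
   <= look_err J.+1 k.+1.
  have -> : look_err J k - look_err J.+1 k = 2 ^- J.+1 * (1 + h * Rb) ^+ k.
    rewrite /look_err.
    have -> : 2 ^- J = 2 * 2 ^- J.+1 :> R by rewrite exprS; field; exact: expf_neq0.
    ring.
  set G1 := 2 ^- J.+1 * (1 + h * Rb) ^+ k.
  have G0 : 0 <= G1 by rewrite mulr_ge0 ?invr_ge0 ?exprn_ge0// (le_trans _ p1).
  have hsR : h * s x <= h * Rb by rewrite ler_wpM2l.
  have wB : 0 <= 2 * Wb%:R * (h * Rb) by apply: mulr_ge0 => //; exact: mulr_ge0.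
  have I1 : h * s x * (G1 + 2 * Wb%:R * (h * Rb)) <= h * Rb * (G1 + 2 * Wb%:R * (h * Rb)).
    by rewrite ler_wpM2r// addr_ge0.
  apply: le_trans (lerD (lexx _) I1) _.
  have I2 : (minn k Wb)%:R * (h * Rb) <= (minn k.+1 Wb)%:R * (h * Rb).
    by rewrite ler_wpM2r// ler_nat minn_monol.
  rewrite /look_err (exprS _ k) -(natr1 k) -/G1.
  have -> : 2 ^- J.+1 * ((1 + h * Rb) * (1 + h * Rb) ^+ k) = G1 + h * Rb * G1.
    by rewrite /G1; ring.
  have -> : 2 * Wb%:R * Rb ^+ 2 * ((k%:R + 1) * h ^+ 2) =
     2 * Wb%:R * Rb ^+ 2 * (k%:R * h ^+ 2) + h * Rb * (2 * Wb%:R * (h * Rb)) by ring.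
  move: I2; rewrite (mulrDr (h * Rb)).
  have alg (g X1 X2 X3 m1 m2 : R) : m1 <= m2 ->
    g + X2 + m1 + (X3 + X1) <= g + X3 + (X2 + X1) + m2 by lra.
  exact: alg.
have := ler_wpM2l M0 Err; move: E1 G.
rewrite /k1; move: (h * _) (\sum_l _) (stay_wt tt x * _) (look_err _ _) (look_err _ _) (look_err _ _) (b k x)  => *; lra.
Qed.

End Lookahead.

(** * Probabilities of the forcing events *)

Lemma countable_measurable_fun {R : realType} {d} {T : measurableType d} {I : countType}
    (D : set T) (Y : T -> I) (g : I -> R) :
  measurable D -> (forall i, measurable (D `&` [set t | Y t = i])) ->
  measurable_fun D (fun t => g (Y t)).
Proof.
move=> mD mY _ B mB.
rewrite (_ : D `&` _ = \bigcup_(i : I) (if `[< B (g i) >] then D `&` [set t | Y t = i] else set0)).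
  apply: countable_bigcupT_measurable; first exact: countableP.
  by move=> i; case: ifP.
apply/seteqP; split => t /=.
  by move=> [Dt Bt]; exists (Y t) => //; case: asboolP.
by move=> [i _]; case: asboolP => // Bi [Dt /= ->].
Qed.

(** The integral of a nonnegative function is a supremum over simple functions below it, so
    monotonicity needs no measurability. *)
Lemma ge0_le_integral_patch {R : realType} {d} {T : measurableType d}
    (mu : {measure set T -> \bar R}) (D E : set T) (f g : T -> \bar R) :
  (forall x, D x -> (0 <= f x)%E) -> (forall x, E x -> (0 <= g x)%E) ->
  (forall x, D x -> E x /\ (f x <= g x)%E) ->
  (\int[mu]_(x in D) f x <= \int[mu]_(x in E) g x)%E.
Proof.
move=> f0 g0 fg; rewrite !ge0_integralE//.
apply: le_ereal_sup => _ [h /= hf <-]; exists h => // x.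
apply: le_trans (hf x) _; rewrite !patchE; case: ifPn => [/set_mem Dx|_].
  by have [Ex fgx] := fg x Dx; rewrite mem_set.
by case: ifPn => // /set_mem Ex; exact: g0.
Qed.

(** * Regularity in time of the random clocks *)

Section Clock.
Context {R : realType} {K : nat}.
Local Notation L := (bool * 'I_K)%type.
Local Notation St := ('I_K -> nat).
Local Notation mu := (@lebesgue_measure R).
Variables (r : L -> St -> R) (nn C : R).
Hypotheses (r0 : forall l x, 0 <= r l x) (n0 : 0 <= nn) (rC : forall l x, nn * r l x <= C).
Variables (N : L -> R -> nat) (x0 : St) (X : R -> St).
Hypothesis cN : forall l, counting_path (N l).
Hypothesis C0 : 0 < C.

Definition clock l (t : R) := nn * Defs.Rint0 t (fun s => r l (X s)).

Hypothesis XE : forall t i, 0 <= t -> ((X t i)%:R : R) =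
  (x0 i)%:R + (N (true, i) (clock (true, i) t))%:R - (N (false, i) (clock (false, i) t))%:R.
Hypothesis rB : exists B : R, forall l x, r l x <= B.

Let muE (t : R) : 0 <= t -> mu `[0%R, t]%classic = t%:E.
Proof.
move=> t0; rewrite lebesgue_measure_itv/= lte_fin oppr0 addr0.
by case: ltP => // h; congr EFin; apply/eqP; rewrite eq_le t0 h.
Qed.

Let int_fin l (t : R) : 0 <= t -> (\int[mu]_(s in `[0%R, t]) (r l (X s))%:E)%E \is a fin_num.
Proof.
move=> t0; have [B hB] := rB; rewrite ge0_fin_numE; last first.
  by apply: integral_ge0 => s _; rewrite lee_fin.
have h : (\int[mu]_(s in `[0%R, t]) (r l (X s))%:E <= \int[mu]_(s in `[0%R, t]) B%:E)%E.
  apply: ge0_le_integral_patch => [s _|s _|s ?]; rewrite ?lee_fin//.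
  by rewrite (le_trans (r0 l (X s))).
by apply: le_lt_trans h _; rewrite integral_cst// [X in (_ * X)%E]muE// ltry.
Qed.

Lemma clock0 l : clock l 0 = 0.
Proof.
by rewrite /clock /Defs.Rint0 set_itv1 -/(Rintegral _ _ _) Rintegral_set1 mulr0.
Qed.

Lemma clock_mono l (s t : R) : 0 <= s -> s <= t -> clock l s <= clock l t.
Proof.
move=> s0 st; have t0 := le_trans s0 st; rewrite /clock ler_wpM2l// /Defs.Rint0 fine_le ?int_fin//.
apply: ge0_le_integral_patch => x; rewrite ?lee_fin//= in_itv/= => /andP[x0' xs].
by rewrite in_itv/= x0' (le_trans xs st).
Qed.

Let cnt (s : R) : {ffun L -> nat} := [ffun l => N l (clock l s)].

Let X_cnt (s : R) : 0 <= s ->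
  X s = fun i => (x0 i + cnt s (true, i) - cnt s (false, i))%N.
Proof.
move=> s0; apply/funext => i; rewrite !ffunE.
have h : (X s i + N (false, i) (clock (false, i) s) =
  x0 i + N (true, i) (clock (true, i) s))%N.
  by apply/eqP; rewrite -(eqr_nat R) !natrD XE//; apply/eqP; ring.
by rewrite -h addnK.
Qed.

(** Clocks are nondecreasing in time, hence so are the counts, whose level sets are therefore
    intervals. As the state is a function of the counts, the rates along a fixed path are measurable
    in time. *)
Let mcnt (t : R) c : measurable (`[0%R, t]%classic `&` [set s : R | cnt s = c]).
Proof.
rewrite (_ : _ `&` _ = `[0%R, t]%classic `&` \bigcap_(l in [set: L])
    [set s : R | 0 <= s /\ N l (clock l s) = c l]); last first.
  apply/seteqP; split => s /=.
    move=> [st <-]; split => // l _; rewrite ffunE; split => //.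
    by move: st; rewrite in_itv/= => /andP[].
  by move=> [st h]; split => //; apply/ffunP => l; rewrite ffunE; have [] := h l I.
apply: measurableI => //; apply: fin_bigcap_measurable => // l _.
apply: measurable_realfun.is_interval_measurable => u v /= [u0 Nu] [v0 Nv] s /andP[us sv]; split.
  exact: le_trans us.
rewrite -Nu; apply: (counting_squeeze (cN l) (t := clock l v)); last by rewrite Nu.
- by rewrite -(clock0 l) clock_mono.
- exact: clock_mono.
- by apply: clock_mono => //; exact: le_trans us.
Qed.

Let mr l (t : R) : measurable_fun `[0%R, t] (fun s => r l (X s)).
Proof.
have h : measurable_fun `[0%R, t] (fun s => r l (fun i =>
    (x0 i + cnt s (true, i) - cnt s (false, i))%N)).
  apply: (@countable_measurable_fun R _ _ {ffun L -> nat} _ cnt (fun c => r l (fun i =>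
    (x0 i + c (true, i) - c (false, i))%N))) => //; exact: mcnt.
apply: eq_measurable_fun h => s; rewrite inE/= in_itv/= => /andP[s0 _].
by rewrite X_cnt.
Qed.

Let ir l (t : R) : 0 <= t -> mu.-integrable `[0%R, t] (EFin \o (fun s => r l (X s))).
Proof.
move=> t0; apply: measurable_bounded_integrable => //.
- by rewrite [X in (X < _)%E]muE// ltry.
- exact: mr.
have [B hB] := rB; exists B; split; first exact: num_real.
by move=> M BM s _ /=; rewrite ger0_norm// (le_trans (hB l (X s)))// ltW.
Qed.

Let clockB l (s t : R) : 0 <= s -> s <= t -> clock l t = clock l s +
   nn * Rintegral mu `]s, t] (fun v => r l (X v)).
Proof.
move=> s0 st; have t0 := le_trans s0 st; rewrite /clock /Defs.Rint0.
rewrite -(@Rintegral_itvB R (fun v => r l (X v)) (BLeft 0) (BRight t) s) ?bnd_simp//.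
  by rewrite /Rintegral; ring.
exact: ir.
Qed.

Let sub_st (s t : R) : 0 <= s -> `]s, t]%classic `<=` `[0%R, t]%classic.
Proof.
by move=> s0 x /=; rewrite !in_itv/= => /andP[sx ->]; rewrite (le_trans s0 (ltW sx)).
Qed.

Let muE' (s t : R) : s <= t -> fine (mu `]s, t]%classic) = t - s.
Proof.
move=> st; rewrite lebesgue_measure_itv/= lte_fin.
by case: ltP => //= h; apply/eqP; rewrite eq_sym subr_eq0 eq_le st h.
Qed.

Let mufin (s t : R) : (mu `]s, t]%classic < +oo)%E.
Proof. by rewrite lebesgue_measure_itv/=; case: ifP => _; rewrite ?ltry// -EFinB ltry. Qed.

Lemma clock_lip l (s t : R) : 0 <= s -> s <= t -> clock l t <= clock l s + C * (t - s).
Proof.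
move=> s0 st; have t0 := le_trans s0 st; rewrite (clockB l s0 st) lerD2l.
have ic (c : R) : mu.-integrable `]s, t] (EFin \o (fun _ : R => c)).
  apply: measurable_bounded_integrable => //.
    exact: mufin.
  by exists `|c|; split; [exact: num_real|move=> M hM x _ /=; exact: ltW].
have is_ : mu.-integrable `]s, t] (EFin \o (fun s => r l (X s))).
  by apply: integrableS (ir l t0) => //; exact: sub_st.
rewrite -[nn * _]/(nn * Rintegral mu _ _) -RintegralZl//.
rewrite -[t - s](muE' st) -Rintegral_cst//.
apply: le_Rintegral => //.
exact: (@integrableZl _ _ _ mu _ _ nn (fun v => (r l (X v))%:E)%E).
Qed.

Lemma clock_cst l (s t : R) x : 0 <= s -> s <= t ->
  (forall v : R, s <= v -> v < t -> X v = x) ->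
  clock l t = clock l s + (t - s) * (nn * r l x).
Proof.
move=> s0 st h; have t0 := le_trans s0 st; rewrite (clockB l s0 st); congr (_ + _).
have is_ : mu.-integrable `]s, t] (EFin \o (fun s => r l (X s))).
  by apply: integrableS (ir l t0) => //; exact: sub_st.
(* The right endpoint is dropped, since the state is prescribed only before t. *)
rewrite -Rintegral_itv_bndo_bndc; last first.
  apply: integrableS is_ => //; apply: subset_itvl; by rewrite bnd_simp.
rewrite (@eq_Rintegral _ _ _ mu _ (fun=> r l x)); last first.
  by move=> v; rewrite inE/= in_itv/= => /andP[/ltW sv vt]; rewrite h.
rewrite Rintegral_cst//.
have -> : fine (mu `]s, t[%classic) = t - s.
  rewrite lebesgue_measure_itv/= lte_fin.
  by case: ltP => //= h'; apply/eqP; rewrite eq_sym subr_eq0 eq_le st h'.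
ring.
Qed.

End Clock.

Section HasE.
Context {R : realType} {d} {T : measurableType d} (P : probability T R).

(** Measurability is carried along with the value because additivity of the integral relies on it;
    the forcing functionals have it although the path itself need not. *)
Definition hasE (F : T -> R) (v : R) : Prop :=
  [/\ measurable_fun setT F, forall w, 0 <= F w & (\int[P]_w (F w)%:E)%E = v%:E].

Lemma hasE_ext F G v : F =1 G -> hasE F v -> hasE G v.
Proof. by move=> /funext ->. Qed.

Lemma hasE0 : hasE (fun=> 0) 0.
Proof. by split => //; rewrite integral0. Qed.

Lemma hasED F G u v : hasE F u -> hasE G v -> hasE (fun w => F w + G w) (u + v).
Proof.
move=> [mF F0 iF] [mG G0 iG]; split.
- exact: measurable_funD.
- by move=> w; rewrite addr_ge0.
- under eq_integral do rewrite EFinD.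
  rewrite ge0_integralD//; first by rewrite iF iG.
  + by move=> w _; rewrite lee_fin.
  + exact/measurable_EFinP.
  + by move=> w _; rewrite lee_fin.
  + exact/measurable_EFinP.
Qed.

Lemma hasE_sum {I : Type} (s : seq I) (Q : pred I) (F : I -> T -> R) (v : I -> R) :
  (forall i, hasE (F i) (v i)) ->
  hasE (fun w => \sum_(i <- s | Q i) F i w) (\sum_(i <- s | Q i) v i).
Proof.
move=> h; elim: s => [|i s IH].
  by apply: (@hasE_ext (fun=> 0)); [move=> w; rewrite big_nil | rewrite big_nil; exact: hasE0].
rewrite big_cons; case: ifP => Qi; last first.
  by apply: hasE_ext IH => w; rewrite big_cons Qi.
by apply: hasE_ext (hasED (h i) IH) => w; rewrite big_cons Qi.
Qed.

Lemma hasEZ (c : R) F v : 0 <= c -> hasE F v -> hasE (fun w => c * F w) (c * v).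
Proof.
move=> c0 [mF F0 iF]; split.
- exact: measurable_funM.
- by move=> w; rewrite mulr_ge0.
- under eq_integral do rewrite EFinM.
  rewrite ge0_integralZl_EFin//; first by rewrite iF EFinM.
  + by move=> w _; rewrite lee_fin.
  + exact/measurable_EFinP.
Qed.

Lemma hasE_bool (B : T -> bool) : measurable [set w | B w] ->
  hasE (fun w => (B w)%:R) (fine (P [set w | B w])).
Proof.
move=> mB; have e : (fun w => (B w)%:R) = \1_[set w | B w] :> (T -> R).
  by apply/funext => w; rewrite indicE; congr (_%:R); congr nat_of_bool;
    apply/idP/idP => [Bw|/set_mem//]; exact: mem_set.
rewrite e; split => //.
by rewrite integral_indic// setIT fineK// fin_num_measure.
Qed.

End HasE.

(** * Prescribed Poisson counts in consecutive windows *)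

Section Pattern.
Context {R : realType}.
Implicit Types (p : seq (R * nat)) (N : R -> nat) (c : R).

Definition pwt (x : R * nat) : R := expR (- x.1) * x.1 ^+ x.2 / (x.2`!)%:R.

Fixpoint chk N c p : bool :=
  if p is x :: p' then (N (c + x.1) == addn (N c) x.2) && chk N (c + x.1) p' else true.
Definition dur p : R := \sum_(x <- p) x.1.

Lemma chk_rcons N c p x : chk N c (rcons p x) =
  chk N c p && (N (c + dur p + x.1) == addn (N (c + dur p)) x.2).
Proof.
elim: p c => [|y p IH] c; first by rewrite /= /dur big_nil addr0 andbT.
by rewrite /= IH /dur big_cons andbA !addrA.
Qed.

Lemma dur_rcons p x : dur (rcons p x) = dur p + x.1.
Proof. by rewrite /dur -cats1 big_cat/= big_seq1. Qed.

Definition tms c p : seq R := c :: scanl +%R c (map fst p).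

Lemma size_tms c p : size (tms c p) = (size p).+1.
Proof. by rewrite /= size_scanl size_map. Qed.

Lemma tms_ge0 c p : 0 <= c -> all (fun x => 0 <= x.1) p -> all (fun t => 0 <= t) (tms c p).
Proof.
elim: p c => [|x p IH] c c0 /=; first by rewrite c0.
by case/andP => x0 p0; rewrite c0/=; apply: IH => //; exact: addr_ge0.
Qed.

Lemma tms_sorted c p : all (fun x => 0 <= x.1) p -> sorted <=%R (tms c p).
Proof.
elim: p c => [|x p IH] c //= /andP[x0 p0]; rewrite lerDl x0/=; exact: IH.
Qed.

Lemma chkP N c p : counting_path N -> 0 <= c -> all (fun x => 0 <= x.1) p ->
  chk N c p <-> forall j, (j < size p)%N ->
  (N (nth 0%R (tms c p) j.+1) - N (nth 0%R (tms c p) j))%N = (nth (0, 0%N) p j).2.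
Proof.
move=> cN; elim: p c => [|x p IH] c c0; first by split.
move=> /= /andP[x0 p0]; have cx0 : 0 <= c + x.1 by exact: addr_ge0.
have le : leq (N c) (N (c + x.1)) by apply: (counting_le cN) => //; rewrite lerDl.
split.
  move=> /andP[/eqP h1 /(IH _ cx0 p0) h2] [|j] /=; first by rewrite h1 addKn.
  by rewrite ltnS => /h2.
move=> h; apply/andP; split.
  by have := h 0%N isT; rewrite /= => <-; rewrite subnKC.
by apply/(IH _ cx0 p0) => j jp; exact: (h j.+1).
Qed.

Lemma tms_diff c p j : (j < size p)%N ->
  nth 0%R (tms c p) j.+1 - nth 0%R (tms c p) j = (nth (0, 0%N) p j).1.
Proof.
elim: p c j => [|x p IH] c [|j] //=; first by rewrite addrC addKr.
by rewrite ltnS => /(IH (c + x.1)).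
Qed.

End Pattern.

Section PatternProb.
Context {R : realType} {d} {T : measurableType d} (P : probability T R).
Variable N : T -> R -> nat.
Hypothesis pN : rate_one_poisson P N.

Lemma poisson_event_measurable (s t : R) m : measurable [set w | N w s = (N w t + m)%N].
Proof.
have [_ [mN _]] := pN.
rewrite (_ : [set _ | _] = \bigcup_k ([set w | N w s = (k + m)%N] `&` [set w | N w t = k])).
  by apply: bigcup_measurable => k _; apply: measurableI; exact: mN.
apply/seteqP; split => w /=; first by move=> e; exists (N w t).
by move=> [k _ [/= -> ->]].
Qed.

Lemma chk_measurable c p : measurable [set w | chk (N w) c p].
Proof.
elim: p c => [|x p IH] c /=; first by rewrite (_ : [set _ | _] = setT)//; apply/seteqP.
rewrite (_ : [set _ | _] = [set w | N w (c + x.1) = addn (N w c) x.2] `&`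
    [set w | chk (N w) (c + x.1) p]).
  by apply: measurableI => //; exact: poisson_event_measurable.
by apply/seteqP; split => w /=; [move=> /andP[/eqP]|move=> [-> ->]; rewrite eqxx].
Qed.

Lemma chk_cylinder c p : 0 <= c -> all (fun x => 0 <= x.1) p ->
  cylinders N [set w | chk (N w) c p].
Proof.
move=> c0 p0; have [cN _] := pN.
exists (tms c p), (fun v => forall j, (j < size p)%N ->
  (nth 0%N v j.+1 - nth 0%N v j)%N = (nth (0, 0%N) p j).2); split; first exact: tms_ge0.
have nthE w j : (j < size p)%N ->
    nth 0%N (map (N w) (tms c p)) j = N w (nth 0%R (tms c p) j) /\
    nth 0%N (map (N w) (tms c p)) j.+1 = N w (nth 0%R (tms c p) j.+1).
  by move=> jp; split; rewrite (nth_map 0)// size_tms ltnS// ltnW.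
apply/seteqP; split => w.
  move=> /(chkP (cN w) c0 p0) h j jp; have [e1 e2] := nthE w j jp.
  by rewrite e1 e2 h.
move=> h; apply/(chkP (cN w) c0 p0) => j jp; have [e1 e2] := nthE w j jp.
by rewrite -(h j jp) e1 e2.
Qed.

Lemma P_chk c p : 0 <= c -> all (fun x => 0 <= x.1) p ->
  P [set w | chk (N w) c p] = (\prod_(x <- p) pwt x)%:E.
Proof.
move=> c0 p0; have [cN [_ [hP hI]]] := pN.
have tI := hI (tms c p) (tms_ge0 c0 p0) (tms_sorted c p0).
pose E j := if (j < size p)%N then
  [set w | (N w (nth 0%R (tms c p) j.+1) - N w (nth 0%R (tms c p) j))%N = (nth (0, 0%N) p j).2]
  else setT.
have := tI (iota 0 (size p)) E (iota_uniq _ _).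
have hE j : j \in iota 0 (size p) -> (if (j.+1 < size (tms c p))%N then
     [set E0 | exists k, E0 = [set w | (N w (nth 0%R (tms c p) j.+1) - N w (nth 0%R (tms c p) j))%N = k]]
     else [set setT]) (E j).
  rewrite mem_iota add0n => /andP[_ jp]; rewrite size_tms ltnS jp /E jp.
  by exists (nth (0, 0%N) p j).2.
move=> /(_ hE) hh.
rewrite (_ : [set w | chk (N w) c p] = \bigcap_(i in [set` iota 0 (size p)]) E i); last first.
  apply/seteqP; split => w /=.
    move=> /(chkP (cN w) c0 p0) h j /=; rewrite mem_iota add0n => /andP[_ jp].
    by rewrite /E jp /=; exact: h.
  move=> h; apply/(chkP (cN w) c0 p0) => j jp; have := h j.
  by rewrite /= mem_iota add0n jp /E jp => /(_ isT).
rewrite hh (big_nth (0, 0%N)) /index_iota subn0 -prodEFin big_seq [RHS]big_seq.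
apply: eq_bigr => j; rewrite mem_iota add0n => /andP[_ jp].
rewrite /E jp hP.
- by rewrite tms_diff.
- have /allP := tms_ge0 c0 p0; apply; apply: mem_nth.
  by rewrite size_tms ltnS ltnW.
- rewrite -subr_ge0 tms_diff//; have /allP := p0; apply; exact: mem_nth.
Qed.

End PatternProb.

Section Joint.
Context {R : realType} {d} {T : measurableType d} (P : probability T R).
Variables (K : nat) (A D : nat -> T -> R -> nat) (X0 : T -> nat -> nat).
Local Notation L := (bool * 'I_K)%type.
Local Notation St := ('I_K -> nat).
Hypothesis pAD : forall i, (1 <= i <= K)%N -> rate_one_poisson P (A i) /\ rate_one_poisson P (D i).
Hypothesis mX0 : forall i k, measurable [set w | X0 w i = k].
Hypothesis ind : mutually_independent P (indep_classes K A D X0).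

Definition drv (l : L) (w : T) : R -> nat := if l.1 then A l.2.+1 w else D l.2.+1 w.

Lemma drv_poisson l : rate_one_poisson P (drv l).
Proof.
case: l => -[] i; rewrite /drv /=; have /pAD [] : (1 <= i.+1 <= K)%N by rewrite /= ltn_ord.
  by [].
by [].
Qed.

Definition init_at (y : St) : set T := [set w | rst (X0 w) = y].

Lemma init_at_measurable y : measurable (init_at y).
Proof.
rewrite (_ : init_at y = \bigcap_(i in [set: 'I_K]) [set w | X0 w i.+1 = y i]).
  by apply: fin_bigcap_measurable => // i _.
apply/seteqP; split => w /=; first by move=> <- i _.
by move=> h; apply/funext => i; apply: h.
Qed.

Definition pat_ev (pr : L -> seq (R * nat)) : set T :=
  [set w | [forall l, chk (drv l w) 0 (pr l)]].
Definition pat_wt (pr : L -> seq (R * nat)) : R := \prod_l \prod_(x <- pr l) pwt x.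
Definition pat_ok (pr : L -> seq (R * nat)) := forall l, all (fun x => 0 <= x.1) (pr l).

Lemma pat_ev_measurable pr : measurable (pat_ev pr).
Proof.
rewrite (_ : pat_ev pr = \bigcap_(l in [set: L]) [set w | chk (drv l w) 0 (pr l)]).
  by apply: fin_bigcap_measurable => // l _; exact: (chk_measurable (drv_poisson l)).
apply/seteqP; split => w; first by move=> /forallP h l _; exact: h.
by move=> h; apply/forallP => l; exact: h.
Qed.

(** The windows are deterministic, so the initial state and the 2 K counters contribute independent
    events. [lab] translates labels to the index set of the independence hypothesis, in which [None]
    is the initial state. *)
Lemma P_joint y pr : pat_ok pr ->
  P (init_at y `&` pat_ev pr) = (fine (P (init_at y)) * pat_wt pr)%:E.
Proof.
move=> ok.
pose lab (l : L) : option (bool * nat) := Some (l.1, l.2.+1).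
pose E (o : option (bool * nat)) := match o with
  | None => init_at y
  | Some bi => if insub bi.2.-1 is Some j then
      [set w | chk (drv (bi.1, j) w) 0 (pr (bi.1, j))] else setT end.
have Elab l : E (lab l) = [set w | chk (drv l w) 0 (pr l)].
  rewrite /E /lab /= insubT//= => h; case: l h => bo j /= h.
  by set j' := Sub _ _; have -> : j' = j by exact/val_inj.
have lab_inj : injective lab.
  by move=> [b1 j1] [b2 j2] [-> /val_inj ->].
pose s := None :: [seq lab l | l <- enum {: L}].
have us : uniq s.
  rewrite /s /= map_inj_uniq// enum_uniq andbT; apply/negP => /mapP[l _].
  by [].
have hs i : i \in s -> indep_classes K A D X0 i (E i).
  rewrite inE => /predU1P[->|/mapP[l _ ->]].
    exists (fun v => forall j : 'I_K, nth 0%N v j = y j).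
    apply/seteqP; split => w.
      by move=> <- j; rewrite (nth_map 0%N) ?size_iota// nth_iota.
    move=> h; apply/funext => j; rewrite -h (nth_map 0%N) ?size_iota// nth_iota//.
  rewrite Elab; case: l => -[] j /=; rewrite ltn_ord;
    exact: (chk_cylinder (drv_poisson _) (lexx 0) (ok _)).
have := ind us hs.
have -> : \bigcap_(i in [set` s]) E i = init_at y `&` pat_ev pr.
  apply/seteqP; split => w.
    move=> h; split; first by apply: (h None); rewrite /= inE eqxx.
    apply/forallP => l; have := h (lab l); rewrite Elab; apply.
    by rewrite /= inE; apply/orP; right; apply: map_f; rewrite mem_enum.
  move=> [h1 /forallP h2] i /=; rewrite inE => /predU1P[->|/mapP[l _ ->]]//.
  by rewrite Elab; exact: h2.
move=> ->; rewrite /s big_cons big_map big_enum/=.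
rewrite EFinM fineK ?fin_num_measure//; last exact: init_at_measurable.
congr (_ * _)%E; rewrite /pat_wt -prodEFin; apply: eq_bigr => l _.
by rewrite -[RHS](P_chk (drv_poisson l) (lexx 0) (ok l)) -Elab.
Qed.

Section LookProb.
Variables (rate : L -> St -> R) (C h : R) (W : nat -> nat) (Phi : St -> R) (y : St).
Hypotheses (rate0 : forall l x, 0 <= rate l x) (C0 : 0 < C) (h0 : 0 <= h).
Hypothesis Phi0 : forall x, 0 <= Phi x.

Let plk w := plook rate C h W Phi (fun l => drv l w).
Let wlk := wlook rate C h W Phi.
Let app (pr : L -> seq (R * nat)) (e : L -> R * nat) : L -> seq (R * nat) :=
  fun l => rcons (pr l) (e l).
Let clk (pr : L -> seq (R * nat)) : L -> R := fun l => dur (pr l).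
Let IP w pr : R := (`[< init_at y w >] && `[< pat_ev pr w >])%:R.

Let ok_app pr e : pat_ok pr -> (forall l, 0 <= (e l).1) -> pat_ok (app pr e).
Proof. by move=> ok he l; rewrite all_rcons he ok. Qed.

Let wt_app pr e : pat_wt (app pr e) = pat_wt pr * \prod_l pwt (e l).
Proof.
rewrite /pat_wt -big_split; apply: eq_bigr => l _.
by rewrite /app -cats1 big_cat/= big_seq1.
Qed.

Let IP_app w pr e : IP w (app pr e) = IP w pr *
  [forall l, drv l w (clk pr l + (e l).1) == addn (drv l w (clk pr l)) (e l).2]%:R.
Proof.
rewrite /IP -natrM mulnb -andbA; congr ((_ && _)%:R).
apply/asboolP/andP.
  move=> /forallP hh; split.
    by apply/asboolP/forallP => l; have := hh l; rewrite chk_rcons => /andP[].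
  by apply/forallP => l; have := hh l; rewrite chk_rcons add0r => /andP[].
move=> [/asboolP /forallP h1 /forallP h2]; apply/forallP => l.
by rewrite chk_rcons add0r h1 /=; exact: h2.
Qed.

Let hasE_IP pr : pat_ok pr -> hasE P (fun w => IP w pr) (fine (P (init_at y)) * pat_wt pr).
Proof.
move=> ok.
have e : [set w | `[< init_at y w >] && `[< pat_ev pr w >]] = init_at y `&` pat_ev pr.
  apply/seteqP; split => w /=.
    by move=> /andP[/asboolP h1 /asboolP h2].
  by move=> [h1 h2]; apply/andP; split; apply/asboolP.
have := @hasE_bool _ _ _ P (fun w => `[< init_at y w >] && `[< pat_ev pr w >]).
rewrite e P_joint//=; apply.
by apply: measurableI; [exact: init_at_measurable | exact: pat_ev_measurable].
Qed.

(** Along a branch of [look] the guessed clocks are deterministic: they are the total lengths of the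
    windows passed so far. The induction therefore carries the history of the branch as a pattern
    [pr] and appends windows to it, whose probabilities multiply. *)
Lemma hasE_plook J j k x pr : pat_ok pr ->
  hasE P (fun w => IP w pr * plk w J j k x (clk pr))
    (fine (P (init_at y)) * pat_wt pr * wlk J j k x tt).
Proof.
have base J' j' x' pr' : pat_ok pr' ->
    hasE P (fun w => IP w pr' * plk w J' j' 0 x' (clk pr'))
      (fine (P (init_at y)) * pat_wt pr' * wlk J' j' 0 x' tt).
  move=> ok; rewrite /wlk /wlook look0 mulrC.
  by apply: hasE_ext (hasEZ (Phi0 x') (hasE_IP ok)) => w; rewrite /plk /plook look0 mulrC.
pose e1 x' : L -> R * nat := fun l => (h * rate l x', 0%N).
pose e2 x' l0 : L -> R * nat := fun l => (h * rate l x', nat_of_bool (l == l0)).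
pose e3 j' : L -> R * nat := fun l => ((W j')%:R * h * C, 0%N).
have hr l x' : 0 <= h * rate l x' by exact: mulr_ge0.
have stay (V : T -> (L -> R) -> R) v x' pr' : pat_ok pr' ->
    (forall pr'', pat_ok pr'' ->
      hasE P (fun w => IP w pr'' * V w (clk pr'')) (fine (P (init_at y)) * pat_wt pr'' * v)) ->
    hasE P (fun w => IP w pr' *
      (stay_ind rate h (fun l => drv l w) (clk pr') x' * V w (stay_clk rate h (clk pr') x')))
      (fine (P (init_at y)) * pat_wt pr' * (stay_wt rate h tt x' * v)).
  move=> ok IH.
  have := IH (app pr' (e1 x')) (@ok_app _ (e1 x') ok (fun l => hr l x')).
  rewrite wt_app.
  have -> : \prod_l pwt (e1 x' l) = stay_wt rate h tt x'.
    by apply: eq_bigr => l _; rewrite /pwt /= expr0 mulr1 divr1.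
  rewrite -!mulrA; apply: hasE_ext => w; rewrite IP_app -mulrA; congr (_ * _).
  congr (_%:R * _).
    by congr nat_of_bool; apply: eq_forallb => l; rewrite /e1 /= addn0.
  by congr (V _ _); apply/funext => l; rewrite /clk dur_rcons.
have hop (V : T -> (L -> R) -> R) v x' j' l0 pr' : pat_ok pr' ->
    (forall pr'', pat_ok pr'' ->
      hasE P (fun w => IP w pr'' * V w (clk pr'')) (fine (P (init_at y)) * pat_wt pr'' * v)) ->
    hasE P (fun w => IP w pr' *
      (hop_ind rate C h W (fun l => drv l w) j' l0 (clk pr') x' * V w (hop_clk rate C h W j' (clk pr') x')))
      (fine (P (init_at y)) * pat_wt pr' * (hop_wt rate C h W j' l0 tt x' * v)).
  move=> ok IH.
  have ok2 : pat_ok (app (app pr' (e2 x' l0)) (e3 j')).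
    apply: ok_app; first by apply: ok_app => // l; exact: hr.
    by move=> l; rewrite /= !mulr_ge0// ltW.
  have := IH _ ok2.
  rewrite !wt_app.
  have -> : pat_wt pr' * (\prod_l pwt (e2 x' l0 l)) * (\prod_l pwt (e3 j' l)) =
      pat_wt pr' * hop_wt rate C h W j' l0 tt x'.
    rewrite -mulrA; congr (_ * (_ * _)); apply: eq_bigr => l _; rewrite /pwt /=.
      by case: (l == l0); rewrite /= divr1.
    by rewrite expr0 mulr1 divr1.
  rewrite -!mulrA; apply: hasE_ext => w; rewrite !IP_app -!mulrA; congr (_ * _).
  rewrite mulrA -natrM mulnb; congr (_%:R * _).
    congr nat_of_bool; congr (_ && _).
    by apply: eq_forallb => l; rewrite /clk dur_rcons /e3 /e2 /= addn0.
  by congr (V _ _); apply/funext => l; rewrite /clk !dur_rcons.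
elim: J j k x pr => [|J IHJ] j; elim=> [|k IHk] x pr ok; try exact: base.
  rewrite /wlk /wlook look0S -/wlook.
  apply: hasE_ext (stay (fun w c => plk w 0%N j k x c) _ x pr ok (IHk x)) => w.
  by rewrite /plk /plook look0S.
rewrite /wlk /wlook lookSS mulrDr.
have H1 := stay (fun w c => plk w J.+1 j k x c) _ x pr ok (IHk x).
case: (leqP (W j) k.+1) => Wk.
  have H2 := hasE_sum (index_enum _) xpredT (fun l => hop
    (fun w c => plk w J j.+1 (k.+1 - W j)%N (mv l x) c) _ x j l pr ok (IHJ j.+1 _ (mv l x))).
  rewrite -mulr_sumr in H2.
  apply: hasE_ext (hasED H1 H2) => w.
  by rewrite /plk /plook lookSS Wk mulrDr mulr_sumr.
rewrite mulr0 addr0; apply: hasE_ext H1 => w.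
by rewrite /plk /plook lookSS leqNgt Wk /= addr0.
Qed.

Lemma int_plook J k x : (\int[P]_w ((`[< init_at y w >])%:R * plk w J 0 k x (fun=> 0))%:E)%E =
  (fine (P (init_at y)) * wlk J 0 k x tt)%:E.
Proof.
have ok : pat_ok (fun=> [::]) by [].
have [_ _] := hasE_plook J 0 k x ok.
have -> : pat_wt (fun=> [::]) = 1 by rewrite /pat_wt big1// => l _; rewrite big_nil.
rewrite mulr1 => <-; apply: eq_integral => w _; rewrite /IP.
have -> : `[< pat_ev (fun=> [::]) w >] = true by apply/asboolP/forallP.
rewrite andbT; congr ((_ * _)%:E); congr (plk _ _ _ _ _ _).
by apply/funext => l; rewrite /clk /dur big_nil.
Qed.

End LookProb.
End Joint.

(** * Convergence for fixed n *)

(** A recursion solves these inequalities because [lead] at j involves only the values of [W] below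
    j. *)
Lemma lead_exists {R : realType} (C rmin : R) :
  exists W : nat -> nat, forall j, lead C W j / rmin + 1 <= (W j)%:R.
Proof.
pose wn (x : R) := (Num.truncn (x / rmin + 1)).+1.
pose v := fix v j := if j is j'.+1 then v j' + C + (wn (v j'))%:R * C else 0 : R.
exists (fun j => wn (v j)) => j.
have -> : lead C (fun j => wn (v j)) j = v j by elim: j => //= j ->.
by apply/ltW; rewrite truncnS_gt.
Qed.

Section Binomial.
Context {R : realType} {I : finType} (lam nu beta c h : R).
Implicit Types (u v : (I -> nat) -> R) (y : I -> nat).
Local Notation G := (queue_gen lam nu beta).
Local Notation Qit := (Qqiter lam nu beta c).

(* For [h * c <= 1] an Euler step of size [h] mixes the identity with one step of [Qqueue],
   so [k] Euler steps average [Qqiter] over a binomial number of steps. *)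
Definition Bstep u y : R := u y + h * G u y.
Definition Bit k u := iter k Bstep u.

Lemma queue_gen_lin s t u v y : G (fun z => s * u z + t * v z) y = s * G u y + t * G v y.
Proof.
rewrite /queue_gen !mulr_sumr -big_split/=; apply: eq_bigr => j _; ring.
Qed.

Lemma Bit_lin k s t u v y :
  Bit k (fun z => s * u z + t * v z) y = s * Bit k u y + t * Bit k v y.
Proof.
elim: k y => [//|k IH] y; rewrite /Bit /= -!/(Bit k _) /Bstep.
have -> : Bit k (fun z => s * u z + t * v z) = fun z => s * Bit k u z + t * Bit k v z.
  by apply/funext => z; exact: IH.
by rewrite queue_gen_lin; ring.
Qed.

Hypotheses (c0 : 0 < c) (h0 : 0 <= h) (hc : h * c <= 1).
Variables (u : (I -> nat) -> R) (y : I -> nat) (L e B : R) (J : nat).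
Hypotheses (e0 : 0 <= e) (B0 : 0 <= B).
Hypothesis Qsmall : forall j, (J <= j)%N -> `|Qit j u y - L| <= e.
Hypothesis Qbnd : forall j, `|Qit j u y - L| <= B.

Lemma Bit_mix k j : Bit k.+1 (Qit j u) y =
  (1 - h * c) * Bit k (Qit j u) y + h * c * Bit k (Qit j.+1 u) y.
Proof.
rewrite -Bit_lin {1}/Bit iterSr -/(Bit k _); congr (Bit k _ y); apply/funext => z.
rewrite /Bstep /= /Qqueue; field; exact: lt0r_neq0.
Qed.

(** A Chernoff bound: if N is the binomial number of [Qqiter] steps, the event j + N < J has
    probability at most 2^(J - j) times the mean of 2^-N, and this mean is (1 - h c / 2)^k. *)
Lemma Bit_close_gen k j :
  `|Bit k (Qit j u) y - L| <= e + B * 2 ^+ J / 2 ^+ j * (1 - h * c / 2) ^+ k.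
Proof.
have hc0 : 0 <= h * c by rewrite mulr_ge0// ltW.
elim: k j => [|k IH] j.
  rewrite expr0 mulr1 /Bit /=; have [Jj|jJ] := leqP J j.
    apply: (le_trans (Qsmall Jj)); rewrite lerDl !mulr_ge0// ?invr_ge0 exprn_ge0//.
  apply: (le_trans (Qbnd j)); rewrite -[leLHS]add0r lerD// -mulrA ler_peMr//.
  by rewrite ler_pdivlMr ?exprn_gt0// mul1r ler_weXn2l ?ler1n// ltnW.
rewrite Bit_mix.
have -> : (1 - h * c) * Bit k (Qit j u) y + h * c * Bit k (Qit j.+1 u) y - L =
  (1 - h * c) * (Bit k (Qit j u) y - L) + h * c * (Bit k (Qit j.+1 u) y - L) by ring.
apply: le_trans (ler_normD _ _) _; rewrite (normrM (1 - h * c)) (normrM (h * c)) (ger0_norm hc0).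
rewrite (ger0_norm (_ : 0 <= 1 - h * c)) ?subr_ge0//.
have h1 : 0 <= 1 - h * c by rewrite subr_ge0.
apply: le_trans (lerD (ler_wpM2l h1 (IH j)) (ler_wpM2l hc0 (IH j.+1))) _.
rewrite le_eqVlt; apply/orP; left; apply/eqP; rewrite (exprS _ k) (exprS _ j).
by field; exact: expf_neq0.
Qed.

Lemma Bit_close k : `|Bit k u y - L| <= e + B * 2 ^+ J * (1 - h * c / 2) ^+ k.
Proof. by have := Bit_close_gen k 0; rewrite expr0 divr1. Qed.

End Binomial.

Section Queue.
Context {R : realType} {d} {T : measurableType d} (P : probability T R).
Variables (K n : nat) (a b : R) (A D : nat -> T -> R -> nat) (X0 : T -> nat -> nat).
Variable X : T -> R -> nat -> nat.
Hypotheses (K2 : (2 <= K)%N) (a0 : 0 <= a) (b0 : 0 < b) (hn : a ^+ 2 < n%:R).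
Hypothesis pAD : forall i, (1 <= i <= K)%N -> rate_one_poisson P (A i) /\ rate_one_poisson P (D i).
Hypothesis mX0 : forall i k, measurable [set w | X0 w i = k].
Hypothesis ordX0 : forall w i, (1 <= i < K)%N -> (X0 w i <= X0 w i.+1)%N.
Hypothesis ind : mutually_independent P (indep_classes K A D X0).
Hypothesis sol : solves_queue K n a b A D X0 X.
Local Notation L := (bool * 'I_K)%type.
Local Notation St := ('I_K -> nat).
Local Notation q := (Num.sqrt (n%:R : R)).
Local Notation lm := (lam a q).
Local Notation nu := (q ^+ 2).
Local Notation beta := (b * q).
Local Notation C := (Cmax K n a b).

Let npos : 0 < n%:R :> R.
Proof. by apply: le_lt_trans hn; exact: sqr_ge0. Qed.

Lemma ext_rst x i : (1 <= i <= K)%N -> ext (@rst K x) i = x i.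
Proof. by case: i => // i /andP[_ iK]; rewrite -[i.+1]/((Ordinal iK).+1) extE. Qed.

Lemma qrk_rst l x : qrk n a b l (@rst K x) =
  n%:R * (if l.1 then alpha_c K n a b x l.2.+1 * up_ind K x l.2.+1
          else delta_c K x l.2.+1 * down_ind x l.2.+1).
Proof.
have e i : (1 <= i < K.+1)%N -> ext (@rst K x) i = x i by exact: ext_rst.
have ei (i : 'I_K) : ext (@rst K x) i.+1 = x i.+1 by apply: e; rewrite /= ltnS.
case: l => -[] i; rewrite /qrk /=; congr (_ * (_ * _)).
- by rewrite /alpha_c; apply: eq_big_nat => j /e ->; rewrite ei.
- rewrite /up_ind; case: eqP => // iK; rewrite ei e//= ltnS ltn_neqAle ltn_ord andbT.
  exact/eqP.
- by rewrite /delta_c; apply: eq_big_nat => j /e ->; rewrite ei.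
- rewrite /down_ind eqSS; case: eqP => i1 /=; first by rewrite e//= ltnS ltnW.
  have hi : (0 < i < K.+1)%N.
    by apply/andP; split; [rewrite lt0n; exact/eqP | rewrite ltnS ltnW].
  by rewrite ei (e _ hi).
Qed.

Let r (l : L) (x : St) : R := n%:R^-1 * qrk n a b l x.
Let nr l x : n%:R * r l x = qrk n a b l x.
Proof. by rewrite /r mulVKf// gt_eqF. Qed.
Let r0 l x : 0 <= r l x.
Proof. by rewrite mulr_ge0 ?invr_ge0//; exact: qrk_ge0. Qed.
Let Xs (w : T) (t : R) : St := @rst K (X w t).

Let rB : exists B : R, forall l x, r l x <= B.
Proof.
exists (n%:R^-1 * C) => l x; rewrite ler_wpM2l ?invr_ge0//; exact: qrk_le.
Qed.

Let rC l x : n%:R * r l x <= C.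
Proof. rewrite nr; exact: qrk_le. Qed.

Lemma Cmax_gt0 : 0 < C.
Proof.
have l0 := lm_gt0 a0 hn; rewrite /Cmax; apply: ltr_wpDl.
  by rewrite addr_ge0// mulr_ge0 ?exprn_ge0 ?sqrtr_ge0// ltW.
by rewrite mulr_gt0// sqrtr_gt0.
Qed.

Let tau w := clock r n%:R (Xs w).

Let XE w t i : 0 <= t -> ((Xs w t i)%:R : R) =
  (@rst K (X0 w) i)%:R + (drv A D (true, i) w (tau w (true, i) t))%:R
   - (drv A D (false, i) w (tau w (false, i) t))%:R.
Proof.
move=> t0; have iK : (1 <= i.+1 <= K)%N by rewrite /= ltn_ord.
rewrite {1}/Xs /rst (sol w t0 iK) /drv /=.
congr (_ + (A _ _ (_ * _))%:R - (D _ _ (_ * _))%:R); congr fine; apply: eq_integral => s _;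
  by rewrite /r /Xs qrk_rst /= mulKf// gt_eqF.
Qed.

Lemma look_pathwise (h : R) (W : nat -> nat) (Phi : St -> R) J k w : 0 <= h ->
  (forall x, 0 <= Phi x) -> (forall j, lead C W j / lm + 1 <= (W j)%:R) ->
  plook (qrk n a b) C h W Phi (fun l => drv A D l w) J 0 k (@rst K (X0 w)) (fun=> 0) <=
  Phi (@rst K (X w (k%:R * h))).
Proof.
move=> h0 Phi0 hW.
have cN (l : L) : counting_path (drv A D l w) by have [] := drv_poisson pAD l.
have cX t i := @XE w t i.
have t0 (l : L) : tau w l 0 = 0 by exact: clock0.
have t1 (l : L) (s t : R) : 0 <= s -> s <= t -> tau w l s <= tau w l t.
  by move=> s0 st; apply: clock_mono.
have t2 (l : L) (s t : R) : 0 <= s -> s <= t -> tau w l t <= tau w l s + C * (t - s).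
  move=> s0 st; apply: (clock_lip r0 (ltW npos) rC cN cX rB) => //.
have t3 (l : L) (s t : R) (x : St) : 0 <= s -> s <= t -> (forall v : R, s <= v -> v < t -> Xs w v = x) ->
    tau w l t = tau w l s + (t - s) * qrk n a b l x.
  by move=> s0 st hx; rewrite -nr; apply: (clock_cst r0 (ltW npos) cN cX rB).
have := @plook_le _ _ (qrk n a b) C lm h W Phi (qrk_ge0 a0 b0 hn) (qrk_le K2 a0 b0 hn)
  Cmax_gt0 (lm_gt0 a0 hn) h0 Phi0 (qrk_min a0 b0 hn) hW _ _ _ _ cN t0 t1 t2 t3 cX
  J 0 k 0 (@rst K (X0 w)) (fun=> 0).
rewrite add0r; apply; split => //.
- apply/funext => i; apply/eqP; rewrite -(eqr_nat R) cX// !t0.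
  by have [N0 _] := cN (true, i); have [N0' _] := cN (false, i); rewrite N0 N0' addr0 subr0.
- by move=> l; rewrite t0 /= mulr0 addr0.
Qed.

Section Bound.
Variables (c M Lim : R) (Phi Psi : St -> R).
Hypotheses (c0 : 0 < c) (Phi0 : forall x, 0 <= Phi x) (PhiM : forall x, Phi x <= M).
Hypothesis sPsi : sym Psi.
Hypothesis PsiE : forall x, ordered x -> Psi x = Phi x.
Hypothesis QL : forall y, Qqiter lm nu beta c k Psi y @[k --> \oo] --> Lim.
Local Notation Rb := (#|{: L}|%:R * C).
Let M0 : 0 <= M. Proof. exact: le_trans (Phi0 (fun=> 0%N)) (PhiM _). Qed.

Lemma Bit_sym h k : sym (Bit lm nu beta h k Psi).
Proof.
elim: k => [//|k IH] s y; rewrite /Bit /= -!/(Bit lm nu beta h k Psi) /Bstep IH.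
by rewrite sym_queue_gen.
Qed.

(** The time t0 depends on y and e but not on the discretization, as it has to serve all later t.
    Given t, the jump budget [Jt], the quiet stretches [W] and the number k of steps are chosen in
    this order. The four errors are each at most e / 4. *)
Lemma wlook_lower (y : St) (e : R) : ordered y -> 0 < e -> exists t0 : R, 0 < t0 /\ forall t, t0 <= t ->
  exists (h : R) (W : nat -> nat) (J k : nat), [/\ 0 <= h, t = k%:R * h,
    (forall j, lead C W j / lm + 1 <= (W j)%:R) &
    Lim - e <= wlook (qrk n a b) C h W Phi J 0 k y tt].
Proof.
move=> oy e0; pose e4 := e / 4.
have e40 : 0 < e4 by rewrite divr_gt0.
have [J1 _ hJ1] := (@cvgrPdist_le _ _ _ _ _ _ _).1 (QL y) _ e40.
pose B := e4 + \sum_(i < J1) `|Qqiter lm nu beta c i Psi y - Lim|.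
have B0 : 0 <= B by rewrite addr_ge0 ?(ltW e40)// sumr_ge0.
have hB j : `|Qqiter lm nu beta c j Psi y - Lim| <= B.
  have [J1j|jJ1] := leqP J1 j.
    by rewrite distrC (le_trans (hJ1 j J1j))// lerDl sumr_ge0.
  rewrite /B (bigD1 (Ordinal jJ1))//= addrCA lerDl addr_ge0 ?(ltW e40)// sumr_ge0//.
have C0 := Cmax_gt0.
have Rb0 : 0 <= Rb by rewrite mulr_ge0// ltW.
have [t0 [t00 ht0]] : exists t0 : R, 0 < t0 /\
    forall t, t0 <= t -> B * 2 ^+ J1 * expR (- (t * c / 2)) <= e4.
  pose A1 := B * 2 ^+ J1; have A10 : 0 <= A1 by rewrite mulr_ge0// exprn_ge0.
  exists ((A1 / e4 + 1) * 2 / c); split; first by rewrite divr_gt0// mulr_gt0// ltr_wpDl// divr_ge0// ltW.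
  move=> t ht; rewrite expRN ler_pdivrMr ?expR_gt0// -ler_pdivrMl//.
  have h1 : A1 / e4 <= t * c / 2.
    have : (A1 / e4 + 1) * 2 / c * c <= t * c by rewrite ler_wpM2r// ltW.
    by rewrite divfK ?gt_eqF//; lra.
  have := expR_ge1Dx (t * c / 2); rewrite mulrC -/A1; lra.
exists t0; split => // t ht; have tp : 0 < t by exact: lt_le_trans ht.
have [Jt hJt] : exists Jt, M * (2 ^- Jt * expR (Rb * t)) <= e4.
  pose A1 := M * expR (Rb * t); have A10 : 0 <= A1 by rewrite mulr_ge0// expR_ge0.
  exists (Num.truncn (A1 / e4)).+1.
  rewrite mulrCA -/A1 ler_pdivrMl ?exprn_gt0//.
  rewrite -ler_pdivrMr//; apply: ltW; apply: lt_trans (truncnS_gt _) _.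
  by rewrite -natrX ltr_nat ltn_expl.
have [W hW] := lead_exists C lm.
pose Wb := \max_(j < Jt) W j.
pose A1 := 2 * Wb%:R * Rb ^+ 2 * t ^+ 2 + Wb%:R * (Rb * t).
have A10 : 0 <= A1.
  apply: addr_ge0; last by rewrite mulr_ge0// mulr_ge0// ltW.
  by apply: mulr_ge0; [apply: mulr_ge0 => //; exact: exprn_ge0 | exact: sqr_ge0].
(* The three summands ensure in turn that the discretization error is at most e / 4, that h Rb <= 1
   and that h c <= 1. *)
pose k := (Num.truncn (M * A1 / e4 + Rb * t + c * t)).+1.
have hk : M * A1 / e4 + Rb * t + c * t < k%:R by exact: truncnS_gt.
have kp : 0 < k%:R :> R by rewrite ltr0n.
have p1 : 0 <= M * A1 / e4 by rewrite divr_ge0 ?(ltW e40)// mulr_ge0.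
have p2 : 0 <= Rb * t by rewrite mulr_ge0// ltW.
have p3 : 0 <= c * t by rewrite mulr_ge0// ltW.
pose h := t / k%:R.
have h0 : 0 <= h by rewrite divr_ge0// ltW.
have kh : k%:R * h = t by rewrite /h mulrC divfK// gt_eqF.
exists h, W, Jt, k; split => //.
have hR1 : h * Rb <= 1.
  by rewrite /h mulrAC ler_pdivrMr// mul1r mulrC; lra.
have hc : h * c <= 1.
  by rewrite /h mulrAC ler_pdivrMr// mul1r mulrC; lra.
have Wb_ge j : (j < Jt)%N -> (W j <= Wb)%N.
  by move=> jJ; apply: (@leq_bigmax _ (fun i : 'I_Jt => W i) (Ordinal jJ)).
have bS m x : ordered x -> Bit lm nu beta h m.+1 Psi x = Bit lm nu beta h m Psi x +
    h * jump (qrk n a b) (@mv K) (Bit lm nu beta h m Psi) x.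
  by move=> ox; rewrite rank_gen_sym//; exact: Bit_sym.
have W1 := wlook_ge (qrk_ge0 a0 b0 hn) (qrk_le K2 a0 b0 hn) C0 (lm_gt0 a0 hn) h0 Phi0 hW
  PhiM (fun l x => @ordered_mv _ _ _ _ _ K2 a0 b0 hn l x) PsiE bS hR1 Wb_ge
  k oy (add0n Jt).
apply: le_trans W1.
have Qs j : (J1 <= j)%N -> `|Qqiter lm nu beta c j Psi y - Lim| <= e4.
  by move=> hj; rewrite distrC; exact: hJ1.
have b1 := Bit_close c0 h0 hc (ltW e40) B0 Qs hB k.
have hc2 : 0 <= 1 - h * c / 2 by move: hc; lra.
have b2 : (1 - h * c / 2) ^+ k <= expR (- (t * c / 2)).
  apply: (@le_trans _ _ (expR (- (h * c / 2)) ^+ k)).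
    by rewrite lerXn2r ?nnegrE ?expR_ge0// expR_ge1Dx.
  by rewrite -expRM_natl -kh le_eqVlt; apply/orP; left; apply/eqP; congr expR; ring.
have b3 : B * 2 ^+ J1 * (1 - h * c / 2) ^+ k <= e4.
  by apply: le_trans (ht0 t ht); rewrite ler_wpM2l// mulr_ge0// exprn_ge0.
have b4 : M * (2 ^- Jt * (1 + h * Rb) ^+ k) <= e4.
  apply: le_trans hJt; rewrite ler_wpM2l// ler_wpM2l ?invr_ge0 ?exprn_ge0//.
  apply: (@le_trans _ _ (expR (h * Rb) ^+ k)).
    rewrite lerXn2r ?nnegrE ?expR_ge0// ?expR_ge1Dx// addr_ge0// mulr_ge0//.
  by rewrite -expRM_natl -kh le_eqVlt; apply/orP; left; apply/eqP; congr expR; ring.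
have b5 : M * (2 * Wb%:R * Rb ^+ 2 * (k%:R * h ^+ 2) + (minn k Wb)%:R * (h * Rb)) <= e4.
  apply: (@le_trans _ _ (M * A1 / k%:R)); last first.
    by rewrite ler_pdivrMr// (mulrC e4) -ler_pdivrMr//; lra.
  rewrite -(mulrA M); apply: (ler_wpM2l M0); rewrite /A1 (mulrDl _ _ (k%:R^-1)); apply: lerD.
    by rewrite le_eqVlt; apply/orP; left; apply/eqP; rewrite /h; field; rewrite gt_eqF.
  rewrite /h (_ : Wb%:R * (Rb * t) / k%:R = Wb%:R * (t / k%:R * Rb)); last by ring.
  by apply: ler_wpM2r; [exact: mulr_ge0 h0 Rb0 | rewrite ler_nat geq_minr].
have b6 : M * @look_err R K C h Wb Jt k <= e4 + e4.
  by rewrite /look_err -addrA (mulrDr M (2 ^- Jt * _)); exact: lerD.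
have ee : e = 4 * e4 by rewrite /e4; field.
move: b1; rewrite ler_norml => /andP[b1 _].
move: (M * @look_err _ _ _ _ _ _ _) (B * _ * _) (Bit _ _ _ _ _ _ _) b6 b3 b1 => x1 x2 x3 b6 b3 b1.
by rewrite ee; lra.
Qed.

(** Integrates the pathwise bound over the event of one initial state; an unordered one is excluded
    by [ordX0]. *)
Lemma lower_at (y : St) (e : R) : 0 < e -> exists t0 : R, forall t, t0 <= t ->
  ((fine (P (init_at X0 y)) * (Lim - e))%:E <=
   \int[P]_w ((`[< init_at X0 y w >])%:R * Phi (@rst K (X w t)))%:E)%E.
Proof.
move=> e0; have [oy|noy] := pselect (ordered y); last first.
  exists 0 => t _; rewrite (_ : init_at X0 y = set0).
    by rewrite measure0 mul0r; apply: integral_ge0 => w _; rewrite lee_fin mulr_ge0.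
  apply/seteqP; split => // w /= e1; apply: noy => i j ij; rewrite -e1 /rst.
  have : (j.+1 <= K)%N by [].
  rewrite -(subnKC ij); elim: (j - i)%N => [|m IH]; first by rewrite addn0.
  rewrite addnS => hm; apply: leq_trans (IH (ltnW hm)) _; apply: ordX0.
  by rewrite /=.
have [t0 [t00 ht0]] := wlook_lower oy e0.
exists t0 => t /ht0 [h [W [J [k [h0 tE hW hl]]]]].
apply: (@le_trans _ _ (fine (P (init_at X0 y)) * wlook (qrk n a b) C h W Phi J 0 k y tt)%:E).
  by rewrite lee_fin ler_wpM2l// fine_ge0.
rewrite -(int_plook pAD mX0 ind W y (qrk_ge0 a0 b0 hn) Cmax_gt0 h0 Phi0 J k y).
apply: ge0_le_integral_patch => [w _|w _|w _].
- by rewrite lee_fin mulr_ge0//; apply: look_ge0.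
- by rewrite lee_fin mulr_ge0.
- split => //; rewrite lee_fin; case: asboolP => [iw|_]; last by rewrite !mul0r.
  rewrite !mul1r -iw tE; exact: look_pathwise.
Qed.

End Bound.
End Queue.

Import HBNNSimple.

(** * Lower integrals of possibly nonmeasurable functions *)

Section Super.
Context {R : realType} {d} {T : measurableType d} (P : probability T R).
Implicit Types F G : T -> R.

Lemma int_le_cst F (M : R) : (forall w, 0 <= F w) -> (forall w, F w <= M) ->
  (\int[P]_w (F w)%:E <= M%:E)%E.
Proof.
move=> F0 FM; have -> : M%:E = (\int[P]_(w in setT) M%:E)%E.
  by rewrite integral_cst// [X in (_ * X)%E]probability_setT mule1.
by apply: ge0_le_integral_patch => // w _; rewrite lee_fin// (le_trans (F0 w)).
Qed.

Lemma int_fin_num F (M : R) : (forall w, 0 <= F w) -> (forall w, F w <= M) ->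
  (\int[P]_w (F w)%:E)%E \is a fin_num.
Proof.
move=> F0 FM; rewrite ge0_fin_numE; last by apply: integral_ge0 => w _; rewrite lee_fin.
by apply: le_lt_trans (int_le_cst F0 FM) _; rewrite ltry.
Qed.

(* Without measurability the integral is only a lower integral. *)
Lemma integral_superadd F G (M : R) : (forall w, 0 <= F w) -> (forall w, 0 <= G w) ->
  (forall w, F w + G w <= M) ->
  (\int[P]_w (F w)%:E + \int[P]_w (G w)%:E <= \int[P]_w (F w + G w)%:E)%E.
Proof.
move=> F0 G0 FGM.
have FM w : F w <= M by apply: le_trans (FGM w); rewrite lerDl.
have GM w : G w <= M by apply: le_trans (FGM w); rewrite lerDr.
have iG := int_fin_num G0 GM.
rewrite -leeBrDr// [X in (X <= _)%E]ge0_integralE => [|w _]; last by rewrite lee_fin.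
apply: ge_ereal_sup => _ [h1 /= hh1 <-].
have h1F w : ((h1 w)%:E <= (F w)%:E)%E.
  by have := hh1 w; rewrite patchE in_setT.
have fh1 : sintegral P h1 \is a fin_num.
  rewrite ge0_fin_numE ?sintegral_ge0//; apply: le_lt_trans (ltry M).
  apply: le_trans (int_le_cst F0 FM).
  rewrite ge0_integralE => [|w _]; last by rewrite lee_fin.
  by apply: ereal_sup_ubound; exists h1.
rewrite leeBrDr// addeC -leeBrDr// [X in (X <= _)%E]ge0_integralE => [|w _]; last by rewrite lee_fin.
apply: ge_ereal_sup => _ [h2 /= hh2 <-].
have h2G w : ((h2 w)%:E <= (G w)%:E)%E.
  by have := hh2 w; rewrite patchE in_setT.
rewrite leeBrDr// -sintegralD.
rewrite ge0_integralE => [|w _]; last by rewrite lee_fin addr_ge0.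
apply: ereal_sup_ubound; exists (add_nnsfun h2 h1) => // w.
rewrite patchE in_setT/= -[leLHS]/((h2 w + h1 w)%:E) lee_fin addrC lerD// -lee_fin.
- exact: h1F.
- exact: h2G.
Qed.

Lemma integral_superadd_sum {I : Type} (s : seq I) (F : I -> T -> R) (M : R) :
  (forall i w, 0 <= F i w) -> (forall w, \sum_(i <- s) F i w <= M) ->
  (\sum_(i <- s) \int[P]_w (F i w)%:E <= \int[P]_w (\sum_(i <- s) F i w)%:E)%E.
Proof.
move=> F0; elim: s => [|i s IH] hM.
  by rewrite big_nil; apply: integral_ge0 => w _; rewrite big_nil.
rewrite big_cons.
have h w : \sum_(j <- s) F j w <= M.
  by apply: le_trans (hM w); rewrite big_cons lerDr.
have -> : (fun w => (\sum_(j <- i :: s) F j w)%:E) = fun w => (F i w + \sum_(j <- s) F j w)%:E.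
  by apply/funext => w; rewrite big_cons.
apply: le_trans (@integral_superadd (F i) (fun w => \sum_(j <- s) F j w) M _ _ _) => //.
- by apply: leeD2l; exact: IH.
- by move=> w; apply: sumr_ge0.
- by move=> w; have := hM w; rewrite big_cons.
Qed.

End Super.

Section Expect.
Context {R : realType} {d} {T : measurableType d} (P : probability T R).
Variables (K n : nat) (a b : R) (A D : nat -> T -> R -> nat) (X0 : T -> nat -> nat).
Variable X : T -> R -> nat -> nat.
Hypotheses (K2 : (2 <= K)%N) (a0 : 0 <= a) (b0 : 0 < b) (hn : a ^+ 2 < n%:R).
Hypothesis pAD : forall i, (1 <= i <= K)%N -> rate_one_poisson P (A i) /\ rate_one_poisson P (D i).
Hypothesis mX0 : forall i k, measurable [set w | X0 w i = k].
Hypothesis ordX0 : forall w i, (1 <= i < K)%N -> (X0 w i <= X0 w i.+1)%N.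
Hypothesis ind : mutually_independent P (indep_classes K A D X0).
Hypothesis sol : solves_queue K n a b A D X0 X.
Local Notation St := ('I_K -> nat).
Local Notation q := (Num.sqrt (n%:R : R)).
Local Notation Qit c := (Qqiter (lam a q) (q ^+ 2) (b * q) c).
Variable c : R.
Hypothesis c0 : 0 < c.

Lemma init_mass (e : R) : 0 < e -> exists m,
  1 - e <= \sum_(y : {ffun 'I_K -> 'I_m}) fine (P (init_at X0 (fun i => y i))).
Proof.
move=> e0.
pose U m := [set w | forall i : 'I_K, (X0 w i.+1 < m)%N].
have UE m : U m = \bigcup_(y in [set: {ffun 'I_K -> 'I_m}]) init_at X0 (fun i => y i).
  apply/seteqP; split => w /=.
    move=> h; exists [ffun i => Ordinal (h i)] => //; apply/funext => i.
    by rewrite ffunE.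
  by move=> [y _ hy] i; have := congr1 (fun f => f i) hy; rewrite /rst => ->.
have mI m (y : {ffun 'I_K -> 'I_m}) : measurable (init_at X0 (fun i => y i)).
  exact: init_at_measurable.
have mU m : measurable (U m).
  by rewrite UE; apply: fin_bigcup_measurable.
have UT : \bigcup_m U m = setT.
  apply/seteqP; split => // w _; exists (\max_(i < K) X0 w i.+1).+1 => // i.
  by rewrite ltnS; exact: (@leq_bigmax _ (fun i : 'I_K => X0 w i.+1)).
have ndU : nondecreasing_seq U.
  move=> m m' mm; apply/subsetPset => w h i; exact: leq_trans (h i) mm.
have mUT : measurable (\bigcup_m U m) by rewrite UT.
have PT : P (\bigcup_m U m) = 1%E by rewrite UT; exact: probability_setT.
have hcv : P (U m) @[m --> \oo] --> 1%E.
  rewrite (_ : 1%E = P (\bigcup_m U m)); first exact: (nondecreasing_cvg_mu mU mUT ndU).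
  exact: esym PT.
have fcv : fine (P (U m)) @[m --> \oo] --> (1 : R).
  exact: (fine_cvg hcv).
have [m _ hm] := (@cvgrPdist_le _ _ _ _ _ _ _).1 fcv _ e0.
exists m; have := hm m (leqnn m); rewrite ler_norml => /andP[_ h].
suff -> : \sum_(y : {ffun 'I_K -> 'I_m}) fine (P (init_at X0 (fun i => y i))) = fine (P (U m)).
  by move: h; lra.
rewrite UE measure_fin_bigcup//; first last.
- move=> y z _ _ [w [/= hy hz]]; apply/ffunP => i; apply/val_inj.
  by have := congr1 (fun f => f i) (etrans (esym hy) hz).
- exact: finite_finset.
rewrite sum_fine => [|y _]; last exact: fin_num_measure.
congr fine; rewrite (@fsbigE _ _ _ _ _ (index_enum {ffun 'I_K -> 'I_m})) ?index_enum_uniq//=.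
  by apply: eq_bigl => y; rewrite in_setT.
by move=> y _; rewrite mem_index_enum.
Qed.

Section Phi.
Variables (M Lim : R) (Phi Psi : St -> R).
Hypotheses (Phi0 : forall x, 0 <= Phi x) (PhiM : forall x, Phi x <= M).
Hypothesis sPsi : sym Psi.
Hypothesis PsiE : forall x, ordered x -> Psi x = Phi x.
Hypothesis QL : forall y, Qit c k Psi y @[k --> \oo] --> Lim.

(** The time obtained from [lower_at] is not uniform in the initial state, so the initial law is
    restricted to finitely many states, up to a small mass, and t is taken beyond all of their
    times. *)
Lemma int_lower (e : R) : 0 < e -> exists t0 : R, forall t, t0 <= t ->
  ((Lim - e)%:E <= \int[P]_w (Phi (@rst K (X w t)))%:E)%E.
Proof.
move=> e0; pose e2 := e / 2; have e20 : 0 < e2 by rewrite divr_gt0.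
(* Chosen so that losing the mass e' costs at most e' Lim <= e / 2. *)
pose e' := e2 / (`|Lim| + 1).
have e'0 : 0 < e' by rewrite divr_gt0// ltr_wpDl.
have [m hm] := init_mass e'0.
pose Y := {ffun 'I_K -> 'I_m}; pose yv (y : Y) : St := fun i => y i.
have ex (y : Y) : exists t0 : R, forall t, t0 <= t ->
  ((fine (P (init_at X0 (yv y))) * (Lim - e2))%:E <=
   \int[P]_w ((`[< init_at X0 (yv y) w >])%:R * Phi (@rst K (X w t)))%:E)%E.
  exact: (lower_at K2 a0 b0 hn pAD mX0 ordX0 ind sol c0 Phi0 PhiM sPsi PsiE QL (yv y) e20).
have [t0 ht0] := choice ex.
exists (\sum_y `|t0 y|) => t ht.
have ht' y : t0 y <= t.
  apply: le_trans ht; rewrite (bigD1 y)//=; apply: le_trans (ler_norm _) _.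
  by rewrite lerDl sumr_ge0.
have I0 : (0 <= \int[P]_w (Phi (@rst K (X w t)))%:E)%E.
  by apply: integral_ge0 => w _; rewrite lee_fin.
have [L1|L1] := leP (Lim - e) 0.
  by apply: le_trans I0; rewrite lee_fin.
have S1 w : \sum_(y : Y) (`[< init_at X0 (yv y) w >])%:R * Phi (@rst K (X w t)) <=
    Phi (@rst K (X w t)).
  have [[y hy]|no] := pselect (exists y : Y, init_at X0 (yv y) w).
    rewrite (bigD1 y)//= big1 ?addr0 => [|z zy].
      by case: asboolP => _; rewrite ?mul1r// mul0r.
    case: asboolP => [hz|_]; last by rewrite mul0r.
    exfalso; move/eqP: zy; apply; apply/ffunP => i; apply/val_inj.
    by have := congr1 (fun f => f i) (etrans (esym hz) hy).
  rewrite big1// => y _; case: asboolP => [hy|_]; last by rewrite mul0r.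
  by exfalso; apply: no; exists y.
apply: (@le_trans _ _ (\int[P]_w (\sum_(y : Y)
    (`[< init_at X0 (yv y) w >])%:R * Phi (@rst K (X w t)))%:E)%E); last first.
  apply: ge0_le_integral_patch => w _; rewrite lee_fin//.
  by apply: sumr_ge0 => y _; rewrite mulr_ge0.
apply: le_trans (@integral_superadd_sum _ _ _ P _ _ _ M _ _); first last.
- by move=> w; apply: le_trans (S1 w) _.
- by move=> y w; rewrite mulr_ge0.
apply: (@le_trans _ _ (\sum_(y : Y) (fine (P (init_at X0 (yv y))) * (Lim - e2))%:E)%E); last first.
  by apply: lee_sum => y _; exact: ht0.
rewrite sumEFin lee_fin -mulr_suml.
have L2 : 0 <= Lim - e2 by move: L1; rewrite /e2; lra.
apply: (@le_trans _ _ ((1 - e') * (Lim - e2))); last by rewrite ler_wpM2r.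
have : e' * Lim <= e2.
  apply: (@le_trans _ _ (e' * (`|Lim| + 1))); last by rewrite /e' divfK// gt_eqF// ltr_wpDl.
  by rewrite ler_wpM2l ?(ltW e'0)// (le_trans (ler_norm _))// lerDl.
have := mulr_ge0 (ltW e'0) (ltW e20); have ee : e = e2 + e2 by rewrite /e2; field.
rewrite ee.
have alg (x z l : R) : 0 <= x * z -> x * l <= z -> l - (z + z) <= (1 - x) * (l - z) by lra.
exact: alg.
Qed.

End Phi.

Section PhiLim.
Variables (M Lim : R) (Phi Psi : St -> R).
Hypotheses (Phi0 : forall x, 0 <= Phi x) (PhiM : forall x, Phi x <= M).
Hypothesis sPsi : sym Psi.
Hypothesis PsiE : forall x, ordered x -> Psi x = Phi x.
Hypothesis QL : forall y, Qit c k Psi y @[k --> \oo] --> Lim.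

Lemma int_near (e : R) : 0 < e -> exists t0 : R, forall t, t0 <= t ->
  `|fine (\int[P]_w (Phi (@rst K (X w t)))%:E)%E - Lim| <= e.
Proof.
move=> e0.
have [t1 ht1] := int_lower Phi0 PhiM sPsi PsiE QL e0.
have Phi0' x : 0 <= M - Phi x by rewrite subr_ge0.
have PhiM' x : M - Phi x <= M by rewrite gerBl.
have sPsi' : sym (fun x => M - Psi x) by move=> s y; rewrite sPsi.
have PsiE' x : ordered x -> M - Psi x = M - Phi x by move=> ox; rewrite PsiE.
have QPsi y : Qit c k (fun x => M - Psi x) y @[k --> \oo] --> M - Lim.
  have Qc k (z : St) : Qit c k (fun _ : St => M) z = M.
    elim: k z => //= k IH z; rewrite /Qqueue.
    have -> : Qit c k (fun _ : St => M) = (fun _ : St => M) by apply/funext => z'; exact: IH.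
    rewrite /queue_gen big1 ?mulr0 ?addr0// => j _; rewrite !subrr; ring.
  have -> : (fun k => Qit c k (fun x => M - Psi x) y) = fun k => M - Qit c k Psi y.
    by apply/funext => k; rewrite QqiterB Qc.
  by apply: cvgB => //; exact: cvg_cst.
have [t2 ht2] := int_lower Phi0' PhiM' sPsi' PsiE' QPsi e0.
exists (Num.max t1 t2) => t; rewrite ge_max => /andP[h1 h2].
pose F w := Phi (@rst K (X w t)).
have iF : (\int[P]_w (F w)%:E)%E \is a fin_num by apply: (@int_fin_num _ _ _ P F M) => w; [exact: Phi0|exact: PhiM].
have iG : (\int[P]_w (M - F w)%:E)%E \is a fin_num.
  by apply: (@int_fin_num _ _ _ P (fun w => M - F w) M) => w; [exact: Phi0'|exact: PhiM'].
have S : (\int[P]_w (F w)%:E + \int[P]_w (M - F w)%:E <= M%:E)%E.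
  apply: le_trans (@integral_superadd _ _ _ P F (fun w => M - F w) M _ _ _) _ => //.
  - by move=> w; exact: Phi0.
  - by move=> w; exact: Phi0'.
  - by move=> w; rewrite addrC subrK.
  - apply: int_le_cst => w; first by rewrite addrC subrK (le_trans (Phi0 (fun=> 0%N))).
    by rewrite addrC subrK.
have := ht1 t h1; have := ht2 t h2; move: S; rewrite -/F.
rewrite -(fineK iF) -(fineK iG) -EFinD !lee_fin => S A2 A1.
rewrite ler_norml; apply/andP; split; first by move: A1; lra.
by move: A1 A2 S => /=; move: (fine _) (fine _) => x y; lra.
Qed.

End PhiLim.

(** The integral of a signed function is the difference of those of its positive and negative parts;
    as no linearity is available for nonmeasurable functions, the parts are treated separately. [F]
    is the observable of the model and [Fs] a symmetric function equal to it on ordered states. *)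
Lemma expect_cvg (F Fs : St -> R) (M Lp Ln : R) : (forall x, `|F x| <= M) -> sym Fs ->
  (forall x, ordered x -> Fs x = F x) ->
  (forall y, Qit c k (fun x => Num.max (Fs x) 0) y @[k --> \oo] --> Lp) ->
  (forall y, Qit c k (fun x => Num.max (- Fs x) 0) y @[k --> \oo] --> Ln) ->
  expect P (fun w => F (@rst K (X w t))) @[t --> +oo] --> Lp - Ln.
Proof.
move=> FM sF FE hp hn'.
have M0 : 0 <= M by apply: le_trans (FM (fun=> 0%N)).
have p0 x : 0 <= Num.max (F x) 0 by rewrite le_max lexx orbT.
have n0 x : 0 <= Num.max (- F x) 0 by rewrite le_max lexx orbT.
have pM x : Num.max (F x) 0 <= M by rewrite ge_max M0 andbT (le_trans (ler_norm _)).
have nM x : Num.max (- F x) 0 <= M.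
  by rewrite ge_max M0 andbT (le_trans (ler_norm _))// normrN.
have sp : sym (fun x => Num.max (Fs x) 0) by move=> s y; rewrite sF.
have sn : sym (fun x => Num.max (- Fs x) 0) by move=> s y; rewrite sF.
have pE x : ordered x -> Num.max (Fs x) 0 = Num.max (F x) 0 by move=> ox; rewrite FE.
have nE x : ordered x -> Num.max (- Fs x) 0 = Num.max (- F x) 0 by move=> ox; rewrite FE.
apply/cvgrPdist_le => e e0; have e20 : 0 < e / 2 by rewrite divr_gt0.
have [t1 ht1] := int_near p0 pM sp pE hp e20.
have [t2 ht2] := int_near n0 nM sn nE hn' e20.
exists (Num.max t1 t2); split; first exact: num_real.
move=> t; rewrite gt_max => /andP[/ltW h1 /ltW h2] /=.
have -> : expect P (fun w => F (@rst K (X w t))) =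
   fine (\int[P]_w (Num.max (F (@rst K (X w t))) 0)%:E)%E -
   fine (\int[P]_w (Num.max (- F (@rst K (X w t))) 0)%:E)%E.
  rewrite /expect integralE -fineB; last 2 first.
  - by apply: (@int_fin_num _ _ _ P _ M) => w; [exact: p0 | exact: pM].
  - by apply: (@int_fin_num _ _ _ P _ M) => w; [exact: n0 | exact: nM].
  congr (fine (_ - _)); apply: eq_integral => w _;
    by rewrite ?funeposE ?funenegE /= ?EFin_max.
move: (ht1 t h1) (ht2 t h2); move: (fine _) (fine _) => y x A1 A2.
have -> : Lp - Ln - (x - y) = (y - Ln) - (x - Lp) by ring.
by apply: le_trans (ler_normB _ _) _; lra.
Qed.

End Expect.

(** * The stationary law *)

Section GeoDCT.
Context {R : realType}.

Lemma geo_trunc (r : R) (f : nat -> R) (M : R) (k0 : nat) : 0 < r -> r < 1 ->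
  (forall k, `|f k| <= M) -> `|geo r f| <= \sum_(k < k0) `|f k| + r ^+ k0 * M.
Proof.
move=> r0 r1; elim: k0 f => [|k0 IH] f fM.
  by rewrite big_ord0 add0r expr0 mul1r; exact: geo_norm.
have bf : bnd f by exists M.
rewrite geo_shift// big_ord_recl exprS.
have h := IH (fun k => f k.+1) (fun k => fM _).
apply: le_trans (ler_normD _ _) _; rewrite !normrM (ger0_norm (ltW r0)).
have r1' : 0 <= 1 - r by rewrite subr_ge0 ltW.
rewrite (ger0_norm r1') -addrA; apply: lerD.
  by rewrite ler_piMl// gerBl ltW.
apply: (@le_trans _ _ (r * (\sum_(k < k0) `|f k.+1| + r ^+ k0 * M))).
  by rewrite ler_wpM2l// ltW.
rewrite mulrDr mulrA lerD2r; apply: ler_piMl (ltW r1).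
by apply: sumr_ge0.
Qed.

Lemma geo_dct (r : R) (f : nat -> nat -> R) (M : R) : 0 < r -> r < 1 ->
  (forall N k, `|f N k| <= M) -> (forall k, f N k @[N --> \oo] --> 0) ->
  geo r (f N) @[N --> \oo] --> 0.
Proof.
move=> r0 r1 fM f0; apply/cvgr0Pnorm_le => e e0.
have M0 : 0 <= M by apply: le_trans (fM 0%N 0%N).
have hr : r ^+ k * M @[k --> \oo] --> 0.
  rewrite -(mul0r M); apply: cvgMr_tmp; apply: cvg_expr.
  by rewrite ger0_norm// ltW.
have e20 : 0 < e / 2 by rewrite divr_gt0.
have [k0 _ hk0] := (@cvgr0Pnorm_le _ _ _ _ _ _).1 hr _ e20.
have hs : \sum_(k < k0) `|f N k| @[N --> \oo] --> 0.
  rewrite [X in _ --> X](_ : 0 = \sum_(k < k0) (0 : R)); last by rewrite big1.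
  apply: cvg_big => [|k _]; first exact: add_continuous.
  by rewrite -(normr0 R); apply: cvg_norm; exact: f0.
have [N0 _ hN0] := (@cvgr0Pnorm_le _ _ _ _ _ _).1 hs _ e20.
exists N0 => // N NN; apply: le_trans (geo_trunc k0 r0 r1 (fM N)) _.
have h1 := le_trans (ler_norm _) (hN0 N NN).
have h2 := le_trans (ler_norm _) (hk0 k0 (leqnn _)).
by rewrite (splitr e) lerD.
Qed.

Lemma Pm_dct {I : eqType} (r : I -> R) (s : seq I) (u : nat -> (I -> nat) -> R) (M : R) y :
  (forall i, 0 < r i) -> (forall i, r i < 1) ->
  (forall N z, `|u N z| <= M) -> (forall z, u N z @[N --> \oo] --> 0) ->
  Pm r s (u N) y @[N --> \oo] --> 0.
Proof.
move=> r0 r1 uM u0; elim: s y => [|i s IH] y /=; first exact: u0.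
apply: (@geo_dct _ _ M) => // N k; exact: Pm_norm.
Qed.

End GeoDCT.

(** * Probability measures on the natural numbers *)

Section DiscreteLaw.
Context {R : realType}.

Definition dmeas (p : nat -> {nonneg R}) : set nat -> \bar R :=
  mseries (fun k => mscale (p k) \d_k) 0.
HB.instance Definition _ p := Measure.on (dmeas p).

(* The proof of total mass 1 is an argument so that an instance can be attached to it. *)
Definition dprob (p : nat -> {nonneg R}) (h : dmeas p setT = 1%E) := dmeas p.
HB.instance Definition _ p h := Measure.on (@dprob p h).
HB.instance Definition _ p h := @Measure_isProbability.Build _ _ R (@dprob p h) h.

Lemma int_dmeas (p : nat -> {nonneg R}) (g : nat -> R) : (forall k, 0 <= g k) ->
  (\int[dmeas p]_k (g k)%:E = \sum_(k <oo) ((p k)%:num * g k)%:E)%E.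
Proof.
move=> g0; rewrite [LHS]ge0_integral_measure_series//=.
apply: eq_eseriesr => k _.
  transitivity ((p k)%:num%:E * \int[\d_k]_x (g x)%:E)%E.
    by apply: ge0_integral_mscale => // x _; rewrite lee_fin.
  by rewrite integral_dirac// diracT mul1e EFinM.
by move=> x _; rewrite lee_fin.
Qed.

Lemma nneseries_EFin (u : nat -> R) (l : R) : series u @ \oo --> l ->
  (\sum_(k <oo) (u k)%:E = l%:E)%E.
Proof.
move=> h; apply/cvg_lim => //.
rewrite (_ : (fun n => _) = EFin \o series u); last first.
  by apply/funext => n /=; rewrite sumEFin.
by apply: cvg_EFin; [exact: nearW | exact: h].
Qed.

Lemma fine_int_dmeas (p : nat -> {nonneg R}) (g : nat -> R) (l : R) : (forall k, 0 <= g k) ->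
  series (fun k => (p k)%:num * g k) @ \oo --> l -> (\int[dmeas p]_k (g k)%:E = l%:E)%E.
Proof. by move=> g0 h; rewrite int_dmeas//; exact: nneseries_EFin. Qed.

Lemma dmeas_setT (p : nat -> {nonneg R}) :
  series (fun k => (p k)%:num) @ \oo --> (1 : R) -> dmeas p setT = 1%E.
Proof.
move=> h; have := @integral_cst _ _ _ (dmeas p) setT measurableT 1.
rewrite mul1e => <-; apply: fine_int_dmeas => //.
by under eq_fun do rewrite mulr1.
Qed.

Lemma expect_dprob (p : nat -> {nonneg R}) (h : dmeas p setT = 1%E) (g : nat -> R) (lp ln : R) :
  series (fun k => (p k)%:num * Num.max (g k) 0) @ \oo --> lp ->
  series (fun k => (p k)%:num * Num.max (- g k) 0) @ \oo --> ln ->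
  expect (dprob h : probability _ R) g = lp - ln.
Proof.
move=> hp hn; rewrite /expect integralE.
have -> : (\int[dprob h]_x ((fun w => (g w)%:E)^\+ x) = lp%:E)%E.
  rewrite -(fine_int_dmeas _ hp); last by move=> k; rewrite le_max lexx orbT.
  by apply: eq_integral => k _; rewrite funeposE EFin_max.
have -> : (\int[dprob h]_x ((fun w => (g w)%:E)^\- x) = ln%:E)%E.
  rewrite -(fine_int_dmeas _ hn); last by move=> k; rewrite le_max lexx orbT.
  by apply: eq_integral => k _; rewrite funenegE EFin_max.
by [].
Qed.

End DiscreteLaw.

Section Stationary.
Context {R : realType} (K : nat) (a b : R).
Hypotheses (K0 : (0 < K)%N) (a0 : 0 <= a) (aK : a * K%:R < b).
Local Notation St := ('I_K -> nat).
Implicit Types (u v : St -> R) (y : St).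

(** Free of q, so the ergodic error is O(q^(-1/2)) uniformly. The last four arguments are the
    constants of [drift_bound], [beta_lam_le], [slack_le] and [slack_ge]. *)
Definition erg_C : R := `|@C8 R 'I_K b (2 * b + a) (2 * b) (2 * b) (b / (K%:R + 4 ^+ K))|.

Let b0 : 0 < b. Proof. by apply: le_lt_trans aK; rewrite mulr_ge0. Qed.
Let Kp : 0 < K%:R :> R. Proof. by rewrite ltr0n. Qed.
Let i0 : 'I_K := Ordinal K0.

Variable q : R.
Hypotheses (hq1 : qmin a b <= q)
  (hq2 : 16 * @C6 R 'I_K b (2 * b + a) (4 ^+ K * (2 * b) ^+ 2) (2 * b) (2 * b)
    (b / (K%:R + 4 ^+ K)) <= q).

Let q1 : 1 <= q.
Proof. by apply: le_trans hq1; rewrite /qmin -addrA lerDl addr_ge0// mulr_ge0// ltW. Qed.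
Let q0 : 0 < q. Proof. exact: lt_le_trans q1. Qed.
Let lm0 : 0 < lam a q. Proof. exact: (@lam_gt0 _ a b). Qed.
Let lmle : lam a q <= q ^+ 2. Proof. exact: (@lam_le _ a b). Qed.

Definition qclk : R := @c0 R 'I_K b * q ^+ 2.
Local Notation r := (ratio K a b q).
Local Notation Qit := (Qqiter (lam a q) (q ^+ 2) (b * q) qclk).

Lemma qclk_gt0 : 0 < qclk.
Proof. by rewrite /qclk mulr_gt0 ?exprn_gt0// /c0 card_ord mulr_gt0// addr_gt0// mulr_gt0. Qed.

Lemma qclk_ge : 2 * (#|'I_K|%:R * lam a q + #|'I_K|%:R * q ^+ 2 + b * q) <= qclk.
Proof.
rewrite /qclk /c0 card_ord.
have h1 : K%:R * lam a q <= K%:R * q ^+ 2 by rewrite ler_wpM2l// ltW.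
have h2 : b * q <= b * q ^+ 2 by rewrite ler_wpM2l ?(ltW b0)// expr2 ler_peMl// ltW.
have -> : 2 * (2 * K%:R + b) * q ^+ 2 = 2 * (K%:R * q ^+ 2 + K%:R * q ^+ 2 + b * q ^+ 2) by ring.
by rewrite ler_wpM2l//; move: (K%:R * _) (K%:R * _) (b * _) (b * _) h1 h2 => *; lra.
Qed.

Lemma stat_exists u : bnd u -> (forall y, u (upall y) = u y) ->
  exists l : R, (forall y, Qit k u y @[k --> \oo] --> l) /\
    `|l - Em r u| <= erg_C / Num.sqrt q * Num.sqrt (Var r u).
Proof.
move=> bu iu.
have lg : q ^+ 2 / 2 <= lam a q by exact: (@lam_ge _ a b).
have h1 : r ^+ #|'I_K| * (lam a q + b * q) = lam a q by rewrite card_ord ratio_eq.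
have h2 : `|#|'I_K|%:R * slack K a b q - b * q / lam a q| <= 4 ^+ K * (2 * b) ^+ 2 / q ^+ 2.
  by rewrite card_ord slack_bound2.
have c5 : 0 < b / (K%:R + 4 ^+ K) by rewrite divr_gt0// addr_gt0// exprn_gt0.
have [l hl hE] := @Qiter_cvg R 'I_K i0 b q (lam a q) (q ^+ 2) (b * q) r (slack K a b q) _ _ _ _ _
  (ratio_gt0 K a0 b0 hq1) (ratio_lt1 K0 a0 b0 hq1) erefl erefl erefl b0 q1 lg lmle h1
  (drift_bound K0 a0 b0 hq1) h2 (beta_lam_le a0 b0 hq1) (slack_le K0 a0 b0 hq1)
  (slack_ge K0 a0 b0 hq1) c5 (slack_le1 K0 a0 b0 hq1) u bu iu hq2.
exists l; split; last first.
  apply: (le_trans hE); rewrite ler_wpM2r ?sqrtr_ge0// ler_wpM2r ?invr_ge0 ?sqrtr_ge0//.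
  exact: ler_norm.
(* Chosen so that K (q^2 (1 + t) - lambda) = (b + a K) q / 2, which is below b q because a K < b. *)
pose t : R := (b / K%:R - a) / (2 * q).
have t0 : 0 < t.
  by rewrite divr_gt0 ?mulr_gt0// subr_gt0 ltr_pdivlMr.
have sig0 : 0 < (1 + t)^-1 by rewrite invr_gt0 addr_gt0.
have sig1 : (1 + t)^-1 < 1 by rewrite invf_lt1 ?addr_gt0// ltrDl.
have dr : #|'I_K|%:R * (q ^+ 2 / (1 + t)^-1 - lam a q) < b * q.
  rewrite card_ord invrK.
  have -> : K%:R * (q ^+ 2 * (1 + t) - lam a q) = (b + a * K%:R) / 2 * q.
    by rewrite /t /lam; field; rewrite !gt_eqF.
  by rewrite ltr_pM2r//; move: aK; lra.
apply: (@Qqiter_cvg R 'I_K i0 (lam a q) (q ^+ 2) (b * q) qclk lm0 lmle (mulr_gt0 b0 q0)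
   qclk_ge _ sig0 sig1 dr (fun k u => Qiter b q (lam a q) (q ^+ 2) (b * q) k u)) => //.
- move=> k v M vM; exact: (Qiter_norm i0 erefl erefl b0 q1 lg lmle).
- by move=> k v iv; exact: Qiter_upall.
Qed.

(** Starting from the empty system is a convention: the limit is the same from every state. *)
Definition stat u : R := limn (fun k => Qit k u (fun=> 0%N)).

Lemma stat_cvg u : bnd u -> (forall y, u (upall y) = u y) ->
  forall y, Qit k u y @[k --> \oo] --> stat u.
Proof.
move=> bu iu y; have [l [hl _]] := stat_exists bu iu.
by rewrite /stat (cvg_lim _ (hl (fun=> 0%N))).
Qed.

Lemma stat_close u : bnd u -> (forall y, u (upall y) = u y) ->
  `|stat u - Em r u| <= erg_C / Num.sqrt q * Num.sqrt (Var r u).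
Proof.
move=> bu iu; have [l [hl h]] := stat_exists bu iu.
by rewrite /stat (cvg_lim _ (hl (fun=> 0%N))).
Qed.

Lemma statB u v : bnd u -> (forall y, u (upall y) = u y) -> bnd v ->
  (forall y, v (upall y) = v y) -> stat (fun y => u y - v y) = stat u - stat v.
Proof.
move=> bu iu bv iv; apply/cvg_lim => //.
rewrite (_ : (fun k => _) = fun k => Qit k u (fun=> 0%N) - Qit k v (fun=> 0%N)).
  by apply: cvgB; exact: stat_cvg.
by apply/funext => k; rewrite QqiterB.
Qed.

Lemma statZ c u : bnd u -> (forall y, u (upall y) = u y) ->
  stat (fun y => c * u y) = c * stat u.
Proof.
move=> bu iu; apply/cvg_lim => //.
rewrite (_ : (fun k => _) = fun k => c * Qit k u (fun=> 0%N)).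
  by apply: cvgMl_tmp; exact: stat_cvg.
apply/funext => k; elim: k (fun=> 0%N : nat) => //= k IH z.
by rewrite -QqueueZ; congr Qqueue; apply/funext => x; exact: IH.
Qed.

Lemma stat_ge0 u : bnd u -> (forall y, u (upall y) = u y) -> (forall y, 0 <= u y) -> 0 <= stat u.
Proof.
move=> bu iu u0; apply: cvgr_to_ge (stat_cvg bu iu (fun=> 0%N)) _.
apply: nearW => k; elim: k (fun=> 0%N : nat) => //= k IH z.
have := @Qqueue_le R 'I_K i0 (lam a q) (q ^+ 2) (b * q) qclk lm0 lmle (mulr_gt0 b0 q0) qclk_ge
  (fun=> 0) (Qit k u) IH z.
apply: le_trans; rewrite /Qqueue /queue_gen big1 ?mulr0 ?addr0// => j _.
by rewrite !subrr !mulr0 !addr0.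
Qed.

Lemma stat_cst c : stat (fun=> c) = c.
Proof.
apply/cvg_lim => //; rewrite (_ : (fun k => _) = fun=> c); first exact: cvg_cst.
apply/funext => k; elim: k (fun=> 0%N : nat) => //= k IH z.
rewrite /Qqueue (_ : Qit k (fun=> c) = fun=> c); last by apply/funext => x; exact: IH.
by rewrite /queue_gen big1 ?mulr0 ?addr0// => j _; rewrite !subrr !mulr0 !addr0.
Qed.

Section Law.
Variable psi : St -> nat.
Hypothesis ipsi : forall y, psi (upall y) = psi y.

Definition law_p k : R := stat (fun y => (psi y == k)%:R).

Lemma law_p_ge0 k : 0 <= law_p k.
Proof. by apply: stat_ge0 => // y; rewrite ipsi. Qed.

(** [stat] is so far only a positive linear functional. Closeness to the product mean transfers
    tightness: on a tail indicator with product mean e it is at most e + C sqrt e. *)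
Lemma stat_tail : stat (fun y => (N <= psi y)%N%:R) @[N --> \oo] --> 0.
Proof.
have ib N y : ((N <= psi (upall y))%N%:R : R) = (N <= psi y)%N%:R by rewrite ipsi.
have hE : Em r (fun y => (N <= psi y)%N%:R) @[N --> \oo] --> 0.
  apply: (@Pm_dct _ _ _ _ _ 1) => [i|i|N y|y].
  - exact: (ratio_gt0 K a0 b0 hq1).
  - exact: (ratio_lt1 K0 a0 b0 hq1).
  - by case: (_ <= _)%N; rewrite ?normr0 ?normr1.
  - apply: cvg_near_cst; exists (psi y).+1 => // N /= h.
    by rewrite leqNgt h.
have r0 := ratio_gt0 K a0 b0 hq1; have r1 := ratio_lt1 K0 a0 b0 hq1.
pose e N := Em r (fun y => (N <= psi y)%N%:R).
have hs : Num.sqrt (e N) @[N --> \oo] --> 0.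
  rewrite -[X in _ --> X]sqrtr0; apply: continuous_cvg hE; exact: sqrt_continuous.
have hB : e N + erg_C / Num.sqrt q * Num.sqrt (e N) @[N --> \oo] --> 0.
  rewrite -[X in _ --> X](addr0 0) -[X in _ --> _ + X](mulr0 (erg_C / Num.sqrt q)).
  by apply: cvgD => //; exact: cvgMl_tmp.
apply: (squeeze_cvgr _ (cvg_cst 0) hB); apply: nearW => N.
rewrite stat_ge0//=.
have V : Var r (fun y => (N <= psi y)%N%:R) <= e N.
  rewrite /Var (_ : (fun y => _ ^+ 2) = fun y => (N <= psi y)%N%:R).
    by rewrite gerBl sqr_ge0.
  by apply/funext => y; case: (_ <= _)%N; rewrite ?expr1n// expr0n.
have h := stat_close (bnd_bool (fun y => (N <= psi y)%N)) (ib N).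
 rewrite -lerBlDl; apply: le_trans (ler_norm _) _.
apply: (le_trans h); rewrite ler_wpM2l ?ler_wsqrtr//.
by rewrite divr_ge0 ?sqrtr_ge0// /erg_C.
Qed.

Lemma stat_le u v : bnd u -> (forall y, u (upall y) = u y) -> bnd v ->
  (forall y, v (upall y) = v y) -> (forall y, u y <= v y) -> stat u <= stat v.
Proof.
move=> bu iu bv iv uv; rewrite -subr_ge0 -statB//; apply: stat_ge0 => // y.
  by rewrite iu iv.
by rewrite subr_ge0.
Qed.

(** Countable additivity from the vanishing tails: the partial sum up to N is the functional of g
    cut off to psi < N. *)
Lemma law_cvg (g : nat -> R) : bnd g ->
  series (fun k => law_p k * g k) @ \oo --> stat (fun y => g (psi y)).
Proof.
move=> [M gM].
have bg : bnd (fun y => g (psi y)) by exists M.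
have ig y : g (psi (upall y)) = g (psi y) by rewrite ipsi.
have part N : series (fun k => law_p k * g k) N = stat (fun y => g (psi y) * (psi y < N)%N%:R).
  elim: N => [|N IH].
    rewrite /series/= big_geq// (_ : (fun y => _) = fun=> 0) ?stat_cst//.
    by apply/funext => y; rewrite mulr0.
  rewrite seriesSr IH addrC.
  have -> : stat (fun y => g (psi y) * (psi y < N)%N%:R) =
    stat (fun y => g (psi y) * (psi y < N.+1)%N%:R - g N * (psi y == N)%:R).
    congr stat; apply/funext => y; rewrite (ltnS (psi y) N) (leq_eqVlt (psi y) N).
    by have [->|_] := eqVneq (psi y) N; rewrite ?ltnn /=; ring.
  have i1 y : g (psi (upall y)) * (psi (upall y) < N.+1)%N%:R = g (psi y) * (psi y < N.+1)%N%:R.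
    by rewrite ipsi.
  have i2 y : g N * (psi (upall y) == N)%:R = g N * (psi y == N)%:R by rewrite ipsi.
  have i3 y : (psi (upall y) == N)%:R = (psi y == N)%:R :> R by rewrite ipsi.
  have S := statB _ i1 _ i2; rewrite S//.
  have Z := statZ (g N) _ i3; rewrite Z//.
  by rewrite /law_p; ring.
rewrite (_ : series _ = fun N => stat (fun y => g (psi y) * (psi y < N)%N%:R)); last first.
  by apply/funext => N; exact: part.
apply/subr_cvg0/norm_cvg0P.
have hM : M * stat (fun y => (N <= psi y)%N%:R) @[N --> \oo] --> 0.
  by rewrite -(mulr0 M); apply: cvgMl_tmp; exact: stat_tail.
apply: (squeeze_cvgr _ (cvg_cst 0) hM); apply: nearW => N.
rewrite normr_ge0/= -statB//; last by move=> y; rewrite ipsi.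
have iN y : M * (N <= psi (upall y))%N%:R = M * (N <= psi y)%N%:R by rewrite ipsi.
have iD y : g (psi (upall y)) * (psi (upall y) < N)%N%:R - g (psi (upall y)) =
  g (psi y) * (psi y < N)%N%:R - g (psi y) by rewrite ipsi.
have key y : `|g (psi y) * (psi y < N)%N%:R - g (psi y)| <= M * (N <= psi y)%N%:R.
  case: leqP => _; first by rewrite mulr0 sub0r normrN mulr1.
  by rewrite mulr1 subrr normr0 mulr0.
have ib y : (N <= psi (upall y))%N%:R = (N <= psi y)%N%:R :> R by rewrite ipsi.
have Z := statZ M (bnd_bool (fun y => (N <= psi y)%N)) ib.
have bN : bnd (fun y => M * (N <= psi y)%N%:R) by [].
have Z' := statZ (-1) bN iN.
rewrite -Z ler_norml; apply/andP; split; last first.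
  by apply: stat_le => // y; exact: le_trans (ler_norm _) (key y).
rewrite -mulN1r -Z'; apply: stat_le => //.
- by move=> y; rewrite iN.
- by move=> y; rewrite mulN1r; have := key y; rewrite ler_norml => /andP[].
Qed.

End Law.
End Stationary.

(** * Gaps of sorted geometric variables *)

Section Nested.
Context {R : realType}.
Implicit Types (rs : seq R) (G H : seq nat -> R).

Fixpoint NG rs G : R :=
  if rs is r :: rs' then geo r (fun k => NG rs' (fun s => G (k :: s))) else G [::].

Definition ratios rs := all (fun r => 0 < r < 1) rs.

Lemma NG_norm rs G M : ratios rs -> (forall s, `|G s| <= M) -> `|NG rs G| <= M.
Proof.
elim: rs G => [|r rs IH] G //= /andP[/andP[r0 r1] hrs] GM.
by apply: geo_norm => // k; apply: IH.
Qed.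

Lemma bnd_NG rs (T : Type) (G : T -> seq nat -> R) M : ratios rs ->
  (forall k s, `|G k s| <= M) -> bnd (fun k => NG rs (G k)).
Proof. by move=> hrs GM; exists M => k; exact: NG_norm. Qed.

Lemma NG_cst rs c : ratios rs -> NG rs (fun=> c) = c.
Proof.
elim: rs => [|r rs IH] //= /andP[/andP[r0 r1] hrs].
by rewrite IH// geo_cst.
Qed.

Lemma eq_NG rs G H : G =1 H -> NG rs G = NG rs H.
Proof. by move=> /funext ->. Qed.

Lemma ratios_nseq m (r : R) : 0 < r -> r < 1 -> ratios (nseq m r).
Proof. by move=> r0 r1; rewrite /ratios all_nseq r0 r1 orbT. Qed.

End Nested.

Lemma add_sqr_leq m : (m + m ^ 2 <= m.+1 ^ 2)%N.
Proof. rewrite -!mulnn; lia. Qed.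

Section Renyi.
Context {R : realType} (r : R).
Hypotheses (r0 : 0 < r) (r1 : r < 1).
Implicit Types (G H h : seq nat -> R).
Local Notation gE m := (NG (nseq m r)).
Local Notation up := (map (addn 1)).

Let r1' : 0 <= 1 - r. Proof. by rewrite subr_ge0 ltW. Qed.
Let r0' : 0 <= r. Proof. exact: ltW. Qed.

(** All coordinates are positive up to an event of probability at most m (1 - r). *)
Lemma gE_shift m H M : (forall s, `|H s| <= M) ->
  `|gE m H - r ^+ m * gE m (fun s => H (up s))| <= m%:R * (1 - r) * M.
Proof.
elim: m H => [|m IH] H HM; first by rewrite /= expr0 mul1r subrr normr0 !mul0r.
have hr := ratios_nseq m r0 r1.
have M0 : 0 <= M by apply: le_trans (HM [::]).
rewrite /=; set E := fun k => gE m (fun s => H (k :: s)).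
have bE : bnd E by apply: (bnd_NG (M := M)).
pose E' k := gE m (fun s => H (k.+1 :: up s)).
have bE' : bnd E' by apply: (bnd_NG (M := M)).
have bS : bnd (fun k => E k.+1) by [].
rewrite (geo_shift r0 r1 bE) exprS -mulrA -addrA -mulrBr.
have -> : geo r (fun k => E k.+1) - r ^+ m * geo r E' = geo r (fun k => E k.+1 + (- r ^+ m) * E' k).
  by rewrite geoD// geoZ// mulNr.
apply: le_trans (ler_normD _ _) _; rewrite !normrM (ger0_norm r0') (ger0_norm r1').
have h1 : `|E 0%N| <= M by apply: NG_norm.
have h2 : `|geo r (fun k => E k.+1 + (- r ^+ m) * E' k)| <= m%:R * (1 - r) * M.
  by apply: geo_norm => // k; rewrite mulNr; apply: IH.
have h3 : 0 <= m%:R * (1 - r) * M by rewrite mulr_ge0// mulr_ge0.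
have := ler_wpM2l r1' h1; have := ler_wpM2l r0' h2.
have : r * (m%:R * (1 - r) * M) <= m%:R * (1 - r) * M by rewrite ler_piMl// ltW.
rewrite -natr1 (_ : (m%:R + 1) * (1 - r) * M = m%:R * (1 - r) * M + (1 - r) * M); last by ring.
by move: (m%:R * (1 - r) * M) (r * _) (r * _) ((1 - r) * _) ((1 - r) * _) => *; lra.
Qed.

Definition symseq H := forall s t, perm_eq s t -> H s = H t.

(* Expansion according to the number of zero coordinates; two or more cost (1 - r)^2. *)
Lemma gE_min m H M : symseq H -> (forall s, `|H s| <= M) ->
  `|gE m H - r ^+ m * gE m (fun s => H (up s))
    - m%:R * (1 - r) * r ^+ m.-1 * gE m.-1 (fun s => H (0%N :: up s))|
  <= (m ^ 2)%:R * (1 - r) ^+ 2 * M.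
Proof.
elim: m H => [|m IH] H sH HM.
  by rewrite /= expr0 mul1r subrr !mul0r subrr normr0.
have hr := ratios_nseq m r0 r1.
have M0 : 0 <= M by apply: le_trans (HM [::]).
(* By symmetry the single zero coordinate may be moved to the front, past the positive first one. *)
have hB : m%:R * r * r ^+ m.-1 * geo r (fun k => gE m.-1 (fun s => H (k.+1 :: 0%N :: up s))) =
    m%:R * r ^+ m * gE m (fun s => H (0%N :: up s)).
  case: (m) => [|m']; first by rewrite !mul0r.
  rewrite /= exprS mulrA; congr (_ * _); congr geo; apply/funext => k.
  by apply: eq_NG => s; apply: sH; rewrite (permEl (perm_catCA [:: k.+1] [:: 0%N] (up s))).
rewrite [m.+1.-1]/=; set B := gE m (fun s => H (0%N :: up s)).
rewrite [gE m.+1 H]/= [gE m.+1 _]/=.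
set E := fun k => gE m (fun s => H (k :: s)).
have bE : bnd E by apply: (bnd_NG (M := M)).
pose E' k := gE m (fun s => H (k.+1 :: up s)).
have bE' : bnd E' by apply: (bnd_NG (M := M)).
have bS : bnd (fun k => E k.+1) by [].
pose E2 k := gE m.-1 (fun s => H (k.+1 :: 0%N :: up s)).
have bE2 : bnd E2 by apply: (bnd_NG (M := M)) => //; exact: ratios_nseq.
pose c := m%:R * (1 - r) * r ^+ m.-1.
have h1 : `|E 0%N - r ^+ m * B| <= m%:R * (1 - r) * M by apply: gE_shift.
have h2 : `|geo r (fun k => E k.+1 + (- r ^+ m) * E' k + (- c) * E2 k)| <=
    (m ^ 2)%:R * (1 - r) ^+ 2 * M.
  apply: geo_norm => // k; rewrite !mulNr; apply: IH => //.
  by move=> s t st; apply: sH; rewrite perm_cons.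
have g2 : geo r (fun k => E k.+1 + (- r ^+ m) * E' k + (- c) * E2 k) =
    geo r (fun k => E k.+1) - r ^+ m * geo r E' - c * geo r E2.
  by rewrite !geoD// !geoZ// !mulNr.
rewrite (geo_shift r0 r1 bE).
have -> : (1 - r) * E 0%N + r * geo r (fun k => E k.+1) - r ^+ m.+1 * geo r E' -
    m.+1%:R * (1 - r) * r ^+ m * B = (1 - r) * (E 0%N - r ^+ m * B) +
    r * geo r (fun k => E k.+1 + (- r ^+ m) * E' k + (- c) * E2 k).
  have -> : m.+1%:R * (1 - r) * r ^+ m * B = (1 - r) * r ^+ m * B + (1 - r) * (m%:R * r ^+ m * B).
    by rewrite -natr1; ring.
  by rewrite /B -hB -/E2 g2 /c exprS; ring.
apply: le_trans (ler_normD _ _) _; rewrite !normrM (ger0_norm r0') (ger0_norm r1').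
have h3 : 0 <= (m ^ 2)%:R * (1 - r) ^+ 2 * M by rewrite mulr_ge0// mulr_ge0// exprn_ge0.
have h4 := ler_wpM2l r1' h1; have h5 := ler_wpM2l r0' h2.
have h6 : r * ((m ^ 2)%:R * (1 - r) ^+ 2 * M) <= (m ^ 2)%:R * (1 - r) ^+ 2 * M.
  by rewrite ler_piMl// ltW.
apply: le_trans (lerD h4 (le_trans h5 h6)) _.
have -> : (1 - r) * (m%:R * (1 - r) * M) + (m ^ 2)%:R * (1 - r) ^+ 2 * M =
  (m + m ^ 2)%:R * (1 - r) ^+ 2 * M by rewrite natrD; ring.
by rewrite ler_wpM2r// ler_wpM2r ?exprn_ge0// ler_nat add_sqr_leq.
Qed.

Definition hrow h j : seq nat -> R := fun s => h (j :: map (addn j.+1) s).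

Lemma sort_min j s : sort leq (map (addn j) (0%N :: up s)) = j :: map (addn j.+1) (sort leq s).
Proof.
apply: (sorted_eq leq_trans anti_leq).
- exact: sort_sorted leq_total _.
- rewrite /= path_min_sorted; last by apply/allP => x /mapP[y _ ->]; rewrite addSn ltnW// leq_addr.
  rewrite sorted_map; apply: sub_sorted (sort_sorted leq_total s) => x y /=.
  by rewrite leq_add2l.
- rewrite perm_sort /= addn0 perm_cons -map_comp.
  rewrite (eq_map (_ : _ =1 addn j.+1)); first by rewrite perm_map// perm_sym perm_sort.
  by move=> x /=; rewrite addnA addn1.
Qed.

(** [gE_min] is applied to the sample raised by every height j and averaged over j with ratio
    r^(m+1); by [geo_shift] its first two terms collapse to (1 - r^(m+1)) times the value at height
    0. *)
Lemma gE_sort_step m h M : (forall s, `|h s| <= M) ->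
  `|(1 - r ^+ m.+1) * gE m.+1 (fun s => h (sort leq s)) -
    m.+1%:R * (1 - r) * r ^+ m *
      geo (r ^+ m.+1) (fun j => gE m (fun s => hrow h j (sort leq s)))|
  <= (m.+1 ^ 2)%:R * (1 - r) ^+ 2 * M.
Proof.
move=> hM; set rho := r ^+ m.+1; set kap := m.+1%:R * (1 - r) * r ^+ m.
have rho0 : 0 < rho by rewrite exprn_gt0.
have rho1 : rho < 1 by rewrite exprn_ilt1.
pose e j := gE m.+1 (fun s => h (sort leq (map (addn j) s))).
have be : bnd e by apply: (bnd_NG (M := M)) => //; exact: ratios_nseq.
pose A j := gE m (fun s => hrow h j (sort leq s)).
have bA : bnd A by apply: (bnd_NG (M := M)) => [|k s]; [exact: ratios_nseq|exact: hM].
have E0 : gE m.+1 (fun s => h (sort leq s)) = e 0%N.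
  by apply: eq_NG => s; rewrite (eq_map (_ : _ =1 id)) ?map_id.
rewrite E0.
have hs := geo_shift rho0 rho1 be.
have bS : bnd (fun k => e k.+1) by [].
have -> : (1 - rho) * e 0%N - kap * geo rho A =
    geo rho (fun j => e j + (- rho) * e j.+1 + (- kap) * A j).
  by rewrite !geoD// !geoZ// hs; ring.
apply: geo_norm => // j; rewrite !mulNr.
have sH : symseq (fun s => h (sort leq (map (addn j) s))).
  move=> s t st; congr h; apply/(perm_sortP leq_total leq_trans anti_leq); exact: perm_map.
have := gE_min m.+1 sH (fun s => hM _); rewrite [m.+1.-1]/= -/kap -/rho.
have -> : gE m.+1 (fun s => h (sort leq (map (addn j) (up s)))) = e j.+1.
  apply: eq_NG => s; rewrite -map_comp (eq_map (_ : _ =1 addn j.+1))// => x /=.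
  by rewrite addnA addn1.
by have -> : gE m (fun s => h (sort leq (map (addn j) (0%N :: up s)))) = A j
  by apply: eq_NG => s; rewrite sort_min.
Qed.

Lemma gE_sort1 m h M : (forall s, `|h s| <= M) ->
  `|gE m.+1 (fun s => h (sort leq s)) -
      geo (r ^+ m.+1) (fun j => gE m (fun s => hrow h j (sort leq s)))|
  <= 2 * (m.+1 ^ 2)%:R * (1 - r) * M.
Proof.
move=> hM; have M0 : 0 <= M by apply: le_trans (hM [::]).
have rho0 : 0 < r ^+ m.+1 by rewrite exprn_gt0.
have rho1 : r ^+ m.+1 < 1 by rewrite exprn_ilt1.
have S1 := gE_sort_step m hM.
(* The constant function 1 shows that the factor (m + 1) (1 - r) r^m is close to 1 - r^(m+1), by
   which the estimate is then divided. *)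
have S2 := @gE_sort_step m (fun=> 1) 1 (fun s => _).
have {}S2 := S2 ltac:(by rewrite normr1).
rewrite /hrow !NG_cst ?ratios_nseq// geo_cst// !mulr1 in S2.
move: S1 S2; set e := gE m.+1 _; set g := geo _ _; set k := _ * r ^+ m; set D := _ * (1 - r) ^+ 2.
move=> S1 S2.
have gM : `|g| <= M.
  by apply: geo_norm => // j; apply: NG_norm => [|s]; [exact: ratios_nseq | exact: hM].
have rr : 1 - r <= 1 - r ^+ m.+1 by rewrite lerB// exprS ler_piMr// exprn_ile1// ltW.
have r1p : 0 < 1 - r by rewrite subr_gt0.
have D0 : 0 <= D by rewrite mulr_ge0// exprn_ge0.
rewrite -(ler_pM2l r1p).
have -> : (1 - r) * (2 * (m.+1 ^ 2)%:R * (1 - r) * M) = D * M + D * M by rewrite /D; ring.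
apply: (@le_trans _ _ ((1 - r ^+ m.+1) * `|e - g|)); first by rewrite ler_wpM2r.
rewrite -[X in X * _]ger0_norm ?(le_trans r1' rr)// -normrM.
have -> : (1 - r ^+ m.+1) * (e - g) = ((1 - r ^+ m.+1) * e - k * g) - (1 - r ^+ m.+1 - k) * g by ring.
apply: le_trans (ler_normB _ _) _; apply: lerD => //.
by rewrite normrM; exact: ler_pM.
Qed.

(** Rebuilds a sorted sample from its minimum and the successive gaps minus one. Samples with ties
    are not of this form; they are part of the O(1 - r) error. *)
Fixpoint build (ks : seq nat) : seq nat :=
  if ks is j :: ks' then j :: map (addn j.+1) (build ks') else [::].

Fixpoint powers m : seq R := if m is m'.+1 then r ^+ m'.+1 :: powers m' else [::].

Lemma ratios_powers m : ratios (powers m).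
Proof.
elim: m => //= m ->; rewrite andbT exprn_gt0//= exprn_ilt1//.
Qed.

Fixpoint renyi_cst m : R := if m is m'.+1 then 2 * (m'.+1 ^ 2)%:R + renyi_cst m' else 0.

Lemma renyi m h M : (forall s, `|h s| <= M) ->
  `|gE m (fun s => h (sort leq s)) - NG (powers m) (fun ks => h (build ks))| <=
   renyi_cst m * (1 - r) * M.
Proof.
elim: m h => [|m IH] h hM; first by rewrite /= subrr normr0 !mul0r.
have M0 : 0 <= M by apply: le_trans (hM [::]).
have rho0 : 0 < r ^+ m.+1 by rewrite exprn_gt0.
have rho1 : r ^+ m.+1 < 1 by rewrite exprn_ilt1.
set e := gE m.+1 _; rewrite [NG _ _]/=; set g := geo _ _.
have S1 := gE_sort1 m hM; rewrite -/e in S1; set g' := geo _ _ in S1.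
have bA : bnd (fun j => gE m (fun s => hrow h j (sort leq s))).
  by apply: (bnd_NG (M := M)) => [|k s]; [exact: ratios_nseq|exact: hM].
have bB : bnd (fun j => NG (powers m) (fun s => h (j :: map (addn j.+1) (build s)))).
  by apply: (bnd_NG (M := M)) => [|k s]; [exact: ratios_powers|exact: hM].
have S2 : `|g' - g| <= renyi_cst m * (1 - r) * M.
  rewrite /g' /g -[X in _ - X]mul1r -mulNr -geoZ// -geoD//; apply: geo_norm => // j.
  by rewrite mulN1r; apply: (IH (hrow h j)) => s; exact: hM.
have -> : e - g = (e - g') + (g' - g) by ring.
apply: le_trans (ler_normD _ _) _; apply: le_trans (lerD S1 S2) _.
by rewrite le_eqVlt; apply/orP; left; apply/eqP => /=; ring.
Qed.

End Renyi.

(** * From geometric to exponential variables *)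

Section Density.
Context {R : realType}.
Local Notation mu := (@lebesgue_measure R).

(** The exponential density without the cut at 0, hence continuous on the whole line. *)
Definition dens (th x : R) : R := th * expR (- (th * x)).

Variable th : R.
Hypothesis th0 : 0 < th.

Lemma dens_ge0 x : 0 <= dens th x.
Proof. by rewrite mulr_ge0 ?expR_ge0// ltW. Qed.

Lemma dens_pdf x : 0 <= x -> exponential_pdf th x = dens th x.
Proof. by move=> x0; rewrite exponential_pdfE// mulNr. Qed.

Lemma integrable_dens : mu.-integrable `[0, +oo[ (EFin \o dens th).
Proof.
apply: (@eq_integrable _ _ _ mu _ _ (EFin \o exponential_pdf th)) => //.
  by move=> x; rewrite inE/= in_itv/= andbT => x0; rewrite dens_pdf.
by apply: (integrableS _ _ _ (integrable_exponential_pdf th0)).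
Qed.

Lemma continuous_expN : continuous (fun x : R => expR (- (th * x))).
Proof.
move=> x; apply: continuous_comp; last exact: continuous_expR.
by apply: continuousN; apply: continuousM => //; exact: cst_continuous.
Qed.

Lemma continuous_dens : continuous (dens th).
Proof.
move=> x; apply: (@continuousM _ R^o (fun=> th) (fun x => expR (- (th * x)))).
  exact: cst_continuous.
exact: continuous_expN.
Qed.

Lemma int_dens (c d : R) : c < d ->
  (\int[mu]_(x in `[c, d]) (dens th x)%:E = (expR (- (th * c)) - expR (- (th * d)))%:E)%E.
Proof.
move=> cd.
have D (z : R) : is_derive z (1 : R) (fun x : R => - expR (- (th * x))) (dens th z).
  rewrite /dens; apply: is_derive_eq; rewrite /GRing.scale/=; ring.
rewrite (@continuous_FTC2 _ (dens th) (fun x => - expR (- (th * x))) c d)//.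
- by rewrite -EFinB opprK addrC.
- exact: continuous_subspaceT continuous_dens.
- split.
  + by move=> z _; have [] := D z.
  + by apply: cvg_at_right_filter; apply: cvgN; exact: continuous_expN.
  + by apply: cvg_at_left_filter; apply: cvgN; exact: continuous_expN.
- by move=> z _; rewrite derive1E; have [_] := D z.
Qed.

End Density.

Section GeoInt.
Context {R : realType} (rho q : R).
Local Notation mu := (@lebesgue_measure R).
Hypotheses (rho0 : 0 < rho) (rho1 : rho < 1) (q0 : 0 < q).

(** The rate of an exponential variable for which the integer part of q times that variable is
    geometric of ratio rho. *)
Definition grate_of : R := - (q * ln rho).
Local Notation th := grate_of.

Lemma grate_gt0 : 0 < th.
Proof. by rewrite /grate_of -mulrN mulr_gt0// oppr_gt0 ln_lt0// rho0. Qed.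

Lemma exp_grate k : expR (- (th * (k%:R / q))) = rho ^+ k.
Proof.
rewrite /grate_of mulNr opprK.
have -> : q * ln rho * (k%:R / q) = k%:R * ln rho by field; rewrite gt_eqF.
by rewrite expRM_natl lnK// posrE.
Qed.

Lemma trunc_measurable (phi : nat -> R) :
  measurable_fun (`[0%R, +oo[%classic : set R) (fun x : R => phi (Num.truncn (q * x))).
Proof.
apply: (@countable_measurable_fun R _ _ nat) => // k.
apply: measurable_realfun.is_interval_measurable => u v /=; rewrite !in_itv/= !andbT.
move=> [u0 uk] [v0 vk] x /andP[ux xv].
have x0 : 0 <= x by exact: le_trans ux.
rewrite in_itv/= andbT; split => //; apply/eqP; rewrite eqn_leq; apply/andP; split.
  by rewrite -vk le_truncn// ler_pM2l.
by rewrite -uk le_truncn// ler_pM2l.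
Qed.

Lemma dens_trunc_measurable (phi : nat -> R) :
  measurable_fun (`[0%R, +oo[%classic : set R) (fun x : R => dens th x * phi (Num.truncn (q * x))).
Proof.
apply: measurable_funM; last exact: trunc_measurable.
apply: measurable_funTS; apply: continuous_measurable_fun; exact: continuous_dens.
Qed.

(* A geometric variable is the integer part of an exponential one. *)
Lemma geo_integral (phi : nat -> R) : bnd phi ->
  (\int[mu]_(x in `[0%R, +oo[) (dens th x * phi (Num.truncn (q * x)))%:E = (geo rho phi)%:E)%E.
Proof.
move=> bphi; have [M hM] := bphi.
have th0 := grate_gt0.
pose F (k : nat) : set R := `[k%:R / q, k.+1%:R / q[%classic.
have FE : \bigcup_k F k = `[0%R, +oo[%classic.
  apply/seteqP; split => x /=.
    move=> [k _]; rewrite /F/= !in_itv/= andbT => /andP[kx _].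
    by apply: le_trans kx; rewrite divr_ge0// ltW.
  rewrite in_itv/= andbT => x0; exists (Num.truncn (q * x)) => //.
  rewrite /F/= in_itv/= ler_pdivrMr// ltr_pdivlMr// (mulrC x).
  by rewrite truncn_le ?truncnS_gt// mulr_ge0// ltW.
have F_trunc k x : F k x -> Num.truncn (q * x) = k.
  rewrite /F/= in_itv/= ler_pdivrMr// ltr_pdivlMr// (mulrC x) => /andP[h1 h2].
  by apply/eqP; rewrite truncn_eq ?h1// (le_trans _ h1).
have mF k : measurable (F k) by exact: measurable_itv.
have tF : trivIset setT F.
  by move=> i j _ _ [x [/F_trunc <- /F_trunc <-]].
have iD : mu.-integrable `[0%R, +oo[ (fun x => (dens th x * phi (Num.truncn (q * x)))%:E).
  apply: (@le_integrable _ _ _ mu _ _ _ (fun x => (M * dens th x)%:E)) => //.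
  - by apply/measurable_EFinP; exact: dens_trunc_measurable.
  - move=> x _; rewrite lee_fin normrM (ger0_norm (dens_ge0 th0 x)) mulrC.
    by rewrite (le_trans _ (ler_norm _))// ler_wpM2r// dens_ge0.
  - exact: (@integrableZl _ _ _ mu _ _ M _ (integrable_dens th0)).
rewrite -FE integral_bigcup//; last by rewrite FE.
have term k : (\int[mu]_(x in F k) (dens th x * phi (Num.truncn (q * x)))%:E)%E =
    ((1 - rho) * rho ^+ k * phi k)%:E.
  have kq : k%:R / q < k.+1%:R / q by rewrite ltr_pM2r ?invr_gt0// ltr_nat.
  have iF : mu.-integrable (F k) (EFin \o dens th).
    apply: (integrableS _ _ _ (integrable_dens th0)) => //; first exact: mF.
    by rewrite -FE; exact: bigcup_sup.
  transitivity (\int[mu]_(x in F k) ((phi k)%:E * (dens th x)%:E))%E.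
    by apply: eq_integral => x; rewrite inE => /F_trunc ->; rewrite EFinM muleC.
  have e : (\int[mu]_(x in F k) (dens th x)%:E = (rho ^+ k - rho ^+ k.+1)%:E)%E.
    rewrite -!exp_grate -int_dens//; apply: integral_itv_bndo_bndc.
    by have [] := integrableP _ _ _ iF.
  rewrite integralZl//; last exact: mF.
  by rewrite [X in (_ * X)%E]e -EFinM exprS; congr EFin; ring.
rewrite (eq_eseriesr (g := fun k => ((1 - rho) * rho ^+ k * phi k)%:E)).
  by apply: nneseries_EFin; exact: geo_cvg.
by move=> k _; exact: term.
Qed.

End GeoInt.

Lemma cvg_addnl_imp {U : topologicalType} (u : nat -> U) (l : U) n0 :
  u n @[n --> \oo] --> l -> u (n0 + n)%N @[n --> \oo] --> l.
Proof.
move=> h A /h [N _ hN]; exists N => // n /= Nn.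
by apply: hN; rewrite /= (leq_trans Nn)// leq_addl.
Qed.

Lemma cvg_addnl_inv {U : topologicalType} (u : nat -> U) (l : U) n0 :
  u (n0 + n)%N @[n --> \oo] --> l -> u n @[n --> \oo] --> l.
Proof.
move=> h A /h [N _ hN]; exists (n0 + N)%N => // n /= Nn.
have nn : (n0 <= n)%N by rewrite (leq_trans _ Nn)// leq_addr.
by rewrite -(subnKC nn); apply: hN; rewrite /= leq_subRL.
Qed.

Section Limit.
Context {R : realType}.
Local Notation mu := (@lebesgue_measure R).
Implicit Types (z : nat -> R) (g : (nat -> R) -> R).

(** Mirrors [iexp] with geometric variables in units of 1/q; [k.+1] is the gap that [build] creates
    from k. *)
Fixpoint gexp (rho : nat -> R) (q : R) m g z : R :=
  if m is m'.+1 then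
    geo (rho m') (fun k => gexp rho q m' g (fun j => if j == m' then k.+1%:R / q else z j))
  else g z.

Lemma gexp_norm rho q m g z M : (forall j, (j < m)%N -> 0 < rho j < 1) ->
  (forall z, `|g z| <= M) -> `|gexp rho q m g z| <= M.
Proof.
elim: m z => [|m IH] z hr gM //=; have /andP[r0 r1] := hr m (ltnSn m).
by apply: geo_norm => // k; apply: IH => // j jm; apply: hr; exact: ltnW.
Qed.

Variables (q : nat -> R) (rho : nat -> nat -> R) (lam : nat -> R) (g : (nat -> R) -> R) (M : R).
Variable m0 : nat.
Hypothesis q0 : forall n, 0 < q n.
Hypothesis qinf : (q n)^-1 @[n --> \oo] --> 0.
Hypothesis hrho : forall n j, (j < m0)%N -> 0 < rho n j < 1.
Hypothesis lam0 : forall j, (j < m0)%N -> 0 < lam j.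
Hypothesis hlam : forall j, (j < m0)%N -> grate_of (rho n j) (q n) @[n --> \oo] --> lam j.
Hypothesis gM : forall z, `|g z| <= M.
Hypothesis gc : forall (zn : nat -> nat -> R) z,
  (forall j, zn n j @[n --> \oo] --> z j) -> g (zn n) @[n --> \oo] --> g z.

Lemma trunc_cvg (x : R) : 0 <= x -> (Num.truncn (q n * x)).+1%:R / q n @[n --> \oo] --> x.
Proof.
move=> x0.
have h : (q n)^-1 + x @[n --> \oo] --> 0 + x by apply: cvgD => //; exact: cvg_cst.
rewrite add0r in h; apply: (squeeze_cvgr _ (cvg_cst x) h); apply: nearW => n.
have qx : 0 <= q n * x by rewrite mulr_ge0// ltW.
rewrite ler_pdivlMr// ler_pdivrMr// mulrDl mulVf ?gt_eqF// (mulrC x) -natr1.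
by rewrite natr1 (ltW (truncnS_gt _))/= -natr1 addrC lerD2l truncn_le.
Qed.

(** The integrand in the last coordinate depends on n itself, so the induction is stated as
    continuous convergence, along all converging sequences of arguments. [geo_integral] turns the
    geometric means into integrals over a fixed domain, where dominated convergence applies. *)
Lemma gexp_cvg m : (m <= m0)%N -> forall (zn : nat -> nat -> R) z,
  (forall j, zn n j @[n --> \oo] --> z j) ->
  gexp (rho n) (q n) m g (zn n) @[n --> \oo] --> iexp lam m g z.
Proof.
elim: m => [|m IH] mm0 zn z hz; first exact: gc.
have {}IH := IH (ltnW mm0).
have M0 : 0 <= M by apply: le_trans (gM (fun=> 0)).
pose th n := grate_of (rho n m) (q n).
have l0 := lam0 mm0.
have r01 n : 0 < rho n m /\ rho n m < 1 by apply/andP; exact: hrho.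
pose phi n k := gexp (rho n) (q n) m g (fun j => if j == m then k.+1%:R / q n else zn n j).
have phiM n k : `|phi n k| <= M.
  by apply: gexp_norm => // j jm; apply: hrho; exact: ltn_trans mm0.
have bphi n : bnd (phi n) by exists M.
pose D : set R := `[0%R, +oo[%classic.
pose f n (x : R) := (dens (th n) x * phi n (Num.truncn (q n * x)))%:E.
pose f0 (x : R) := (dens (lam m) x * iexp lam m g (fun j => if j == m then x else z j))%:E.
(* For th n between lam m / 2 and 2 lam m, the density is at most 2 lam m exp(- lam m x / 2), which
   is 4 times the density of rate lam m / 2. *)
pose G (x : R) := (M * 4 * dens (lam m / 2) x)%:E.
have hth : th n @[n --> \oo] --> lam m by exact: hlam.
have [n0 _ hn0] : \forall n \near \oo, lam m / 2 <= th n /\ th n <= 2 * lam m.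
  near=> n; split; near: n.
    by apply: (cvgr_ge _ hth); rewrite ltr_pdivrMr// ltr_pMr// ltr1n.
  by apply: (cvgr_le _ hth); rewrite ltr_pMl// ltr1n.
have l20 : 0 < lam m / 2 by rewrite divr_gt0.
have mD : measurable D by exact: measurable_itv.
have mf n : measurable_fun D (f (n0 + n)%N).
  apply/measurable_EFinP; by apply: dens_trunc_measurable; exact: q0.
have ff x : D x -> f (n0 + n)%N x @[n --> \oo] --> f0 x.
    rewrite /D/= in_itv/= andbT => x0.
    have h : f n x @[n --> \oo] --> f0 x.
      apply: cvg_EFin; first exact: nearW.
      apply: cvgM; last first.
        apply: IH => j; case: eqP => // _; exact: trunc_cvg.
      rewrite /dens; apply: cvgM => //; apply: continuous_cvg; first exact: continuous_expR.
      by apply: cvgN; apply: cvgMr_tmp.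
    exact: (cvg_addnl_imp n0 h).
have fG x : D x -> G x \is a fin_num by [].
have iG : mu.-integrable D G.
  apply: (@eq_integrable _ _ _ mu _ (measurable_itv _) (fun x => (M * 4)%:E * (dens (lam m / 2) x)%:E)%E).
      by move=> x _; rewrite -EFinM.
    apply: integrableZl => //; exact: integrable_dens.
have fle n x : D x -> (`|f (n0 + n)%N x| <= G x)%E.
    rewrite /D/= in_itv/= andbT => x0.
    have [t1 t2] := hn0 (n0 + n)%N (leq_addr _ _).
    rewrite lee_fin normrM (mulrC M 4) -mulrA (mulrC M) mulrA.
    have t0 : 0 < th (n0 + n)%N by exact: lt_le_trans t1.
    apply: ler_pM => //; rewrite ger0_norm ?dens_ge0// /dens.
    apply: (@le_trans _ _ (2 * lam m * expR (- (lam m / 2 * x)))).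
      apply: ler_pM => //; first exact: ltW.
      by rewrite ler_expR lerN2 ler_wpM2r.
    by rewrite le_eqVlt; apply/orP; left; apply/eqP; field.
have dc : (\int[mu]_(x in D) f (n0 + n)%N x)%E @[n --> \oo] --> (\int[mu]_(x in D) f0 x)%E.
  apply: (@dominated_cvg _ _ _ mu D _ (fun n => f (n0 + n)%N) f0 G);
    [exact: mD | exact: mf | exact: ff | exact: fG | exact: iG | exact: fle].
have fE n : (\int[mu]_(x in D) f n x)%E = (geo (rho n m) (phi n))%:E.
  by have [h1 h2] := r01 n; apply: geo_integral.
have gE : geo (rho (n0 + n)%N m) (phi (n0 + n)%N) @[n --> \oo] --> iexp lam m.+1 g z.
  have dc' : (geo (rho (n0 + n)%N m) (phi (n0 + n)%N))%:E @[n --> \oo] --> (\int[mu]_(x in D) f0 x)%E.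
    by move: dc; under eq_fun do rewrite fE.
  have fin : (\int[mu]_(x in D) f0 x)%E \is a fin_num.
    apply: integrable_fin_num; first exact: mD.
    apply: (@lebesgue_integral_dominated_convergence.dominated_integrable _ _ _ mu D _
      (fun n => f (n0 + n)%N) f0 G);
      [exact: mD | exact: mf | exact: ff | exact: iG | exact: fle].
  rewrite -(fineK fin) in dc'.
  have -> : iexp lam m.+1 g z = fine (\int[mu]_(x in D) f0 x)%E by [].
  exact: (fine_cvg dc').
exact: (cvg_addnl_inv gE).
Unshelve. all: end_near.
Qed.

End Limit.

Section Reorder.
Context {R : realType}.

(** Splitting off the first N values of one variable leaves the two orders of summation equal up to
    the remaining weight r1^N; letting N grow exchanges them. *)
Lemma geo_swap_bound (r1 r2 : R) (f : nat -> nat -> R) M N :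
  0 < r1 -> r1 < 1 -> 0 < r2 -> r2 < 1 -> (forall k l, `|f k l| <= M) ->
  `|geo r1 (fun k => geo r2 (f k)) - geo r2 (fun l => geo r1 (fun k => f k l))| <=
    r1 ^+ N * (2 * M).
Proof.
move=> p1 l1 p2 l2; elim: N f => [|N IH] f fM.
  rewrite expr0 mul1r (_ : 2 * M = M + M); last by ring.
  apply: le_trans (ler_normB _ _) _; apply: lerD;
    by apply: geo_norm => // k; apply: geo_norm => // l.
have b1 : bnd (fun k => geo r2 (f k)) by exists M => k; apply: geo_norm.
have b2 : bnd (f 0%N) by exists M.
have b3 : bnd (fun l => geo r1 (fun k => f k.+1 l)) by exists M => k; apply: geo_norm.
rewrite (geo_shift p1 l1 b1).
have -> : geo r2 (fun l => geo r1 (fun k => f k l)) =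
    (1 - r1) * geo r2 (f 0%N) + r1 * geo r2 (fun l => geo r1 (fun k => f k.+1 l)).
  rewrite -(geoZ p2 l2 (1 - r1) b2) -(geoZ p2 l2 r1 b3) -geoD//; congr geo; apply/funext => l.
  have bl : bnd (fun k => f k l) by exists M.
  by rewrite (geo_shift p1 l1 bl).
rewrite opprD addrACA subrr add0r -mulrBr normrM gtr0_norm// exprS -mulrA.
by rewrite ler_wpM2l ?(ltW p1)//; apply: IH.
Qed.

Lemma geo_swap (r1 r2 : R) (f : nat -> nat -> R) M :
  0 < r1 -> r1 < 1 -> 0 < r2 -> r2 < 1 -> (forall k l, `|f k l| <= M) ->
  geo r1 (fun k => geo r2 (f k)) = geo r2 (fun l => geo r1 (fun k => f k l)).
Proof.
move=> p1 l1 p2 l2 fM; apply/eqP; rewrite -subr_eq0 -normr_le0.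
have h : r1 ^+ N * (2 * M) @[N --> \oo] --> 0.
  rewrite -(mul0r (2 * M)); apply: cvgMr_tmp; apply: cvg_expr.
  by rewrite ger0_norm// ltW.
apply: cvgr_to_ge h _; apply: nearW => N; exact: geo_swap_bound.
Qed.

Context {I : eqType} (rho : I -> R).
Hypotheses (rho0 : forall i, 0 < rho i) (rho1 : forall i, rho i < 1).

Lemma Pm_eq_off (s : seq I) (f g : (I -> nat) -> R) y :
  (forall z, (forall i, i \notin s -> z i = y i) -> f z = g z) ->
  Pm rho s f y = Pm rho s g y.
Proof.
elim: s y => [|i s IH] y fg /=; first exact: fg.
congr geo; apply/funext => k; apply: IH => z hz; apply: fg => j.
rewrite inE negb_or => /andP[ji js]; rewrite hz// /upd (negbTE ji)//.
Qed.

Lemma Pm_rcons (s : seq I) i (f : (I -> nat) -> R) M y :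
  i \notin s -> (forall z, `|f z| <= M) -> Pm rho (i :: s) f y = Pm rho (rcons s i) f y.
Proof.
move=> + fM; elim: s y => [|j s IH] y //=.
rewrite inE negb_or => /andP[ij si].
rewrite (@geo_swap _ _ _ M)//; last by move=> k l; exact: Pm_norm.
congr geo; apply/funext => l; rewrite -IH//=; congr geo; apply/funext => k; congr Pm.
apply/funext => z; rewrite /upd; case: (eqVneq z i) => [->|//].
by rewrite (negbTE ij).
Qed.

Lemma Pm_rev (s : seq I) (f : (I -> nat) -> R) M y :
  uniq s -> (forall z, `|f z| <= M) -> Pm rho (rev s) f y = Pm rho s f y.
Proof.
move=> + fM; elim: s y => [|i s IH] y //= /andP[si us].
rewrite rev_cons -(@Pm_rcons _ _ _ M)//=; last by rewrite mem_rev.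
by congr geo; apply/funext => k; rewrite IH.
Qed.

Lemma Pm_NG (s : seq I) (G : seq nat -> R) y : uniq s ->
  Pm rho s (fun z => G (map z s)) y = NG (map rho s) G.
Proof.
elim: s G y => [|i s IH] G y //= /andP[si us]; congr geo; apply/funext => k.
rewrite -(IH _ (upd y i k))//; apply: Pm_eq_off => z hz /=.
by rewrite hz// /upd eqxx.
Qed.

End Reorder.

Section GapMean.
Context {R : realType}.

(** [gexp] averages over the highest coordinate outermost, hence the reversed list. *)
Lemma gexp_Pm (rho : nat -> R) (q : R) m (g : (nat -> R) -> R) (z : nat -> R) (y : nat -> nat) :
  gexp rho q m g z = Pm rho (rev (iota 0 m))
    (fun y => g (fun j => if (j < m)%N then (y j).+1%:R / q else z j)) y.
Proof.
elim: m z y => [//|m IH] z y; rewrite [gexp _ _ _ _ _]/=.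
have -> : iota 0 m.+1 = rcons (iota 0 m) m by rewrite -addn1 iotaD cats1.
rewrite rev_rcons /=; congr geo; apply/funext => k.
rewrite (IH _ (upd y m k)); apply: Pm_eq_off => x hx; congr g; apply/funext => j.
rewrite (ltnS j m) (leq_eqVlt j m); have [->|jm] /= := eqVneq j m; last by [].
by rewrite ltnn hx ?/upd ?eqxx// mem_rev mem_iota add0n ltnn andbF.
Qed.

Lemma size_build ks : size (build ks) = size ks.
Proof. by elim: ks => //= k ks IH; rewrite size_map IH. Qed.

Lemma build_gap j0 ks j : (j < size ks)%N ->
  (nth 0 (build (j0 :: ks)) j.+1 - nth 0 (build (j0 :: ks)) j)%N = (nth 0 ks j).+1.
Proof.
elim: j j0 ks => [|j IH] j0 [|k ks] //; first by move=> _; rewrite /= addSn -addnS addKn.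
move=> jk; rewrite -[RHS](IH k ks jk).
change (nth 0%N (map (addn j0.+1) (build (k :: ks))) j.+1 -
  nth 0%N (map (addn j0.+1) (build (k :: ks))) j = 
  nth 0%N (build (k :: ks)) j.+1 - nth 0%N (build (k :: ks)) j)%N.
by rewrite !(nth_map 0%N) ?subnDl ?size_build// ltnW.
Qed.

Lemma NG_eq_size (rs : seq R) (G H : seq nat -> R) :
  (forall s, size s = size rs -> G s = H s) -> NG rs G = NG rs H.
Proof.
elim: rs G H => [|r rs IH] G H h /=; first exact: h.
by congr geo; apply/funext => k; apply: IH => s sz; apply: h; rewrite /= sz.
Qed.

Lemma powers_iota (r : R) m : powers r m = map (fun i => r ^+ (m - i.+1).+1) (iota 0 m).
Proof.
elim: m => //= m ->; rewrite subSS subn0; congr cons.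
have -> : iota 1 m = map S (iota 0 m) by rewrite -[RHS](iotaDl 1 0).
by rewrite -map_comp; apply: eq_map => i /=; rewrite subSS.
Qed.

Definition gap_row (q : R) m (s : seq nat) : 'rV[R]_m :=
  \row_(j < m) ((nth 0%N s j.+1 - nth 0%N s j)%N%:R / q).

(** The first ratio in [powers r m.+1] is that of the minimum, which the gaps do not see and which
    averages out; the ratios r^m, ..., r left over belong to the m gaps. *)
Lemma gap_mean (r q : R) m (f : 'rV[R]_m -> R) M (z : nat -> R) : 0 < r -> r < 1 ->
  (forall x, `|f x| <= M) ->
  `|Em r (fun y : 'I_m.+1 -> nat => f (gap_row q m (sort leq (map y (index_enum 'I_m.+1))))) -
    gexp (fun i => r ^+ (m - i.+1).+1) q m (fun z => f (\row_(j < m) z j)) z|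
  <= @renyi_cst R m.+1 * (1 - r) * M.
Proof.
move=> r0 r1 fM.
pose h s := f (gap_row q m s).
have -> : Em r (fun y : 'I_m.+1 -> nat => f (gap_row q m (sort leq (map y (index_enum 'I_m.+1))))) =
    NG (nseq m.+1 r) (fun s => h (sort leq s)).
  rewrite /Em (@Pm_NG _ _ _ _ (fun s => h (sort leq s))) ?index_enum_uniq//.
  have sz : size (index_enum 'I_m.+1) = m.+1.
    by rewrite -sum1_size big_const_ord iter_addn mul1n addn0.
  have nse (U : Type) (s : seq U) : [seq r | _ <- s] = nseq (size s) r.
    by elim: s => //= x s ->.
  by rewrite nse sz.
suff -> : gexp (fun i => r ^+ (m - i.+1).+1) q m (fun z => f (\row_(j < m) z j)) z =
    NG (powers r m.+1) (fun ks => h (build ks)) by apply: renyi => // s; exact: fM.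
rewrite [RHS]/=.
have e j0 : NG (powers r m) (fun ks => h (build (j0 :: ks))) =
    NG (powers r m) (fun ks => f (\row_(j < m) ((nth 0%N ks j).+1%:R / q))).
  apply: NG_eq_size => s; rewrite powers_iota size_map size_iota => sz.
  by congr f; apply/rowP => j; rewrite !mxE build_gap// sz.
have -> : (fun k => NG (powers r m) (fun s => h (k :: [seq (k.+1 + i)%N | i <- build s]))) =
   fun=> NG (powers r m) (fun ks => f (\row_(j < m) ((nth 0%N ks j).+1%:R / q))).
  by apply/funext => k; exact: e.
rewrite geo_cst ?exprn_gt0 ?exprn_ilt1 ?(ltW r0)//.
have hp i : 0 < r ^+ (m - i.+1).+1 by rewrite exprn_gt0.
have hl i : r ^+ (m - i.+1).+1 < 1 by rewrite exprn_ilt1 ?(ltW r0).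
rewrite (gexp_Pm _ _ _ _ _ (fun=> 0%N)) (@Pm_rev _ _ _ hp hl _ _ M) ?iota_uniq//.
rewrite powers_iota -(@Pm_NG _ _ _ _ _ (fun=> 0%N)) ?iota_uniq//.
congr Pm; apply/funext => y; congr f; apply/rowP => j; rewrite !mxE ltn_ord.
by rewrite (nth_map 0%N) ?size_iota// nth_iota.
Qed.

End GapMean.

(** * Conclusion *)

Section GapFunction.
Context {R : realType} (m : nat).
Local Notation St := ('I_m.+1 -> nat).
Implicit Types (y : St) (q : R).

Definition sortst y : seq nat := sort leq (map y (index_enum 'I_m.+1)).
Definition gaps y : seq nat := [seq (nth 0 (sortst y) j.+1 - nth 0 (sortst y) j)%N | j <- iota 0 m].
(** Coding the gap vector as a natural number lets the limit laws of all n live on [nat]; the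
    scaling is left to the decoding. *)
Definition gcode y : nat := pickle (gaps y).
Definition gdecode q (k : nat) : 'rV[R]_m :=
  \row_(j < m) ((nth 0%N (odflt [::] (unpickle k : option (seq nat))) j)%:R / q).

Lemma index_enum_ord : perm_eq (index_enum 'I_m.+1) (enum 'I_m.+1).
Proof.
by apply: uniq_perm; rewrite ?index_enum_uniq ?enum_uniq// => i; rewrite mem_index_enum mem_enum.
Qed.

Lemma gdecode_gcode q y : gdecode q (gcode y) = gap_row q m (sortst y).
Proof.
apply/rowP => j; rewrite !mxE /gcode pickleK /=; congr (_%:R / _).
by rewrite /gaps (nth_map 0%N) ?size_iota// nth_iota.
Qed.

Lemma size_sortst y : size (sortst y) = m.+1.
Proof.
by rewrite size_sort size_map (perm_size index_enum_ord) size_enum_ord.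
Qed.

Lemma sortst_perm (s : 'S_m.+1) y : sortst (y \o s) = sortst y.
Proof.
apply/(perm_sortP leq_total leq_trans anti_leq); rewrite map_comp perm_map//.
apply: uniq_perm; rewrite ?index_enum_uniq// ?(map_inj_uniq perm_inj) ?index_enum_uniq// => i.
rewrite mem_index_enum; apply/mapP; exists (s^-1 i)%g; first by rewrite mem_index_enum.
by rewrite permKV.
Qed.

Lemma sortst_upall y : sortst (upall y) = map S (sortst y).
Proof.
rewrite /sortst (_ : map (upall y) _ = map S (map y (index_enum 'I_m.+1))); last first.
  by rewrite -map_comp.
apply: (sorted_eq leq_trans anti_leq).
- exact: sort_sorted leq_total _.
- rewrite sorted_map; apply: sub_sorted (sort_sorted leq_total _) => i j /=.
  by rewrite ltnS.
- by rewrite perm_sort perm_map// perm_sym perm_sort.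
Qed.

Lemma gcode_upall y : gcode (upall y) = gcode y.
Proof.
rewrite /gcode; congr pickle; apply/eq_in_map => j; rewrite mem_iota add0n => /andP[_ jm].
by rewrite sortst_upall !(nth_map 0%N) ?size_sortst ?subSS// ltnW.
Qed.

Lemma sortst_ordered y (i : 'I_m.+1) : ordered y -> nth 0%N (sortst y) i = y i.
Proof.
move=> oy; have -> : sortst y = map y (enum 'I_m.+1).
  apply: (sorted_eq leq_trans anti_leq).
  - exact: sort_sorted leq_total _.
  - rewrite sorted_map; have : sorted ltn (map val (enum 'I_m.+1)).
      by rewrite val_enum_ord iota_ltn_sorted.
    by rewrite sorted_map; apply: sub_sorted => j k /= jk; apply: oy; exact: ltnW.
  - by rewrite perm_sort perm_map// index_enum_ord.
by rewrite (nth_map i) ?size_enum_ord// nth_ord_enum.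
Qed.

(** The gaps as the model takes them, in the given order and with real subtraction; on ordered
    states they agree with those of the sorted state. *)
Definition gap_raw q y : 'rV[R]_m :=
  \row_(j < m) (((ext y j.+2)%:R - (ext y j.+1)%:R) / q).

Lemma gap_raw_ordered q y : ordered y -> gap_row q m (sortst y) = gap_raw q y.
Proof.
move=> oy; apply/rowP => j; rewrite !mxE; congr (_ / _).
have h1 : (j.+1 < m.+1)%N by rewrite ltnS.
have h0 : (j < m.+1)%N by exact: ltnW.
rewrite -[j.+1 in RHS]/((Ordinal h0).+1) -[j.+2]/((Ordinal h1).+1) !extE.
rewrite -(sortst_ordered (Ordinal h0) oy) -(sortst_ordered (Ordinal h1) oy) /= natrB//.
have := oy (Ordinal h0) (Ordinal h1) (leqnSn _).
by rewrite -(sortst_ordered (Ordinal h0) oy) -(sortst_ordered (Ordinal h1) oy).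
Qed.

Lemma gap_raw_rst q (x : nat -> nat) :
  gap_raw q (rst x) = \row_(j < m) (((x j.+2)%:R - (x j.+1)%:R) / q).
Proof.
apply/rowP => j; rewrite !mxE.
have h1 : (0 < j.+1 <= m.+1)%N by rewrite /= ltnS ltnW.
have h2 : (0 < j.+2 <= m.+1)%N by rewrite /= ltnS.
by rewrite (ext_rst x h1) (ext_rst x h2).
Qed.

End GapFunction.

Section Rates.
Context {R : realType} (K : nat) (a b : R).
Hypotheses (K0 : (0 < K)%N) (a0 : 0 <= a) (b0 : 0 < b).
Variable q : nat -> R.
Hypothesis hq : forall n, qmin a b <= q n.
Hypothesis qinf : (q n)^-1 @[n --> \oo] --> 0.

Let q1 n : 1 + 2 * a + 2 * b <= q n. Proof. exact: hq. Qed.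
Let q0 n : 0 < q n. Proof. by apply: lt_le_trans (q1 n); move: a0 b0; lra. Qed.

Lemma ratio_cvg : 1 - ratio K a b (q n) @[n --> \oo] --> 0.
Proof.
have h : 2 * b * (q n)^-1 @[n --> \oo] --> 0.
  by rewrite -(mulr0 (2 * b)); apply: cvgMl_tmp.
apply: (squeeze_cvgr _ (cvg_cst 0) h); apply: nearW => n.
have r0 := ratio_gt0 K a0 b0 (hq n); have r1 := ratio_lt1 K0 a0 b0 (hq n).
rewrite subr_ge0 (ltW r1)/=; apply: le_trans (slack_le K0 a0 b0 (hq n)).
rewrite /slack; move: (ratio _ _ _ _) r0 r1 => r r0 r1.
have -> : r^-1 - 1 = (1 - r) / r by field; rewrite gt_eqF.
by rewrite ler_peMr ?subr_ge0 ?(ltW r1)// invf_ge1// ltW.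
Qed.

(** Here - q ln r = q ln (1 + x) / K with x = b q / lambda = b / (q - a), and x / (1 + x) <= ln (1 +
    x) <= x squeezes it between sequences tending to b / K. *)
Lemma ln_ratio_cvg : - (q n * ln (ratio K a b (q n))) @[n --> \oo] --> b / K%:R.
Proof.
have Kp : 0 < K%:R :> R by rewrite ltr0n.
pose lo n := b / K%:R / (1 + (b - a) * (q n)^-1).
pose hi n := b / K%:R / (1 - a * (q n)^-1).
have clo : lo n @[n --> \oo] --> b / K%:R.
  rewrite -[X in _ --> X]divr1; apply: cvgMl_tmp; apply: cvgV; first exact: oner_neq0.
  rewrite -[X in _ --> X]addr0; apply: cvgD; first exact: cvg_cst.
  by rewrite -(mulr0 (b - a)); apply: cvgMl_tmp.
have chi : hi n @[n --> \oo] --> b / K%:R.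
  rewrite -[X in _ --> X]divr1; apply: cvgMl_tmp; apply: cvgV; first exact: oner_neq0.
  rewrite -[X in _ --> X]subr0; apply: cvgB; first exact: cvg_cst.
  by rewrite -(mulr0 a); apply: cvgMl_tmp.
apply: (squeeze_cvgr _ clo chi); apply: nearW => n.
have r0 := ratio_gt0 K a0 b0 (hq n).
have l0 : 0 < lam a (q n) by exact: (@lam_gt0 _ a b).
pose x := b * q n / lam a (q n).
have x0 : 0 < x by rewrite divr_gt0// mulr_gt0.
have qa : 0 < q n - a by move: (q1 n) a0 b0; lra.
have xE : x = b / (q n - a).
  by rewrite /x /lam; field; rewrite !gt_eqF//= expr2 -mulrBl mulr_gt0.
have e : K%:R * ln (ratio K a b (q n)) = - ln (1 + x).
  rewrite mulr_natl -lnXn// (ratioK K0 a0 b0 (hq n)) -lnV ?posrE ?addr_gt0//; congr ln.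
  by rewrite /x; field; rewrite !gt_eqF//= addr_gt0// mulr_gt0.
have up : ln (1 + x) <= x by apply: le_ln1Dx; apply: lt_trans x0.
have dn : x / (1 + x) <= ln (1 + x).
  have h : -1 < - x / (1 + x).
    by rewrite ltr_pdivlMr ?addr_gt0//; move: x0; lra.
  have := le_ln1Dx h; have -> : 1 + - x / (1 + x) = (1 + x)^-1.
    by field; rewrite gt_eqF ?addr_gt0.
  rewrite lnV ?posrE ?addr_gt0// mulNr lerN2; exact.
have -> : - (q n * ln (ratio K a b (q n))) = q n / K%:R * ln (1 + x).
  by rewrite -[ln (1 + x)]opprK -e; field; rewrite gt_eqF.
have qK : 0 < q n / K%:R by rewrite divr_gt0.
have hin : hi n = q n / K%:R * x.
  by rewrite /hi xE; field; rewrite !gt_eqF.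
have lon : lo n = q n / K%:R * (x / (1 + x)).
  rewrite /lo xE; field; rewrite !gt_eqF//.
  by move: (q1 n) a0 b0; lra.
by rewrite hin lon !ler_pM2l// up dn.
Qed.

End Rates.

Lemma row_cvg {R : realType} m (f : 'rV[R]_m -> R) : continuous f ->
  forall (zn : nat -> nat -> R) z, (forall j, zn n j @[n --> \oo] --> z j) ->
  f (\row_(j < m) zn n j) @[n --> \oo] --> f (\row_(j < m) z j).
Proof.
move=> cf zn z hz.
apply: (cvg_comp (fun n => \row_(j < m) zn n j) f); last exact: cf.
apply/cvg_ballP => e e0.
have : \forall n \near \oo, forall j : 'I_m, ball (z j) e (zn n j).
  by apply: filter_forall => j; move/cvg_ballP: (hz j); exact.
by apply: filterS => n h; split=> // i j; rewrite !mxE.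
Qed.

Section Assembly.
Context {R : realType} (m : nat) (a b : R).
Local Notation K := m.+1.
Hypotheses (a0 : 0 <= a) (aK : a * K%:R < b).
Local Notation St := ('I_m.+1 -> nat).
Let b0 : 0 < b. Proof. by apply: le_lt_trans aK; rewrite mulr_ge0. Qed.
Let K0 : (0 < K)%N := ltn0Sn m.

(** With the absolute value the sum dominates both thresholds of the stationary law at once. *)
Definition sqrt_min : R := qmin a b +
  `|16 * @C6 R 'I_K b (2 * b + a) (4 ^+ K * (2 * b) ^+ 2) (2 * b) (2 * b) (b / (K%:R + 4 ^+ K))|.
Definition size_min : nat := (Num.truncn (sqrt_min ^+ 2 + a ^+ 2)).+1.

Let qm0 : 0 <= qmin a b. Proof. by rewrite /qmin; move: a0 b0; lra. Qed.
Let sm0 : 0 <= sqrt_min. Proof. by rewrite addr_ge0. Qed.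

Lemma size_min_lt n : (size_min <= n)%N -> sqrt_min ^+ 2 + a ^+ 2 < n%:R.
Proof.
move=> h; apply: (lt_le_trans (truncnS_gt _)); by rewrite ler_nat.
Qed.

Lemma size_min_a n : (size_min <= n)%N -> a ^+ 2 < n%:R.
Proof. by move=> /size_min_lt; apply: le_lt_trans; rewrite lerDr sqr_ge0. Qed.

Lemma size_min_sqrt n : (size_min <= n)%N -> sqrt_min <= Num.sqrt n%:R.
Proof.
move=> /size_min_lt h; rewrite -[X in X <= _](ger0_norm sm0) -sqrtr_sqr ler_wsqrtr// ltW//.
by apply: le_lt_trans h; rewrite lerDl sqr_ge0.
Qed.

Lemma sqrt_min_q q : sqrt_min <= q -> qmin a b <= q.
Proof. by apply: le_trans; rewrite lerDl. Qed.

Lemma sqrt_min_C q : sqrt_min <= q ->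
  16 * @C6 R 'I_K b (2 * b + a) (4 ^+ K * (2 * b) ^+ 2) (2 * b) (2 * b) (b / (K%:R + 4 ^+ K)) <= q.
Proof. by apply: le_trans; apply: le_trans (ler_norm _) _; rewrite lerDr. Qed.

Section Stat.
Variable q : R.
Hypothesis hq : sqrt_min <= q.
Let hq1 := sqrt_min_q hq.
Let hq2 := sqrt_min_C hq.

Lemma bnd_max0 (T : Type) (u : T -> R) : bnd u -> bnd (fun y => Num.max (u y) 0).
Proof.
move=> [M uM]; exists M => y; apply: le_trans (uM y); move: (u y) => x.
by rewrite maxEle; case: (x <= 0); rewrite ?normr0.
Qed.

Lemma stat_maxB (u : St -> R) : bnd u -> (forall y, u (upall y) = u y) ->
  stat a b q (fun y => Num.max (u y) 0) - stat a b q (fun y => Num.max (- u y) 0) = stat a b q u.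
Proof.
move=> bu iu; have bp := bnd_max0 bu.
have bn : bnd (fun y => Num.max (- u y) 0).
  by apply: bnd_max0; have [M uM] := bu; exists M => y; rewrite normrN.
have ip y : Num.max (u (upall y)) 0 = Num.max (u y) 0 by rewrite iu.
have in' y : Num.max (- u (upall y)) 0 = Num.max (- u y) 0 by rewrite iu.
rewrite -(statB K0 a0 aK hq1 hq2 bp ip bn in'); congr stat; apply/funext => y.
rewrite !maxEle; move: (u y) => x; by case: (leP x 0); case: (leP (- x) 0); lra.
Qed.

Lemma gap_law : exists P : probability nat R, forall g : nat -> R, bnd g ->
  expect P g = stat a b q (fun y : St => g (gcode y)).
Proof.
have pp k : 0 <= law_p a b q (@gcode m) k.
  exact: (law_p_ge0 K0 a0 aK hq1 hq2 (@gcode_upall m)).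
have lc := law_cvg K0 a0 aK hq1 hq2 (@gcode_upall m).
pose p k : {nonneg R} := NngNum (pp k).
have h1 : dmeas p setT = 1%E.
  apply: dmeas_setT; have b1 : bnd (fun _ : nat => 1 : R) by exists 1 => k; rewrite normr1.
  have := lc _ b1; rewrite (@stat_cst R m.+1 a b).
  by under eq_fun do rewrite mulr1.
exists (dprob h1) => g bg.
have bn : bnd (fun k => - g k) by have [M gM] := bg; exists M => k; rewrite normrN.
rewrite (expect_dprob h1 (lc _ (bnd_max0 bg)) (lc _ (bnd_max0 bn))) stat_maxB//.
by move=> y; rewrite gcode_upall.
Qed.

End Stat.

Lemma Var_le (r M : R) (u : St -> R) : 0 < r -> r < 1 -> (forall y, `|u y| <= M) ->
  Var r u <= M ^+ 2.
Proof.
move=> r0 r1 uM; rewrite /Var lerBlDr; apply: (@le_trans _ _ (M ^+ 2)); last first.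
  by rewrite lerDl sqr_ge0.
apply: le_trans (ler_norm _) _; apply: Em_norm => // y.
by rewrite normrX lerXn2r ?nnegrE// (le_trans _ (uM y)).
Qed.

Lemma sqrt_inv_cvg : (Num.sqrt (size_min + n)%:R : R)^-1 @[n --> \oo] --> 0.
Proof.
have h : (size_min + n)%:R^-1 @[n --> \oo] --> (0 : R).
  rewrite /size_min; exact: (cvg_addnl_imp (Num.truncn (sqrt_min ^+ 2 + a ^+ 2)) cvg_harmonic).
rewrite (_ : (fun n => _) = fun n => Num.sqrt (size_min + n)%:R^-1).
  rewrite -[X in _ --> X]sqrtr0; apply: continuous_cvg h; exact: sqrt_continuous.
by apply/funext => n; rewrite sqrtrV.
Qed.

Lemma stat_gap_cvg (f : 'rV[R]_m -> R) M : continuous f -> (forall x, `|f x| <= M) ->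
  stat a b (Num.sqrt n%:R) (fun y : St => f (gap_row (Num.sqrt n%:R) m (sortst y)))
    @[n --> \oo] --> prod_exp_expect (limit_rates K b) f.
Proof.
move=> cf fM; apply: (cvg_addnl_inv (n0 := size_min)).
pose q n : R := Num.sqrt (size_min + n)%:R.
have hq n : sqrt_min <= q n by apply: size_min_sqrt; exact: leq_addr.
have hq1 n := sqrt_min_q (hq n); have hq2 n := sqrt_min_C (hq n).
have q0 n : 0 < q n.
  by apply: lt_le_trans (hq1 n); rewrite /qmin; move: a0 b0; lra.
have qinf : (q n)^-1 @[n --> \oo] --> 0 by exact: sqrt_inv_cvg.
have M0 : 0 <= M by apply: le_trans (fM 0).
pose r n := ratio K a b (q n).
have r0 n : 0 < r n := ratio_gt0 K a0 b0 (hq1 n).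
have r1 n : r n < 1 := ratio_lt1 K0 a0 b0 (hq1 n).
pose g (z : nat -> R) := f (\row_(j < m) z j).
pose ge n := gexp (fun i => r n ^+ (m - i.+1).+1) (q n) m g (fun=> 0).
pose st n := stat a b (q n) (fun y : St => f (gap_row (q n) m (sortst y))).
have cge : ge n @[n --> \oo] --> prod_exp_expect (limit_rates K b) f.
  apply: (@gexp_cvg R q (fun n i => r n ^+ (m - i.+1).+1) (limit_rates K b) g M m) => //.
  - by move=> n j _; rewrite exprn_gt0//= exprn_ilt1// ltW.
  - move=> j jm; rewrite /limit_rates mulr_gt0// divr_gt0// ltr0n// subn_gt0 ltnS//.
  (* The rate belonging to r^(m - j) is m - j times the one of r, which tends to b / K; with K = m +
     1 this is the limit rate. *)
  - move=> j jm; rewrite /limit_rates subSS -mulrA -(mulrC b) mulrA.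
    have -> : (m - j)%N = (m - j.+1).+1 by rewrite -subSn// subSS.
    have h : (m - j.+1).+1%:R * - (q n * ln (r n)) @[n --> \oo] --> (m - j.+1).+1%:R * (b / K%:R).
      by apply: cvgMl_tmp; exact: ln_ratio_cvg.
    rewrite -mulrA; move: h; rewrite (_ : (fun n => _ * - _) = fun n => grate_of (r n ^+ (m - j.+1).+1) (q n))//.
    by apply/funext => n; rewrite /grate_of lnXn// -mulr_natl; ring.
  - by move=> z; exact: fM.
  - by move=> zn z hz; exact: (row_cvg cf hz).
  - by move=> j; exact: cvg_cst.
pose B n := @erg_C R K a b * Num.sqrt (q n)^-1 * M + @renyi_cst R K * (1 - r n) * M.
have B0 : B n @[n --> \oo] --> 0.
  have e : 0 = erg_C K a b * 0 * M + renyi_cst K * 0 * M :> R by ring.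
  rewrite [X in _ --> X]e; apply: cvgD; apply: cvgMr_tmp; apply: cvgMl_tmp.
    by rewrite -[X in _ --> X]sqrtr0; apply: continuous_cvg qinf; exact: sqrt_continuous.
  exact: ratio_cvg.
have dB n : `|st n - ge n| <= B n.
  have bu : bnd (fun y : St => f (gap_row (q n) m (sortst y))) by exists M.
  have iu (y : St) : f (gap_row (q n) m (sortst (upall y))) = f (gap_row (q n) m (sortst y)).
    by rewrite -!gdecode_gcode gcode_upall.
  have h1 := stat_close K0 a0 aK (hq1 n) (hq2 n) bu iu.
  have h2 := gap_mean (q n) (fun=> 0) (r0 n) (r1 n) fM.
  apply: le_trans (ler_distD (Em (r n) (fun y : St => f (gap_row (q n) m (sortst y)))) _ _) _.
  apply: lerD h2; apply: (le_trans h1); rewrite -sqrtrV ?(ltW (q0 n))//.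
  rewrite ler_wpM2l ?mulr_ge0 ?sqrtr_ge0 ?normr_ge0//.
  rewrite -[leRHS](ger0_norm M0) -sqrtr_sqr ler_wsqrtr//.
  by apply: (@Var_le (r n) M _ (r0 n) (r1 n)) => y; exact: fM.
rewrite -[X in _ --> X]add0r (_ : (fun n => _) = fun n => (st n - ge n) + ge n); last first.
  by apply/funext => n; rewrite subrK.
apply: cvgD => //; apply/norm_cvg0P; apply: (squeeze_cvgr _ (cvg_cst 0) B0).
by apply: nearW => n; rewrite normr_ge0 dB.
Qed.

End Assembly.

Theorem theorem3p8 (R : realType) (K : nat) (a b : R)
  (d : measure_display) (T : measurableType d) (P : probability T R)
  (A D : nat -> T -> R -> nat) (X0 : nat -> T -> nat -> nat)
  (X : nat -> T -> R -> nat -> nat) :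
  (2 <= K)%N -> 0 <= a -> a * K%:R < b ->
  (forall i, (1 <= i <= K)%N -> rate_one_poisson P (A i) /\ rate_one_poisson P (D i)) ->
  (forall n : nat, a ^+ 2 < n%:R ->
     (forall i k, measurable [set w | X0 n w i = k]) /\
     (forall w i, (1 <= i < K)%N -> (X0 n w i <= X0 n w i.+1)%N) /\
     mutually_independent P (indep_classes K A D (X0 n)) /\
     solves_queue K n a b A D (X0 n) (X n)) ->
  exists n0 : nat,
  exists (d' : nat -> measure_display) (T' : forall n, measurableType (d' n))
         (P' : forall n, probability (T' n) R) (Zinf : forall n, T' n -> 'rV[R]_(K.-1)),
    (forall n, (n0 <= n)%N ->
       (forall w j, 0 <= Zinf n w ord0 j) /\
       (forall j, measurable_fun [set: T' n] (fun w => Zinf n w ord0 j)) /\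
       (forall f : 'rV[R]_(K.-1) -> R, bounded_continuous f ->
          expect P (fun w => f (Zc_hat K n (X n) t w)) @[t --> +oo]
            --> expect (P' n) (fun w => f (Zinf n w)))) /\
    (forall f : 'rV[R]_(K.-1) -> R, bounded_continuous f ->
       expect (P' n) (fun w => f (Zinf n w)) @[n --> \oo]
         --> prod_exp_expect (limit_rates K b) f).
Proof.
case: K => [//|m] K2 a0 aK pAD hn; rewrite -[m.+1.-1]/m.
have b0 : 0 < b by apply: le_lt_trans aK; rewrite mulr_ge0.
have law n : exists Q : probability nat R, (size_min m a b <= n)%N ->
    forall g : nat -> R, bnd g ->
    expect Q g = stat a b (Num.sqrt n%:R) (fun y : 'I_m.+1 -> nat => g (gcode y)).
  (* Below the threshold any law will do; the one at the threshold is used to make the choice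
     total. *)
  have [h|h] := leqP (size_min m a b) n; last first.
    have [Q _] := gap_law a0 aK (size_min_sqrt a0 aK (leqnn _)).
    by exists Q => h'; move: h; rewrite ltnNge => /negP.
  have [Q hQ] := gap_law a0 aK (size_min_sqrt a0 aK h).
  by exists Q.
have [Q hQ] := choice law.
exists (size_min m a b), (fun=> default_measure_display), (fun=> nat : measurableType _), Q.
exists (fun n => gdecode m (Num.sqrt n%:R)).
have EQ n (f : 'rV[R]_m -> R) : (size_min m a b <= n)%N -> bnd f ->
  expect (Q n) (fun w => f (gdecode m (Num.sqrt n%:R) w)) =
  stat a b (Num.sqrt n%:R) (fun y : 'I_m.+1 -> nat => f (gap_row (Num.sqrt n%:R) m (sortst y))).
  move=> nn [M fM]; have bg : bnd (fun w => f (gdecode m (Num.sqrt n%:R) w)) by exists M.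
  rewrite (hQ n nn _ bg).
  by congr stat; apply/funext => y; rewrite gdecode_gcode.
split; last first.
  move=> f [cf [M fM]]; have bf : bnd f by exists M.
  have := stat_gap_cvg a0 aK cf fM => /(cvg_addnl_imp (size_min m a b)) h.
  apply: (cvg_addnl_inv (n0 := size_min m a b)).
  by under eq_fun do rewrite (EQ _ f (leq_addr _ _) bf).
move=> n nn; have hq := size_min_sqrt a0 aK nn; have na := size_min_a nn.
have [mX0 [ordX0 [ind sol]]] := hn n na.
split; first by move=> w j; rewrite mxE divr_ge0 ?sqrtr_ge0.
split; first by [].
move=> f [cf [M fM]]; have bf : bnd f by exists M.
rewrite EQ//.
set q := Num.sqrt n%:R in hq *.
(* The gaps in given order, [F], are not symmetric in the queues, as the labelled chain requires;
   [Fs] sorts first. *)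
pose Fs (y : 'I_m.+1 -> nat) := f (gap_row q m (sortst y)).
pose F (y : 'I_m.+1 -> nat) := f (gap_raw q y).
have bFs : bnd Fs by exists M => y; exact: fM.
have bFn : bnd (fun y => - Fs y) by exists M => y; rewrite normrN; exact: fM.
have iFs y : Fs (upall y) = Fs y by rewrite /Fs -!gdecode_gcode gcode_upall.
have hq1 := sqrt_min_q hq; have hq2 := sqrt_min_C a0 aK hq.
rewrite (_ : (fun t => _) = fun t => expect P (fun w => F (rst (X n w t)))); last first.
  apply/funext => t; congr expect; apply/funext => w; rewrite /F; congr f.
  by rewrite gap_raw_rst.
rewrite -(stat_maxB a0 aK hq bFs iFs).
apply: (@expect_cvg _ _ _ P m.+1 n a b A D (X0 n) (X n) _ _ _ _ _ _ _ _ _ (qclk m.+1 b q)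
  _ F Fs M) => //.
- exact: (qclk_gt0 (ltn0Sn m) a0 aK hq1).
- by move=> x; exact: fM.
- by move=> s y; rewrite /Fs sortst_perm.
- by move=> x ox; rewrite /Fs /F gap_raw_ordered.
- move=> y; apply: (stat_cvg (ltn0Sn m) a0 aK hq1 hq2) => [|x]; first exact: bnd_max0.
  by rewrite iFs.
- move=> y; apply: (stat_cvg (ltn0Sn m) a0 aK hq1 hq2) => [|x]; first exact: bnd_max0.
  by rewrite iFs.
Qed.
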